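(* Let $n\ge 3$ and let $u$ be a subharmonic function in $\mathbb{R}^n$ of non-integer order $\rho$ and finite type, whose Riesz masses are distributed over the negative $x_1$-axis. Let $\mu$ be its Riesz measure, $n(t)=t^{2-n}\mu(\overline{B_t})$ its counting function, and $q$ the integer part of $\rho$. If there exists the limit $$\lim_{t\to\infty}t^{-\rho}n(t)=\mathbf{\Delta},$$ then for any $x=(r,\theta)$ with $0\le\theta_1<\pi$ there exists the limit $$\lim_{r\to\infty} r^{-\rho}u(x)=H(\theta_1).$$ This limit, that is, the indicator function of the subharmonic function $u$, is given by $$H(\theta_1)=(\rho+n-2)\,\mathbf{\Delta}\int_0^\infty s^{-\rho-1}h_n(s,\theta_1,q)\,ds .$$ Moreover, the indicator can be expressed through the associated Legendre functions of the first kind on the cut as $$H(\theta_1)=\frac{\pi\,2^{\frac{n-3}{2}}\Gamma\left(\frac{n-1}{2}\right)\prod_{k=1}^{n-2}(\rho+k)\;\mathbf{\Delta}}{(n-3)!\,\sin(\pi\rho)\,(\sin\theta_1)^{\frac{n-3}{2}}}\;P^{\frac{3-n}{2}}_{-\rho-\frac{n-1}{2}}(\cos\theta_1),$$ which, by the property $P^\mu_\nu=P^\mu_{-\nu-1}$, can be rewritten as $$H(\theta_1)=\frac{\pi\,2^{\frac{n-3}{2}}\Gamma\left(\frac{n-1}{2}\right)\prod_{k=1}^{n-2}(\rho+k)\;\mathbf{\Delta}}{(n-3)!\,\sin(\pi\rho)\,(\sin\theta_1)^{\frac{n-3}{2}}}\;P^{\frac{3-n}{2}}_{\rho+\frac{n-3}{2}}(\cos\theta_1).$$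 This last equation holds for $\theta_1=\pi$ as well, since in this case both its sides are equal to $-\infty$.
   Context: Points $x\in\mathbb{R}^n$ are written in spherical coordinates $x=(r,\theta)$, $r=|x|$, $\theta=(\theta_1,\dots,\theta_{n-1})$, with $x_1=r\cos\theta_1$, $0\le\theta_1\le\pi$ (so $\theta_1$ is the angle between $x$ and the positive $x_1$-axis). $\overline{B_t}$ is the closed ball of radius $t$ centered at the origin. The negative $x_1$-axis is the half-line $\{\theta_1=\pi\}$ issuing from the origin. The Riesz measure $\mu$ of $u$ is normalized so that locally $u(x)=-\int|x-y|^{2-n}d\mu(y)+{}$harmonic. Order $\rho$ and finite type refer to the growth of $\max_{|x|=r}u(x)$; finite type means $\max_{|x|=r}u(x)=O(r^\rho)$ as $r\to\infty$. $\mathbf{\Delta}$ is a constant. The kernel is $$h_n(s,\theta_1,q)=-\left(1+2s\cos\theta_1+s^2\right)^{\frac{2-n}{2}}+\sum_{j=0}^q(-s)^jG_j^{\frac{n-2}{2}}(\cos\theta_1),$$ where the Gegenbauer polynomials are defined by $(1-2t\xi+t^2)^{-\frac{n-2}{2}}=\sum_{j\ge0}G_j^{\frac{n-2}{2}}(\xi)t^j$. Standing assumptions: the closed unit ball $\overline{B_1}$ is free of masses of $u$ (so $n(t)=0$ for $0\le t\le1$), and the harmonic polynomial of degree at most $q$ in the Hadamard representation of $u$ is zero, so that $u(x)=\int_0^\infty t^{2-n}h_n\left(\frac rt,\theta_1,q\right)d\left(t^{n-2}n(t)\right)$. $P^\mu_\nu(\xi)$, $-1<\xi<1$, is the associated Legendre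 function of the first kind on the cut: $P^\mu_\nu(\xi)=\frac{1}{\Gamma(1-\mu)}\left(\frac{1+\xi}{1-\xi}\right)^{\mu/2}{}_2F_1\left(-\nu,\nu+1;1-\mu;\frac{1-\xi}{2}\right)$ (here $\mu,\nu$ are parameters). At $\theta_1=0$ the expressions $(\sin\theta_1)^{-(n-3)/2}P^{(3-n)/2}_{\nu}(\cos\theta_1)$ are understood as their limits as $\theta_1\downarrow0$.
   Formalization: That both sides equal -∞ at θ_1=π is stated only for Δ≠0: for Δ=0 the integral formula there is 0·(-∞) and the Legendre expression is identically 0 for θ_1<π. The Legendre side at π is read as its limit as θ_1↑π. *)

(* Defs.v *)
From HB Require Import structures.
From mathcomp Require Import all_boot all_order all_algebra.
From mathcomp Require Import all_classical all_reals all_analysis.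

Set Implicit Arguments.
Unset Strict Implicit.
Unset Printing Implicit Defensive.

Import Order.TTheory GRing.Theory Num.Theory.
Import numFieldNormedType.Exports.

Local Open Scope classical_set_scope.
Local Open Scope ring_scope.

Section euclidean_space.
Context {R : realType} {n : nat}.
Implicit Types x y c : 'rV[R]_n.

(* The norm of 'rV[R]_n in the library is the sup norm; it induces the same
   topology and Borel sets as the Euclidean norm below. *)
Definition dotp x y : R := \sum_(i < n) x 0 i * y 0 i.
Definition enorm x : R := Num.sqrt (dotp x x).

Definition eball c (r : R) : set 'rV[R]_n := [set x | enorm (x - c) < r].
Definition ecball c (r : R) : set 'rV[R]_n := [set x | enorm (x - c) <= r].
Definition esphere c (r : R) : set 'rV[R]_n := [set x | enorm (x - c) = r].

(* The unit vector of the x_1-axis, so that x_1 = dotp x e1. *)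
Definition e1 : 'rV[R]_n := \row_(i < n) (i == 0 :> nat)%:R.

(* x = (r, theta) where only the first angle theta = theta_1 is recorded; at
   the origin theta is arbitrary. *)
Definition spherical x (r theta : R) : Prop :=
  [/\ r = enorm x, 0 <= theta <= pi & dotp x e1 = r * cos theta].

Definition neg_axis : set 'rV[R]_n := [set - t *: e1 | t in `[0, +oo[].

Definition partial (i : 'I_n) (f : 'rV[R]_n -> R) : 'rV[R]_n -> R :=
  fun x => 'D_(delta_mx 0 i) f x.

Definition C2_on (A : set 'rV[R]_n) (f : 'rV[R]_n -> R) : Prop :=
  forall x, A x ->
  [/\ {for x, continuous f},
      forall i, derivable f x (delta_mx 0 i) /\
        {for x, continuous (partial i f)} &
      forall i j, derivable (partial i f) x (delta_mx 0 j) /\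
        {for x, continuous (partial j (partial i f))}].

Definition harmonic_on (A : set 'rV[R]_n) (f : 'rV[R]_n -> R) : Prop :=
  C2_on A f /\ forall x, A x -> \sum_(i < n) partial i (partial i f) x = 0.

(* Domination by harmonic majorants on balls; upper semicontinuity of u is
   lower semicontinuity of - u, and u = -oo identically is excluded. *)
Definition subharmonic (u : 'rV[R]_n -> \bar R) : Prop :=
  [/\ forall x, (u x < +oo)%E,
      exists x, u x != -oo%E,
      lower_semicontinuous (fun x => - u x)%E &
      forall c (r : R) (h : 'rV[R]_n -> R), 0 < r ->
        {within ecball c r, continuous h} -> harmonic_on (eball c r) h ->
        (forall x, esphere c r x -> (u x <= (h x)%:E)%E) ->
        forall x, eball c r x -> (u x <= (h x)%:E)%E].

(* The maximum of u on |x| = r, attained when u is upper semicontinuous. *)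
Definition max_sphere (u : 'rV[R]_n -> \bar R) (r : R) : \bar R :=
  ereal_sup (u @` esphere 0 r).

Definition has_order (u : 'rV[R]_n -> \bar R) (rho : R) : Prop :=
  limf_esup (fun r : R => lne (max_sphere u r) * ((ln r)^-1)%:E)%E
    (pinfty_nbhs R) = rho%:E.

Definition has_finite_type (u : 'rV[R]_n -> \bar R) (rho : R) : Prop :=
  exists C : R, \forall r \near +oo,
    (`|max_sphere u r| <= (C * r `^ rho)%:E)%E.

Definition borelRn := g_sigma_algebraType (@open 'rV[R]_n).

Definition locally_finite (mu : {measure set borelRn -> \bar R}) : Prop :=
  forall r : R, (mu (ecball 0 r) < +oo)%E.

(* The extended inverse makes |x - y|^(2-n) equal to +oo when x = y. *)
Definition riesz_measure (u : 'rV[R]_n -> \bar R)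
    (mu : {measure set borelRn -> \bar R}) : Prop :=
  forall c, exists (d : R) (h : 'rV[R]_n -> R),
    [/\ 0 < d, harmonic_on (eball c d) h &
      forall x, eball c d x ->
        u x = (- \int[mu]_(y in (eball c d : set borelRn))
                   ((enorm (x - (y : 'rV[R]_n)) ^+ (n - 2))%:E)^-1
               + (h x)%:E)%E].

(* The distribution function of the masses, t^(n-2) n(t). *)
Definition mass (mu : {measure set borelRn -> \bar R}) (t : R) : R :=
  fine (mu (ecball 0 t)).

Definition counting_fun (mu : {measure set borelRn -> \bar R}) (t : R) : R :=
  t ^- (n - 2) * mass mu t.

End euclidean_space.

Arguments borelRn : clear implicits.

Section mass_cumulative.
Context {R : realType} {n : nat}.
Variable mu : {measure set (borelRn R n) -> \bar R}.

Lemma continuous_enorm : continuous (@enorm R n).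
Proof.
move=> x; rewrite /enorm.
apply: (@continuous_comp _ _ _ (fun x : 'rV[R]_n => dotp x x) Num.sqrt);
  last exact: sqrt_continuous.
have := @continuous_big _ _ +%R 0 xpredT (@add_continuous R)
  'rV[R]_n (index_enum 'I_n) (fun i y => y 0 i * y 0 i).
apply=> i _ y; apply: (@cvgM _ _ _ _ (fun z : 'rV[R]_n => z 0 i)
  (fun z : 'rV[R]_n => z 0 i)); try exact: (@coord_continuous R 1 n 0 i y).
exact: (@nbhs_filter 'rV[R]_n).
Qed.

Lemma measurable_ecball (t : R) :
  measurable (ecball 0 t : set (borelRn R n)).
Proof.
have -> : ecball 0 t = ~` ((@enorm R n) @^-1` [set r : R | t < r]).
  apply/seteqP; split => x; rewrite /ecball/= subr0.
    by move=> xt; apply/negP; rewrite -leNgt.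
  by move=> /negP; rewrite -leNgt.
apply: measurableC; apply: sub_sigma_algebra.
apply: open_comp; last exact: open_gt.
by move=> x _; exact: continuous_enorm.
Qed.

Hypothesis mu_fin : locally_finite mu.

Lemma mass_EFin (t : R) : (mass mu t)%:E = mu (ecball 0 t).
Proof. by rewrite /mass fineK// ge0_fin_numE. Qed.

Lemma mass_nondecreasing : nondecreasing (mass mu).
Proof.
move=> s t st; rewrite -lee_fin !mass_EFin.
apply: le_measure; rewrite ?inE; [exact: measurable_ecball..|].
by move=> x /= /le_trans; apply.
Qed.

Lemma mass_right_continuous : right_continuous (mass mu).
Proof.
move=> t; apply/cvgrPdist_lt => e e0.
pose F (k : nat) : set (borelRn R n) := ecball 0 (t + k.+1%:R^-1).
have capF : \bigcap_k F k = ecball 0 t.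
  apply/seteqP; split => x /=; last first.
    by move=> xt k _; rewrite /F/ecball/= (le_trans xt)// lerDl.
  move=> xF; rewrite /ecball/= leNgt; apply/negP => tx.
  have : 0 < enorm (x - 0) - t by rewrite subr_gt0.
  move=> /ltr_add_invr[k]; rewrite add0r ltrBrDl => kx.
  by have := xF k I; rewrite /F /ecball/= leNgt kx.
have cvgF : mu (F k) @[k --> \oo] --> mu (ecball 0 t).
  rewrite -capF; apply: (@nonincreasing_cvg_mu _ _ _ mu F).
  - exact: mu_fin.
  - by move=> k; exact: measurable_ecball.
  - by rewrite capF; exact: measurable_ecball.
  - move=> i j ij; apply/subsetPset => x; rewrite /F/ecball/= => /le_trans; apply.
    by rewrite lerD2l lef_pV2 ?posrE// ler_nat.
have cvgm : mass mu (t + k.+1%:R^-1) @[k --> \oo] --> mass mu t.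
  by rewrite -mass_EFin in cvgF; exact: fine_cvg cvgF.
have /cvgrPdist_lt/(_ e e0)[k _ /(_ k (leqnn _))/=] := cvgm.
move=> mk; near=> s; rewrite distrC ger0_norm; last first.
  by rewrite subr_ge0; apply: mass_nondecreasing; near: s; exact: nbhs_right_ge.
apply: le_lt_trans mk; rewrite distrC ger0_norm; last first.
  by rewrite subr_ge0; apply: mass_nondecreasing; rewrite lerDl.
rewrite lerD2r; apply: mass_nondecreasing.
by near: s; apply: nbhs_right_le; rewrite ltrDl.
Unshelve. all: by end_near. Qed.

End mass_cumulative.

Section mass_stieltjes.
Context {R : realType} {n : nat} (mu : {measure set (borelRn R n) -> \bar R}).

(* The mass function packaged so that its Lebesgue-Stieltjes measure, written
   d(t^(n-2) n(t)), is available. *)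
Definition mass_fun of locally_finite mu : R -> R := mass mu.

HB.instance Definition _ (mu_fin : locally_finite mu) :=
  isCumulative.Build R _ R (mass_fun mu_fin)
    (mass_nondecreasing mu_fin) (mass_right_continuous mu_fin).

End mass_stieltjes.

Section special_functions.
Context {R : realType}.

(* The coefficient of t^j in the Taylor expansion at t = 0 of the generating
   function (1 - 2 t xi + t^2)^(-lambda). *)
Definition gegenbauer (lambda : R) (j : nat) (xi : R) : R :=
  derive1n j (fun t : R => (1 - 2 * t * xi + t ^+ 2) `^ (- lambda)) 0 / j`!%:R.

(* The extended inverse makes the first term, hence the kernel, equal to -oo
   at s = 1, theta = pi. *)
Definition hadamard_kernel (n : nat) (s theta : R) (q : nat) : \bar R :=
  (- (((1 + 2 * s * cos theta + s ^+ 2) `^ ((n%:R - 2) / 2))%:E)^-1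
   + (\sum_(0 <= j < q.+1)
        (- s) ^+ j * gegenbauer ((n%:R - 2) / 2) j (cos theta))%:E)%E.

(* Only meaningful for 0 < z. *)
Definition Gamma (z : R) : R :=
  \int[lebesgue_measure]_(t in `]0, +oo[) (t `^ (z - 1) * expR (- t)).

Definition pochhammer (a : R) (k : nat) : R := \prod_(0 <= i < k) (a + i%:R).

(* Only meaningful for `|z| < 1. *)
Definition hyp2F1 (a b c z : R) : R :=
  limn (series (fun k => pochhammer a k * pochhammer b k
                         / (pochhammer c k * k`!%:R) * z ^+ k)).

(* The Legendre function on the cut -1 < xi < 1, for m < 1. *)
Definition legendreP (m nu xi : R) : R :=
  (Gamma (1 - m))^-1 * ((1 + xi) / (1 - xi)) `^ (m / 2)
  * hyp2F1 (- nu) (nu + 1) (1 - m) ((1 - xi) / 2).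

Definition indicator_integral (n : nat) (rho Delta : R) (q : nat) (theta : R)
    : \bar R :=
  (((rho + n%:R - 2) * Delta)%:E
   * \int[lebesgue_measure]_(s in `]0%R, +oo[)
       ((s `^ (- rho - 1))%:E * hadamard_kernel n s theta q))%E.

Definition indicator_legendre (n : nat) (rho Delta nu theta : R) : R :=
  pi * 2 `^ ((n%:R - 3) / 2) * Gamma ((n%:R - 1) / 2)
    * (\prod_(1 <= k < n.-1) (rho + k%:R)) * Delta
  / ((n - 3)`!%:R * sin (pi * rho) * sin theta `^ ((n%:R - 3) / 2))
  * legendreP ((3 - n%:R) / 2) nu (cos theta).

End special_functions.

(* Main.v *)
Require Import Defs.
From HB Require Import structures.
From mathcomp Require Import all_boot all_order all_algebra.
From mathcomp Require Import all_classical all_reals all_analysis.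
From mathcomp Require Import measurable_realfun lebesgue_integral_under.
From mathcomp Require Import ring lra.

Set Implicit Arguments.
Unset Strict Implicit.
Unset Printing Implicit Defensive.

Import Order.TTheory GRing.Theory Num.Theory.
Import numFieldNormedType.Exports.

Local Open Scope classical_set_scope.
Local Open Scope ring_scope.

(** Write N = n - 2, lam = N / 2 and xi = cos theta. The kernel is minus the
    Taylor remainder at 0, after q + 1 terms, of the generating function
    (1 + 2 s xi + s^2)^(-lam). The theorem rests on the Mellin transform
    [mellin k rho lam xi], the integral over s > 0 of s^(-rho-1) times the
    remainder after k terms, which converges when rho lies strictly between the
    orders of the remainder at infinity and at 0.

    The limit along a ray. If s^N h(s) is the integral of x^(N-1) w(x) over
    0 < x <= s, Fubini turns the potential with kernel t^(-N) h(r/t) into an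
    integral of w against the distribution function of the masses at r/s
    ([potential_fubini]). This function, normalized by its growth, is bounded and
    tends to Delta, so that dominated convergence gives the limit
    ([potential_limit]), and an integration by parts brings back h
    ([kernel_limit]).

    The Legendre functions. The recursion of the Gegenbauer coefficients in lam
    expresses the derivative of a remainder by remainders for lam + 1
    ([der_remainder]). Hence the transforms satisfy recursions ([mellin_rec],
    [mellin_split]), are differentiable in xi ([der_mellin]) and solve the
    Gegenbauer equation ([mellin_ode]). An energy argument shows that a solution
    regular at xi = 1 is determined by its value there ([gegenbauer_unique]), so
    that the transform is its value at xi = 1 times a hypergeometric function
    ([mellin_legendre]). That value is a Beta integral ([mellin_at1]); the
    recursions reduce it to lam = 1, where sin theta times the transform is the
    motion of an oscillator of frequency rho + 1. Comparing, as theta tends to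
    pi, with rho = -1, for which this motion is theta itself, yields the factor
    pi / sin (pi rho) ([mellin1_at1]).

    The angle pi. As the ray turns towards the masses the kernel decreases, up to
    a multiple of a fixed integrable kernel ([remainder_compare]), and its Mellin
    transform diverges logarithmically ([mellin_diverges]). So the integral and
    the potential on the negative axis lie below finite quantities that tend to
    -oo ([integral_pi], [pi_limit]).

    Orders below 0. Then q = 0, and on the positive axis the potential is
    nonnegative and increasing, whereas finite type makes it tend to 0. Hence
    there are no masses ([negative_order_massless]) and all the quantities are
    zero. *)

(** * Differentiation at a point *)

Section pointwise_derivatives.
Context {R : realType}.
Implicit Types (f g : R -> R) (x a b c : R).

Lemma der_cst c x : is_derive x 1 (fun _ : R => c) 0.
Proof. exact: is_derive_cst. Qed.
Lemma der_id x : is_derive x 1 (fun y : R => y) 1.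
Proof. exact: is_derive_id. Qed.
Lemma der_add f g x a b : is_derive x 1 f a -> is_derive x 1 g b ->
  is_derive x 1 (fun y => f y + g y) (a + b).
Proof. exact: is_deriveD. Qed.
Lemma der_opp f x a : is_derive x 1 f a -> is_derive x 1 (fun y => - f y) (- a).
Proof. exact: is_deriveN. Qed.
Lemma der_mul f g x a b : is_derive x 1 f a -> is_derive x 1 g b ->
  is_derive x 1 (fun y => f y * g y) (f x * b + g x * a).
Proof. exact: is_deriveM. Qed.
Lemma der_exp f n x a : is_derive x 1 f a ->
  is_derive x 1 (fun y => f y ^+ n) (n%:R * f x ^+ n.-1 * a).
Proof.
move=> fa; rewrite (_ : (fun y => f y ^+ n) = f ^+ n); last first.
  by apply/funext => y; rewrite exprfctE.
exact: (@is_deriveX _ _ f n x 1 a fa).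
Qed.
Lemma der_inv f x a : f x != 0 -> is_derive x 1 f a ->
  is_derive x 1 (fun y => (f y)^-1) (- (f x) ^- 2 * a).
Proof.
move=> fx0 fa; have [fd fE] := fa.
apply: DeriveDef; first exact: derivableV.
by rewrite deriveV// fE.
Qed.
Lemma der_comp f g x a b : is_derive (g x) 1 f a -> is_derive x 1 g b ->
  is_derive x 1 (fun y => f (g y)) (a * b).
Proof. exact: is_derive1_comp. Qed.
Lemma der_powR f p x a : 0 < f x -> is_derive x 1 f a ->
  is_derive x 1 (fun y => f y `^ p) (p * f x `^ (p - 1) * a).
Proof.
by move=> fx fa; apply: (@der_comp (fun y => y `^ p)) => //; exact: is_derive1_powR.
Qed.

Lemma der_continuous f x a : is_derive x 1 f a -> {for x, continuous f}.
Proof.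
by move=> [fd _]; apply/differentiable_continuous; rewrite -derivable1_diffP.
Qed.

Lemma der_derive1 f x a : is_derive x 1 f a -> derive1 f x = a.
Proof. by move=> fa; rewrite derive1E derive_val. Qed.

End pointwise_derivatives.

(** Leaves the positivity or nonvanishing conditions first, and then the
    equation between the computed and the stated derivative. *)
Ltac der_step :=
  lazymatch goal with
  | |- is_derive _ _ (fun _ => ?c) _ => eapply der_cst
  | |- is_derive _ _ (fun _ => _ + _) _ => eapply der_add
  | |- is_derive _ _ (fun _ => - _) _ => eapply der_opp
  | |- is_derive _ _ (fun _ => _ ^-1) _ => eapply der_inv
  | |- is_derive _ _ (fun _ => _ * _) _ => eapply der_mul
  | |- is_derive _ _ (fun _ => _ ^+ _) _ => eapply der_exp
  | |- is_derive _ _ (fun _ => _ `^ _) _ => eapply der_powR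
  | |- is_derive _ _ (@GRing.mul _ ?c) _ => eapply (@der_mul _ (fun _ => c) (fun y => y))
  | |- is_derive _ _ (@GRing.add _ ?c) _ => eapply (@der_add _ (fun _ => c) (fun y => y))
  | |- is_derive _ _ (@GRing.opp _) _ => eapply (@der_opp _ (fun y => y))
  | |- is_derive _ _ (fun y => y) _ => eapply der_id
  | |- is_derive _ _ (fun y => cos y) _ => eapply is_derive_cos
  | |- is_derive _ _ (fun y => sin y) _ => eapply is_derive_sin
  | |- is_derive _ _ (fun y => cos _) _ => eapply (@der_comp _ cos); [eapply is_derive_cos|]
  | |- is_derive _ _ (fun y => sin _) _ => eapply (@der_comp _ sin); [eapply is_derive_sin|]
  | |- is_derive _ _ _ _ => eassumption
  end.
Ltac der := eapply is_derive_eq; [repeat der_step | cbv beta].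

(** * Integrals over the half line *)

Section half_line.
Context {R : realType}.
Notation mu := (@lebesgue_measure R).
Implicit Types (f g F : R -> R) (e C s : R).

(** The derivative of s^e / (1 + s^e): it has integral 1 and is comparable to
    s^(e-1) near 0 and to s^(-e-1) near infinity. *)
Definition majorant e s : R := e * s `^ (e - 1) / (1 + s `^ e) ^+ 2.
Definition majorant_prim e s : R := 1 - (1 + s `^ e)^-1.

Lemma majorant_ge0 e s : 0 <= e -> 0 <= majorant e s.
Proof. by move=> e0; rewrite /majorant !mulr_ge0 ?invr_ge0 ?exprn_ge0 ?addr_ge0 ?powR_ge0. Qed.

Lemma der_majorant e s : 0 < s -> is_derive s 1 (majorant_prim e) (majorant e s).
Proof.
move=> s0; rewrite /majorant_prim /majorant.
have p0 : 0 < 1 + s `^ e by rewrite ltr_wpDr ?powR_ge0.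
der; [exact: lt0r_neq0|exact: s0|].
by rewrite mulr1 !add0r mulNr opprK [LHS]mulrC.
Qed.

Lemma continuous_gt0_measurable f : {in `]0, +oo[, continuous f} ->
  measurable_fun (`]0, +oo[%classic : set R) f.
Proof.
move=> cf; apply: open_continuous_measurable_fun; first exact: interval_open.
by move=> x /set_mem; apply: cf.
Qed.

(** For a nonnegative integrand monotone convergence along the intervals
    [1/k, +oo[ removes the singularity at 0. *)
Lemma ge0_FTC_half_line f F (l0 l : R) :
  (forall s : R, 0 < s -> 0 <= f s) -> {in `]0, +oo[, continuous f} ->
  (forall s : R, 0 < s -> is_derive s 1 F (f s)) ->
  F s @[s --> 0^'+] --> l0 -> F s @[s --> +oo] --> l ->
  (\int[mu]_(s in `]0%R, +oo[) (f s)%:E = (l - l0)%:E)%E.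
Proof.
move=> f0 cf dF F0 Fl.
pose D (k : nat) : set R := `[k.+1%:R^-1, +oo[%classic.
have k0 (k : nat) : 0 < k.+1%:R^-1 :> R by rewrite invr_gt0.
have DE : \bigcup_k D k = (`]0, +oo[%classic : set R).
  apply/seteqP; split => x /=.
    by move=> [k _]; rewrite /D/= !in_itv/= !andbT; apply: lt_le_trans.
  rewrite in_itv/= andbT => x0.
  have [k kx] := ltr_add_invr x0.
  by exists k => //; rewrite /D/= in_itv/= andbT ltW// -[ltLHS]add0r.
have mfe : measurable_fun (`]0, +oo[%classic : set R) (EFin \o f).
  by apply/measurable_EFinP; exact: continuous_gt0_measurable.
have intD k : (\int[mu]_(s in D k) (f s)%:E = (l - F k.+1%:R^-1)%:E)%E.
  rewrite EFinB; apply: ge0_continuous_FTC2y => //.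
  - by move=> x kx; apply/f0/(lt_le_trans (k0 k)).
  - apply: continuous_in_subspaceT => x /set_mem; rewrite /= in_itv/= andbT => kx.
    by apply: cf; rewrite in_itv/= andbT (lt_le_trans (k0 k)).
  - by move=> x kx; have [] := dF _ (lt_trans (k0 k) kx).
  - exact/cvg_at_right_filter/(der_continuous (dF _ (k0 k))).
  - move=> x; rewrite in_itv/= andbT => kx.
    exact/der_derive1/dF/(lt_trans (k0 k)).
have H : (\int[mu]_(s in D k) (f s)%:E @[k --> \oo] -->
    \int[mu]_(s in \bigcup_k D k) (f s)%:E)%E.
  apply: (@ge0_nondecreasing_set_cvg_integral _ (measurableTypeR R) R D).
  - move=> i j ij; apply/subsetPset => x; rewrite /D/= !in_itv/= !andbT.
    by apply: le_trans; rewrite lef_pV2 ?posrE// ler_nat.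
  - by move=> i; exact: measurable_itv.
  - move=> i; apply: measurable_funS mfe => // x.
    by rewrite /D/= !in_itv/= !andbT; apply: lt_le_trans.
  - by move=> i x; rewrite /D/= in_itv/= andbT lee_fin => kx; apply/f0/(lt_le_trans (k0 i)).
rewrite -DE -(cvg_lim _ H)//; under eq_fun do rewrite intD.
apply/cvg_lim => //.
apply: cvg_EFin; first exact: nearW.
apply: cvgB; first exact: cvg_cst.
have /cvg_at_rightP/(_ (fun k => k.+1%:R^-1)) := F0; apply.
by split => //; exact: cvg_harmonic.
Qed.

Local Notation half := (`]0, +oo[%classic : set R).

Lemma powR_cvgy e : 0 < e -> s `^ e @[s --> +oo] --> +oo.
Proof.
move=> e0; apply/cvgryPge => A; near=> s.
have A1 : 0 <= Num.max A 1 by rewrite le_max ler01 orbT.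
apply: (@le_trans _ _ (Num.max A 1)); first by rewrite le_max lexx.
have -> : Num.max A 1 = (Num.max A 1 `^ e^-1) `^ e.
  by rewrite -powRrM mulVf ?gt_eqF// powRr1.
have s0 : 0 <= s by near: s; exact: nbhs_pinfty_ge.
apply: ge0_ler_powR; [exact: ltW|by rewrite nnegrE powR_ge0|by []|].
by near: s; exact: nbhs_pinfty_ge.
Unshelve. all: by end_near. Qed.

Lemma majorant_continuous e : {in `]0, +oo[, continuous (majorant e)}.
Proof.
move=> s; rewrite in_itv/= andbT => s0.
have p0 : 0 < 1 + s `^ e by rewrite ltr_wpDr ?powR_ge0.
apply: (@der_continuous _ _ _ _); rewrite /majorant.
der; [exact: s0|rewrite expf_neq0//; exact: lt0r_neq0|exact: s0|reflexivity].
Qed.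

Lemma majorant_prim_cvg0 e : 0 < e -> majorant_prim e s @[s --> 0^'+] --> (0 : R).
Proof.
move=> e0.
rewrite -[X in _ --> X](subrr 1); apply: cvgB; first exact: cvg_cst.
rewrite -[X in _ --> X]invr1; apply: cvgV => //.
rewrite -[X in _ --> X]addr0; apply: cvgD; first exact: cvg_cst.
exact: powR_cvg0.
Qed.

Lemma majorant_prim_cvgy e : 0 < e -> majorant_prim e s @[s --> +oo] --> (1 : R).
Proof.
move=> e0; rewrite -[X in _ --> X]subr0; apply: cvgB; first exact: cvg_cst.
apply/(@gtr0_cvgV0 _ _ (nbhs +oo) _ (fun s : R => 1 + s `^ e)).
  by near=> s; rewrite ltr_wpDr ?powR_ge0.
apply/cvgryPge => A; near=> s.
apply: (@le_trans _ _ (s `^ e)); last by rewrite lerDr.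
near: s; move: A; apply/cvgryPge; exact: powR_cvgy.
Unshelve. all: by end_near. Qed.

Lemma integral_majorant e : 0 < e ->
  (\int[mu]_(s in `]0%R, +oo[) (majorant e s)%:E = 1%:E)%E.
Proof.
move=> e0; rewrite -(subr0 (1 : R)); apply: ge0_FTC_half_line.
- by move=> s _; apply/majorant_ge0/ltW.
- exact: majorant_continuous.
- by move=> s; exact: der_majorant.
- exact: majorant_prim_cvg0.
- exact: majorant_prim_cvgy.
Qed.

Lemma integrable_majorant e : 0 < e -> mu.-integrable half (EFin \o majorant e).
Proof.
move=> e0; apply/integrableP; split.
  apply/measurable_EFinP; apply: continuous_gt0_measurable; exact: majorant_continuous.
under eq_integral do rewrite /= ger0_norm ?majorant_ge0 ?(ltW e0)//.
by rewrite integral_majorant// ltry.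
Qed.

Lemma integrable_scaled_majorant e C : 0 < e ->
  mu.-integrable half (EFin \o (fun s => C * majorant e s)).
Proof.
move=> e0; rewrite (_ : EFin \o _ = (fun s => C%:E * (EFin \o majorant e) s)%E)//.
by apply: integrableZl => //; exact: integrable_majorant.
Qed.

Definition power_bounded e C f := forall s, 0 < s ->
  `|f s| <= C * majorant e s.

(** The factor 4 is lost in the denominator (1 + s^e)^2, at most 4 for s <= 1
    and at most 4 s^(2e) for s >= 1. *)
Lemma power_boundedP e C f : 0 < e -> 0 <= C ->
  (forall s, 0 < s <= 1 -> `|f s| <= C * s `^ (e - 1)) ->
  (forall s, 1 <= s -> `|f s| <= C * s `^ (- e - 1)) ->
  power_bounded e (4 * C / e) f.
Proof.
move=> e0 C0 f0 f1 s s0.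
have -> : 4 * C / e * majorant e s = C * (4 * s `^ (e - 1) / (1 + s `^ e) ^+ 2).
  by rewrite /majorant; field; rewrite (gt_eqF e0)/= gt_eqF// ltr_wpDr ?powR_ge0.
have q0 : 0 < s `^ (e - 1) by rewrite powR_gt0.
have p0 : 0 < s `^ e by rewrite powR_gt0.
have [s1|s1] := leP s 1.
  apply: (le_trans (f0 s _)); first by rewrite s0.
  rewrite ler_wpM2l// ler_pdivlMr ?exprn_gt0 ?addr_gt0// mulrC ler_pM2r//.
  have : s `^ e <= 1 by rewrite -(powRr0 s); apply: ger_powR; rewrite ?s0// ltW.
  by nra.
apply: (le_trans (f1 s (ltW s1))).
rewrite ler_wpM2l// ler_pdivlMr ?exprn_gt0 ?addr_gt0//.
have p1 : 1 <= s `^ e by rewrite -(powRr0 s); apply: ler_powR; rewrite ltW.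
have -> : s `^ (e - 1) = s `^ (- e - 1) * (s `^ e) ^+ 2.
  rewrite -powR_mulrn ?powR_ge0// -powRrM -powRD ?(gt_eqF s0) ?implybT//.
  by congr (_ `^ _); ring.
have h : (1 + s `^ e) ^+ 2 <= 4 * (s `^ e) ^+ 2 by nra.
by have := ler_wpM2l (powR_ge0 s (- e - 1)) h; lra.
Qed.

Lemma integrable_power_bounded e C f : 0 < e -> {in `]0, +oo[, continuous f} ->
  power_bounded e C f -> mu.-integrable half (EFin \o f).
Proof.
move=> e0 cf bf.
apply: (@le_integrable _ _ _ mu half _ _ (fun s => C%:E * (majorant e s)%:E)%E) => //.
- by apply/measurable_EFinP; exact: continuous_gt0_measurable.
- move=> s; rewrite /= in_itv/= andbT => s0; rewrite lee_fin.
  by apply: le_trans (ler_norm _); exact: bf.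
- by apply: integrableZl => //; exact: integrable_majorant.
Qed.

(** Adding a multiple of the majorant, whose primitive is explicit, reduces the
    claim to a nonnegative integrand. *)
Lemma FTC_half_line e C f F (l0 l : R) : 0 < e -> {in `]0, +oo[, continuous f} ->
  power_bounded e C f ->
  (forall s, 0 < s -> is_derive s 1 F (f s)) ->
  F s @[s --> 0^'+] --> l0 -> F s @[s --> +oo] --> l ->
  \int[mu]_(s in half) f s = l - l0.
Proof.
move=> e0 cf bf dF F0 Fl.
have intf := integrable_power_bounded e0 cf bf.
have intm := integrable_scaled_majorant C e0.
have cm := @majorant_continuous e.
have P0 := majorant_prim_cvg0 e0.
have P1 := majorant_prim_cvgy e0.
have H : (\int[mu]_(s in half) (f s + C * majorant e s)%:E =
    ((l + C * 1) - (l0 + C * 0))%:E)%E.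
  apply: (@ge0_FTC_half_line _ (fun s => F s + C * majorant_prim e s)).
  - move=> s s0; have := bf s s0; rewrite ler_norml => /andP[h _]; lra.
  - move=> s sI; apply: cvgD; first exact: cf.
    by apply: cvgM; [exact: cvg_cst|exact: cm].
  - move=> s s0; have dm := der_majorant e s0.
    apply: (is_derive_eq (der_add (dF s s0) (der_mul (der_cst C s) dm))).
    by rewrite mulr0 addr0.
  - by apply: cvgD => //; apply: cvgM => //; exact: cvg_cst.
  - by apply: cvgD => //; apply: cvgM => //; exact: cvg_cst.
move/(congr1 fine): H; rewrite -/(Rintegral _ _ _) RintegralD// RintegralZl//; last exact: integrable_majorant.
rewrite {2}/Rintegral integral_majorant//= => H; lra.
Unshelve. all: by end_near. Qed.

Lemma measurable_ratio (r : R) : measurable_fun half (fun t => r / t).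
Proof.
apply: continuous_gt0_measurable => s; rewrite in_itv/= andbT => s0.
have sN : s != 0 by rewrite gt_eqF.
exact: (der_continuous (der_mul (der_cst r s) (@der_inv _ (fun s => s) _ _ sN (der_id s)))).
Qed.

Lemma measurable_pow_inv (N : nat) : measurable_fun half (fun t => t ^- N).
Proof.
apply: continuous_gt0_measurable => s; rewrite in_itv/= andbT => s0.
have sN : s ^+ N != 0 by rewrite expf_neq0// gt_eqF.
exact: (der_continuous (@der_inv _ (fun s => s ^+ N) _ _ sN (der_exp N (der_id s)))).
Qed.

(** Continuity together with a power of room at both ends: the class of
    integrands for which all the integrals over the half line converge. *)
Definition tame f := {in `]0, +oo[, continuous f} /\
  exists e C, [/\ 0 < e, 0 <= C,
    forall s, 0 < s <= 1 -> `|f s| <= C * s `^ (e - 1) &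
    forall s, 1 <= s -> `|f s| <= C * s `^ (- e - 1)].

Lemma tame_integrable f : tame f -> mu.-integrable half (EFin \o f).
Proof.
move=> [cf [e [C [e0 C0 f0 f1]]]].
exact: (integrable_power_bounded e0 cf (power_boundedP e0 C0 f0 f1)).
Qed.

Lemma tameD f g : tame f -> tame g -> tame (fun s => f s + g s).
Proof.
move=> [cf [e [C [e0 C0 f0 f1]]]] [cg [e' [C' [e0' C0' g0 g1]]]].
split; first by move=> s sI; apply: cvgD; [exact: cf|exact: cg].
exists (Num.min e e'), (C + C'); split.
- by rewrite lt_min e0.
- exact: addr_ge0.
- move=> s s01; apply: (le_trans (ler_normD _ _)); rewrite mulrDl; apply: lerD.
    apply: (le_trans (f0 s s01)); rewrite ler_wpM2l//.
    by apply: ger_powR => //; rewrite lerD2r ge_min lexx.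
  apply: (le_trans (g0 s s01)); rewrite ler_wpM2l//.
  by apply: ger_powR => //; rewrite lerD2r ge_min lexx orbT.
- move=> s s1; apply: (le_trans (ler_normD _ _)); rewrite mulrDl; apply: lerD.
    apply: (le_trans (f1 s s1)); rewrite ler_wpM2l//.
    by apply: ler_powR => //; rewrite lerD2r lerN2 ge_min lexx.
  apply: (le_trans (g1 s s1)); rewrite ler_wpM2l//.
  by apply: ler_powR => //; rewrite lerD2r lerN2 ge_min lexx orbT.
Qed.

Lemma tameZ c f : tame f -> tame (fun s => c * f s).
Proof.
move=> [cf [e [C [e0 C0 f0 f1]]]]; split.
  by move=> s sI; apply: cvgM; [exact: cvg_cst|exact: cf].
exists e, (`|c| * C); split => //.
- exact: mulr_ge0.
- by move=> s s01; rewrite normrM -mulrA ler_wpM2l//; exact: f0.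
- by move=> s s1; rewrite normrM -mulrA ler_wpM2l//; exact: f1.
Qed.

Lemma tame_norm f : tame f -> tame (fun s => `|f s|).
Proof.
move=> [cf [e [C [e0 C0 f0 f1]]]]; split.
  by move=> s sI; apply: cvg_norm; exact: cf.
by exists e, C; split => // s s1; rewrite normr_id; [exact: f0|exact: f1].
Qed.

Lemma Rintegral_tameD f g : tame f -> tame g ->
  \int[mu]_(s in half) (f s + g s) = \int[mu]_(s in half) f s + \int[mu]_(s in half) g s.
Proof.
move=> tf tg; apply: RintegralD; first exact: measurable_itv.
  exact: tame_integrable.
exact: tame_integrable.
Qed.

Lemma Rintegral_tameZ c f : tame f ->
  \int[mu]_(s in half) (c * f s) = c * \int[mu]_(s in half) f s.
Proof.
move=> tf; apply: RintegralZl; first exact: measurable_itv.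
exact: tame_integrable.
Qed.

Lemma eq_tame f g : (forall s, 0 < s -> f s = g s) -> tame f -> tame g.
Proof.
move=> fg [cf [e [C [e0 C0 f0 f1]]]]; split.
  move=> s; rewrite in_itv/= andbT => s0.
  have := cf s; rewrite in_itv/= andbT => /(_ s0).
  rewrite /continuous_at -fg//; apply: cvg_trans; apply: near_eq_cvg.
  near=> t; rewrite fg//; near: t; exact: lt_nbhsr.
exists e, C; split => //.
- by move=> s /[dup] s01 /andP[s0 _]; rewrite -fg//; exact: f0.
- by move=> s s1; rewrite -fg; [exact: f1|exact: lt_le_trans s1].
Unshelve. all: by end_near. Qed.

Lemma tame_cvg0 f : tame f -> s * f s @[s --> 0^'+] --> (0 : R).
Proof.
move=> [cf [e [C [e0 C0 f0 f1]]]].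
apply: norm_cvg0.
apply: (@squeeze_cvgr _ _ _ _ (fun=> 0) (fun s => C * s `^ e)).
- near=> s; rewrite normr_ge0/= normrM.
  have s0 : 0 < s by [].
  have s1 : s <= 1 by near: s; apply: nbhs_right_le.
  rewrite ger0_norm ?(ltW s0)//.
  have := f0 s; rewrite s0 s1 => /(_ isT) h.
  rewrite -(mulr_powRB1 (ltW s0) e0) mulrCA.
  by rewrite ler_wpM2l// ltW.
- exact: cvg_cst.
- rewrite -[X in _ --> X](mulr0 C); apply: cvgM; first exact: cvg_cst.
  exact: powR_cvg0.
Unshelve. all: by end_near. Qed.

Lemma tame_cvgy f : tame f -> s * f s @[s --> +oo] --> (0 : R).
Proof.
move=> [cf [e [C [e0 C0 f0 f1]]]].
apply: norm_cvg0.
apply: (@squeeze_cvgr _ _ _ _ (fun=> 0) (fun s => C * (s `^ e)^-1)).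
- near=> s; rewrite normr_ge0/= normrM.
  have s1 : 1 <= s by near: s; exact: nbhs_pinfty_ge.
  have s0 : 0 < s by exact: lt_le_trans s1.
  rewrite ger0_norm ?(ltW s0)//.
  rewrite -powRN -(subrK 1 (- e)) powRD ?(gt_eqF s0) ?implybT// powRr1 ?(ltW s0)//.
  by rewrite mulrA [leLHS]mulrC ler_wpM2r ?(ltW s0)//; exact: f1.
- exact: cvg_cst.
- rewrite -[X in _ --> X](mulr0 C); apply: cvgM; first exact: cvg_cst.
  apply/(@gtr0_cvgV0 _ _ (nbhs +oo) _ (fun s : R => s `^ e)).
    by near=> s; rewrite powR_gt0//.
  exact: powR_cvgy.
Unshelve. all: by end_near. Qed.

(** The boundary terms of an integration by parts vanish in the tame class. *)
Lemma integral_tame_derivative f g : tame f -> tame g ->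
  (forall s, 0 < s -> is_derive s 1 (fun s => s * f s) (g s)) ->
  \int[mu]_(s in half) g s = 0.
Proof.
move=> tf [cg [e [C [e0 C0 g0 g1]]]] dF; rewrite -[RHS](subrr 0).
apply: (FTC_half_line e0 cg (power_boundedP e0 C0 g0 g1) dF).
- exact: tame_cvg0.
- exact: tame_cvgy.
Qed.

Lemma integrable_half_fin_num f : mu.-integrable half (EFin \o f) ->
  (\int[mu]_(s in half) (f s)%:E = (\int[mu]_(s in half) f s)%:E)%E.
Proof. by move=> fi; rewrite fineK//; exact: integrable_fin_num. Qed.

Lemma dominated_half_line (f_ : nat -> R -> R) f g :
  (forall n, measurable_fun half (f_ n)) ->
  (forall s, 0 < s -> f_ n s @[n --> \oo] --> f s) ->
  mu.-integrable half (EFin \o g) ->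
  (forall n s, 0 < s -> `|f_ n s| <= g s) ->
  mu.-integrable half (EFin \o f) /\
  (\int[mu]_(s in half) f_ n s @[n --> \oo] --> \int[mu]_(s in half) f s).
Proof.
move=> mf ff ig fg.
have mh : measurable (half : set (measurableTypeR R)) by exact: measurable_itv.
have f1 : forall n, measurable_fun (half : set (measurableTypeR R)) (fun s => (f_ n s)%:E).
  by move=> n; apply/measurable_EFinP; exact: mf.
have f2 : forall s : measurableTypeR R, half s -> (f_ n s)%:E @[n --> \oo] --> (f s)%:E.
  move=> s; rewrite /= in_itv/= andbT => s0.
  by apply: cvg_EFin; [exact: nearW|exact: ff].
have f4 : forall n (s : measurableTypeR R), half s -> (`|(f_ n s)%:E| <= (EFin \o g) s)%E.
  by move=> n s; rewrite /= in_itv/= andbT => s0; rewrite lee_fin/=; exact: fg.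
have mfl := emeasurable_fun_cvg _ _ f1 f2.
have fi : mu.-integrable half (EFin \o f).
  have [] := @dominated_convergence _ (measurableTypeR R) R mu half mh
    (fun n s => (f_ n s)%:E) (EFin \o f) (EFin \o g) f1 mfl (aeW mu f2) ig
    (aeW mu (fun s n hs => f4 n s hs)).
  by [].
split => //.
have H := @dominated_cvg _ (measurableTypeR R) R mu half mh
  (fun n s => (f_ n s)%:E) (EFin \o f) (EFin \o g) f1 f2 (fun _ _ => erefl) ig f4.
by apply: (fine_cvg (a := \int[mu]_(s in half) f s)); rewrite -(integrable_half_fin_num fi); exact: H.
Qed.

End half_line.

(** * Taylor remainders of the Gegenbauer generating function *)

Section kernel.
Context {R : realType}.
Implicit Types (lam xi s t rho : R) (j k : nat).

(** The squared distance from the point at distance s from the origin, whose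
    angle to the positive axis has cosine xi, to the point at distance 1 on the
    negative axis. *)
Definition quad xi s : R := 1 + 2 * s * xi + s ^+ 2.
Definition genfun lam xi s : R := quad xi s `^ (- lam).
(** The sign accounts for the masses lying on the negative axis: these are the
    Taylor coefficients at 0 of genfun lam xi. *)
Definition coef lam xi j : R := (-1) ^+ j * gegenbauer lam j xi.
Definition remainder lam xi k s : R :=
  genfun lam xi s - \sum_(j < k) coef lam xi j * s ^+ j.

Section gegenbauer_recursion.
Variable xi : R.

Let g lam t : R := (1 - 2 * t * xi + t ^+ 2) `^ (- lam).
Let U : set R := [set t | 0 < 1 - 2 * t * xi + t ^+ 2].

Let openU : open U.
Proof.
apply: (@open_comp _ _ (fun t : R => 1 - 2 * t * xi + t ^+ 2) [set y | 0 < y]).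
  by move=> t _; apply: der_continuous.
exact: open_gt.
Qed.

Let derg lam t : U t -> is_derive t 1 (g lam) (2 * lam * ((xi - t) * g (lam + 1) t)).
Proof.
rewrite /U/= => Ut; rewrite /g; der; first exact: Ut.
rewrite (_ : - lam - 1 = - (lam + 1)); last by ring.
rewrite expr1; ring.
Qed.

Let dern (n : nat) : forall j, (j <= n)%N -> forall lam t, U t ->
  is_derive t 1 (derive1n j (g lam))
    (2 * lam * ((xi - t) * derive1n j (g (lam + 1)) t
                - j%:R * derive1n j.-1 (g (lam + 1)) t)).
Proof.
elim: n => [|n IH] j.
  rewrite leqn0 => /eqP -> lam t Ut.
  by apply: is_derive_eq; [exact: derg|rewrite mul0r subr0].
rewrite leq_eqVlt => /predU1P[->{j}|]; last by rewrite ltnS; exact: IH.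
move=> lam t Ut.
have dn1 l : U t -> is_derive t 1 (derive1n n (g l)) (derive1n n.+1 (g l) t).
  by move=> _; have [h _] := IH n (leqnn n) l t Ut; rewrite derive1nS derive1E; exact: DeriveDef.
have dn2 l : n%:R * derive1n n.-1.+1 (g l) t = n%:R * derive1n n (g l) t.
  by case: (n) => [|//]; rewrite !mul0r.
apply: (@near_eq_is_derive _ _ _
  (fun t => 2 * lam * ((xi - t) * derive1n n (g (lam + 1)) t
                - n%:R * derive1n n.-1 (g (lam + 1)) t))).
  near=> y; have Uy : U y by near: y; exact: open_nbhs_nbhs.
  by rewrite derive1nS derive1E; apply/esym; have [_ ->] := IH n (leqnn n) lam y Uy.
have dnp : is_derive t 1 (derive1n n.-1 (g (lam + 1))) (derive1n n.-1.+1 (g (lam + 1)) t).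
  have [h _] := IH n.-1 (leq_pred n) (lam + 1) t Ut.
  by rewrite derive1nS derive1E; exact: DeriveDef.
have dnn := dn1 (lam + 1) Ut.
apply: (@is_derive_eq _ _ _ _ _ _ _ _ (der_mul (der_cst (2 * lam) t)
  (der_add (der_mul (der_add (der_cst xi t) (der_opp (der_id t))) dnn)
     (der_opp (der_mul (der_cst n%:R t) dnp))))).
have := dn2 (lam + 1).
move: (derive1n n.-1.+1 _ t) (derive1n n _ t) (derive1n n.-1 _ t) (derive1n n.+1 _ t) => A B C D AB.
rewrite add0r !mulr0 !addr0 AB -natr1; ring.
Unshelve. all: by end_near. Qed.

(** The derivative of the generating function is 2 lam (xi - t) times the one for
    lam + 1; differentiating this j times at 0 gives the recursion. *)
Lemma coef_rec lam j : j.+1%:R * coef lam xi j.+1 =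
  - 2 * lam * (xi * coef (lam + 1) xi j + if j is i.+1 then coef (lam + 1) xi i else 0).
Proof.
have U0 : U 0 by rewrite /U/= mulr0 mul0r subr0 expr0n addr0.
have [_ h] := @dern j j (leqnn j) lam 0 U0.
rewrite /coef /gegenbauer derive1nS derive1E h factS natrM.
have jf : j`!%:R != 0 :> R by rewrite pnatr_eq0 -lt0n fact_gt0.
rewrite -/(g (lam + 1)) subr0.
case: j jf {h} => [|i] jf.
  by rewrite fact0 expr1 !expr0; field.
rewrite /= factS natrM; rewrite factS natrM in jf.
have [i1 i2] : i.+1%:R != 0 :> R /\ i`!%:R != 0 :> R.
  by move: jf; rewrite mulf_eq0 negb_or => /andP.
rewrite !exprS /=; field.
have i0 := ler0n R i; rewrite i2 !gt_eqF//; lra.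
Qed.

Lemma coef0 lam : coef lam xi 0 = 1.
Proof.
rewrite /coef /gegenbauer derive1n0 expr0 fact0 divr1 mul1r.
by rewrite mulr0 mul0r subr0 expr0n addr0 powR1.
Qed.

End gegenbauer_recursion.

Lemma der_genfun lam xi s : 0 < quad xi s ->
  is_derive s 1 (genfun lam xi) (- 2 * lam * ((xi + s) * genfun (lam + 1) xi s)).
Proof.
move=> qs; rewrite /genfun /quad; der; first exact: qs.
rewrite (_ : - lam - 1 = - (lam + 1)); last by ring.
rewrite expr1 /quad; ring.
Qed.

Lemma der_coef_sum lam xi k s :
  is_derive s 1 (fun s => \sum_(j < k) coef lam xi j * s ^+ j)
    (- 2 * lam * (xi * (\sum_(j < k.-1) coef (lam + 1) xi j * s ^+ j)
                 + s * (\sum_(j < k.-2) coef (lam + 1) xi j * s ^+ j))).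
Proof.
elim: k => [|k IH].
  under eq_fun do rewrite big_ord0.
  by apply: (is_derive_eq (der_cst 0 s)); rewrite !big_ord0; ring.
under eq_fun do rewrite big_ord_recr/=.
have d : is_derive s 1 (fun s => coef lam xi k * s ^+ k)
    (coef lam xi k * (k%:R * s ^+ k.-1)).
  by der; ring.
apply: (is_derive_eq (der_add IH d)).
case: k {IH d} => [|k]; first by rewrite !big_ord0; ring.
rewrite mulrA (mulrC (coef _ _ _)) coef_rec /= big_ord_recr/=.
case: k => [|k] /=; first by rewrite !big_ord0 !expr0; ring.
by rewrite [X in _ = _ * (_ + s * X)]big_ord_recr/= exprS; ring.
Qed.

(** A derivative raises lam by one and lowers the number of subtracted terms,
    because coef_rec does the same to the coefficients. *)
Lemma der_remainder lam xi k s : 0 < quad xi s ->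
  is_derive s 1 (remainder lam xi k)
    (- 2 * lam * (xi * remainder (lam + 1) xi k.-1 s
                 + s * remainder (lam + 1) xi k.-2 s)).
Proof.
move=> qs; apply: (is_derive_eq (der_add (der_genfun lam qs)
  (der_opp (der_coef_sum lam xi k s)))).
by rewrite /remainder; ring.
Qed.

Lemma remainder0 lam xi k : remainder lam xi k.+1 0 = 0.
Proof.
rewrite /remainder /genfun /quad mulr0 mul0r addr0 expr0n/= addr0 powR1.
rewrite big_ord_recl/= coef0 expr0 mulr1 big1 ?addr0 ?subrr// => i _.
by rewrite exprS mul0r mulr0.
Qed.

Lemma powR_opp_le (p x y : R) : 0 <= p -> 0 < x -> x <= y -> y `^ (- p) <= x `^ (- p).
Proof.
move=> p0 x0 xy; have y0 := lt_le_trans x0 xy.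
rewrite !powRN lef_pV2 ?posrE ?powR_gt0//.
by apply: ge0_ler_powR => //; rewrite nnegrE ltW.
Qed.

(** quad is the convex combination of (1 + s)^2 and (1 - s)^2 with weights
    (1 + xi) / 2 and (1 - xi) / 2 when -1 < xi < 1. *)
Lemma quad_ge xi : -1 < xi ->
  exists2 d : R, 0 < d & forall s, 0 <= s -> d * (1 + s) ^+ 2 <= quad xi s.
Proof.
move=> xi1; rewrite /quad; have [x1|x1] := leP 1 xi.
  exists 1 => // s s0; have : 0 <= s * (xi - 1) by rewrite mulr_ge0// subr_ge0.
  lra.
exists ((1 + xi) / 2); first lra.
move=> s s0; have : 0 <= (1 - xi) * (1 - s) ^+ 2.
  by rewrite mulr_ge0 ?sqr_ge0// subr_ge0 ltW.
lra.
Qed.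

Lemma quad_gt0 xi s : -1 < xi -> 0 <= s -> 0 < quad xi s.
Proof.
move=> /quad_ge[d d0 h] s0; apply: lt_le_trans (h s s0).
by rewrite mulr_gt0// exprn_gt0// ltr_wpDr.
Qed.

(** Integrating the derivative of the remainder from 0 gains one power of s at
    each order; the constant depends on xi only through bounds on quad. *)
Lemma remainder_near0 (A : set R) (s0 d M : R) : s0 <= 1 -> 0 < d ->
  (forall xi, A xi -> `|xi| <= M /\ forall s, 0 <= s <= s0 -> d <= quad xi s) ->
  forall k lam, 0 < lam -> exists2 C, 0 <= C &
    forall xi s, A xi -> 0 <= s <= s0 -> `|remainder lam xi k s| <= C * s ^+ k.
Proof.
move=> s01 d0 HA k.
suff: forall i, (i <= k)%N -> forall lam, 0 < lam -> exists2 C, 0 <= C &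
    forall xi s, A xi -> 0 <= s <= s0 -> `|remainder lam xi i s| <= C * s ^+ i.
  by apply.
elim: k => [|k IH] i.
  rewrite leqn0 => /eqP -> lam lam0; exists (d `^ (- lam)); first exact: powR_ge0.
  move=> xi s Axi ss; rewrite /remainder big_ord0 subr0 expr0 mulr1.
  rewrite ger0_norm ?powR_ge0//; apply: powR_opp_le => //; first exact: ltW.
  by have [_] := HA _ Axi; apply.
rewrite leq_eqVlt => /predU1P[->{i}|]; last by rewrite ltnS; exact: IH.
move=> lam lam0.
have lam1 : 0 < lam + 1 by rewrite ltr_pwDr// ltW.
have [C1 C10 H1] := IH k (leqnn k) _ lam1.
have [C2 C20 H2] := IH k.-1 (leq_pred k) _ lam1.
exists (2 * lam * (`|M| * C1 + C2)).
  by rewrite !mulr_ge0// ?addr_ge0// ?mulr_ge0// ltW.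
move=> xi s Axi /andP[s_ge0 ss0]; have [xM qd] := HA _ Axi.
have q0 t : 0 <= t <= s -> 0 < quad xi t.
  by move=> /andP[t0 ts]; apply: (lt_le_trans d0); apply: qd; rewrite t0 (le_trans ts).
have [||c] := @MVT_segment _ (remainder lam xi k.+1) (fun s => - 2 * lam *
   (xi * remainder (lam + 1) xi k s + s * remainder (lam + 1) xi k.-1 s)) 0 s s_ge0.
- move=> t; rewrite in_itv/= => /andP[/ltW t0 /ltW ts].
  by apply: (der_remainder _ k.+1); apply: q0; rewrite t0.
- apply: derivable_within_continuous => t; rewrite in_itv/= => t0s.
  by have [] := der_remainder lam k.+1 (q0 _ t0s).
rewrite in_itv/= => /andP[c0 cs]; rewrite remainder0 !subr0 => ->.
rewrite exprSr mulrA normrM (ger0_norm s_ge0) ler_wpM2r//.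
have cs0 : 0 <= c <= s0 by rewrite c0 (le_trans cs).
have l2 : `|-2 * lam| = 2 * lam by rewrite ler0_norm; lra.
rewrite normrM l2 -(mulrA (2 * lam)).
rewrite ler_wpM2l ?mulr_ge0 ?(ltW lam0)// mulrDl.
apply: (le_trans (ler_normD _ _)); rewrite !normrM; apply: lerD.
  rewrite -mulrA ler_pM//; first exact: (le_trans xM (ler_norm _)).
  apply: (le_trans (H1 _ _ Axi cs0)); rewrite ler_wpM2l//.
  by rewrite lerXn2r ?nnegrE.
rewrite (ger0_norm c0); apply: (@le_trans _ _ (c * (C2 * c ^+ k.-1))).
  by rewrite ler_wpM2l//; exact: H2.
rewrite mulrCA ler_wpM2l//.
case: (k) => [|k'] /=; first by rewrite !expr0 mulr1 (le_trans cs)// (le_trans ss0).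
by rewrite -exprS lerXn2r ?nnegrE.
Qed.

(** The exponent of the growth of a remainder at infinity: that of the last
    subtracted term, or of the generating function itself. *)
Definition growth k lam : R := if k is j.+1 then j%:R else - 2 * lam.

Lemma remainder_nearoo lam xi k : 0 < lam -> -1 < xi -> exists2 C, 0 <= C &
  forall s, 1 <= s -> `|remainder lam xi k s| <= C * s `^ growth k lam.
Proof.
move=> lam0 xi1; have [d d0 qd] := quad_ge xi1.
have fb s : 1 <= s -> `|genfun lam xi s| <= d `^ (- lam) * s `^ (- 2 * lam).
  move=> s1; have s0 : 0 < s by exact: lt_le_trans s1.
  rewrite ger0_norm ?powR_ge0//.
  have -> : s `^ (- 2 * lam) = (s ^+ 2) `^ (- lam).
    by rewrite -powR_mulrn ?(ltW s0)// -powRrM; congr (_ `^ _); ring.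
  rewrite -powRM ?exprn_ge0 ?(ltW s0) ?(ltW d0)//.
  apply: powR_opp_le; [exact: ltW|by rewrite mulr_gt0// exprn_gt0|].
  by apply: le_trans (qd s (ltW s0)); rewrite ler_pM2l// lerXn2r ?nnegrE ?addr_ge0 ?(ltW s0)// lerDr.
case: k => [|k].
  exists (d `^ (- lam)); first exact: powR_ge0.
  by move=> s s1; rewrite /remainder big_ord0 subr0; exact: fb.
exists (d `^ (- lam) + \sum_(j < k.+1) `|coef lam xi j|).
  by rewrite addr_ge0 ?powR_ge0// sumr_ge0.
move=> s s1; have s0 : 0 <= s by exact: le_trans s1.
rewrite /growth powR_mulrn// mulrDl; apply: (le_trans (ler_normB _ _)); apply: lerD.
  apply: (le_trans (fb s s1)); rewrite ler_wpM2l ?powR_ge0//.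
  apply: (@le_trans _ _ (s `^ 0)); first by apply: ler_powR => //; lra.
  by rewrite powRr0 exprn_ege1.
apply: (le_trans (ler_norm_sum _ _ _)); rewrite mulr_suml; apply: ler_sum => j _.
rewrite normrM normrX (ger0_norm s0) ler_wpM2l//.
by apply: ler_weXn2l => //; rewrite -ltnS.
Qed.

(** The exponents for which the Mellin integral of the remainder converges. *)
Definition valid k rho lam := growth k lam < rho < k%:R.

Lemma valid_pred1 k rho lam : 0 < lam -> valid k rho lam -> valid k.-1 (rho - 1) (lam + 1).
Proof.
rewrite /valid /growth => lam0; case: k => [|[|k]] /=; lra.
Qed.

Lemma valid_pred2 k rho lam : 0 < lam -> valid k rho lam -> valid k.-2 (rho - 2) (lam + 1).
Proof.
rewrite /valid /growth => lam0; case: k => [|[|[|k]]] /=; lra.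
Qed.

Lemma valid_succ k rho lam : valid k rho lam -> valid k rho (lam + 1).
Proof. by rewrite /valid /growth; case: k => [|k] //=; lra. Qed.

Lemma tame_remainder k rho lam xi : valid k rho lam -> 0 < lam -> -1 < xi ->
  tame (fun s => s `^ (- rho - 1) * remainder lam xi k s).
Proof.
move=> /andP[v1 v2] lam0 xi1; split.
  move=> s; rewrite in_itv/= andbT => s0.
  have dr := der_remainder lam k (quad_gt0 xi1 (ltW s0)).
  have dp : is_derive s 1 (fun s => s `^ (- rho - 1)) ((- rho - 1) * s `^ (- rho - 1 - 1) * 1).
    by apply: der_powR.
  exact: (der_continuous (der_mul dp dr)).
have [d d0 qd] := quad_ge xi1.
have [|C1 C10 H1] := @remainder_near0 [set xi] 1 d `|xi| (lexx _) d0 _ k lam lam0.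
  move=> _ ->; split => // s /andP[s0 _]; apply: le_trans (qd s s0).
  by rewrite ler_peMr ?(ltW d0)// exprn_ege1// lerDl.
have [C2 C20 H2] := remainder_nearoo k lam0 xi1.
exists (Num.min (k%:R - rho) (rho - growth k lam)), (C1 + C2); split.
- by rewrite lt_min !subr_gt0 v1 v2.
- exact: addr_ge0.
- move=> s /andP[s0 s1]; rewrite normrM (ger0_norm (powR_ge0 _ _)).
  apply: (@le_trans _ _ (s `^ (- rho - 1) * (C1 * s ^+ k))).
    by rewrite ler_wpM2l ?powR_ge0//; apply: H1 => //; rewrite (ltW s0).
  rewrite mulrCA -powR_mulrn ?(ltW s0)// -powRD ?(gt_eqF s0) ?implybT//.
  apply: ler_pM; rewrite ?powR_ge0//; first by rewrite lerDl.
  apply: ger_powR; first by rewrite s0.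
  by rewrite lerBlDr minEle; case: ifP; lra.
- move=> s s1; have s0 : 0 < s by exact: lt_le_trans s1.
  rewrite normrM (ger0_norm (powR_ge0 _ _)).
  apply: (@le_trans _ _ (s `^ (- rho - 1) * (C2 * s `^ growth k lam))).
    by rewrite ler_wpM2l ?powR_ge0//; exact: H2.
  rewrite mulrCA -powRD ?(gt_eqF s0) ?implybT//.
  apply: ler_pM; rewrite ?powR_ge0//; first by rewrite lerDr.
  by apply: ler_powR => //; rewrite minEle; case: ifP; lra.
Qed.

End kernel.

(** * Mellin transforms of the remainders *)

Section mellin.
Context {R : realType}.
Implicit Types (lam xi s t rho : R) (j k : nat).
Notation mu := (@lebesgue_measure R).
Local Notation half := (`]0, +oo[%classic : set R).

(** For k = q.+1 this is, up to the sign and a constant, the indicator of order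
    rho; the other parameters occur through the recursions below. *)
Definition mellin k rho lam xi : R :=
  \int[mu]_(s in half) (s `^ (- rho - 1) * remainder lam xi k s).

Lemma mellinE k rho lam xi : mellin k rho lam xi =
  \int[mu]_(s in half) (s `^ (- rho - 1) * remainder lam xi k s).
Proof. by []. Qed.

Lemma powRS s (x : R) : 0 < s -> s `^ (x + 1) = s * s `^ x.
Proof.
by move=> s0; rewrite powRD ?(gt_eqF s0) ?implybT// powRr1 ?(ltW s0)// mulrC.
Qed.

(** Integration by parts, with der_remainder for the derivative. *)
Lemma mellin_rec k rho lam xi : valid k rho lam -> 0 < lam -> -1 < xi ->
  rho * mellin k rho lam xi = - 2 * lam *
    (xi * mellin k.-1 (rho - 1) (lam + 1) xi + mellin k.-2 (rho - 2) (lam + 1) xi).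
Proof.
move=> v lam0 xi1.
have lam1 : 0 < lam + 1 by rewrite ltr_pwDr// ltW.
have t0 := tame_remainder v lam0 xi1.
have t1 := tame_remainder (valid_pred1 lam0 v) lam1 xi1.
have t2 := tame_remainder (valid_pred2 lam0 v) lam1 xi1.
have t0' := tameZ (- rho) t0.
have t1' := tameZ xi t1.
have t12 := tameZ (- 2 * lam) (tameD t1' t2).
have tg := tameD t0' t12.
have := integral_tame_derivative t0 tg.
rewrite (Rintegral_tameD t0' t12) (Rintegral_tameZ _ t0) (Rintegral_tameZ _ (tameD t1' t2)).
rewrite (Rintegral_tameD t1' t2) (Rintegral_tameZ _ t1).
rewrite -/(mellin k rho lam xi) -/(mellin k.-1 (rho - 1) (lam + 1) xi).
rewrite -/(mellin k.-2 (rho - 2) (lam + 1) xi) => h.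
suff : - rho * mellin k rho lam xi + -2 * lam * (xi * mellin k.-1 (rho - 1) (lam + 1) xi + mellin k.-2 (rho - 2) (lam + 1) xi) = 0 by move=> e; lra.
apply: h => s s0.
have dr := der_remainder lam k (quad_gt0 xi1 (ltW s0)).
have dp : is_derive s 1 (fun s => s `^ (- rho - 1)) ((- rho - 1) * s `^ (- rho - 1 - 1) * 1).
  by apply: der_powR.
apply: (is_derive_eq (der_mul (der_id s) (der_mul dp dr))).
rewrite (_ : - (rho - 1) - 1 = - rho - 1 + 1); last by ring.
rewrite (_ : - (rho - 2) - 1 = - rho - 1 + 1 + 1); last by ring.
rewrite (_ : s `^ (- rho - 1) = s * s `^ (- rho - 1 - 1)); last first.
  by rewrite -powRS// subrK.
rewrite !powRS// (_ : s `^ (- rho - 1) = s * s `^ (- rho - 1 - 1)); last first.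
  by rewrite -powRS// subrK.
ring.
Qed.

(** Without subtracted terms this is the identity quad * quad^(-lam-1) =
    quad^(-lam) under the integral; mellin_rec carries it over to larger k. *)
Lemma mellin_split k rho lam xi : valid k rho lam -> 0 < lam -> -1 < xi ->
  mellin k rho lam xi = mellin k rho (lam + 1) xi
    + 2 * xi * mellin k.-1 (rho - 1) (lam + 1) xi + mellin k.-2 (rho - 2) (lam + 1) xi.
Proof.
suff: forall k, (forall i, (i <= k)%N -> forall rho lam, valid i rho lam -> 0 < lam -> -1 < xi ->
  mellin i rho lam xi = mellin i rho (lam + 1) xi
    + 2 * xi * mellin i.-1 (rho - 1) (lam + 1) xi + mellin i.-2 (rho - 2) (lam + 1) xi).
  by move=> /(_ k k (leqnn k)); apply.
move=> {k rho lam}; elim=> [|k IH] i.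
  rewrite leqn0 => /eqP -> rho lam v lam0 xi1 /=.
  have lam1 : 0 < lam + 1 by rewrite ltr_pwDr// ltW.
  have t0 := tame_remainder (valid_succ v) lam1 xi1.
  have t1 := tame_remainder (valid_pred1 lam0 v) lam1 xi1.
  have t2 := tame_remainder (valid_pred2 lam0 v) lam1 xi1.
  have t1' := tameZ (2 * xi) t1.
  rewrite /mellin -(Rintegral_tameZ _ t1) -(Rintegral_tameD t0 t1').
  rewrite -(Rintegral_tameD (tameD t0 t1') t2).
  apply: eq_Rintegral => s; rewrite inE/= in_itv/= andbT => s0.
  rewrite /remainder !big_ord0 !subr0 /genfun.
  rewrite (_ : - (rho - 1) - 1 = - rho - 1 + 1); last by ring.
  rewrite (_ : - (rho - 2) - 1 = - rho - 1 + 1 + 1); last by ring.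
  rewrite !(powRS _ s0).
  rewrite (_ : - lam = - (lam + 1) + 1); last by ring.
  rewrite powRS ?quad_gt0 ?(ltW s0)// {1}/quad; ring.
rewrite leq_eqVlt => /predU1P[->{i}|]; last by rewrite ltnS; exact: IH.
move=> rho lam v lam0 xi1.
have lam1 : 0 < lam + 1 by rewrite ltr_pwDr// ltW.
have rho0 : 0 < rho.
  by case/andP: v => + _; apply: le_lt_trans; rewrite /growth ler0n.
have v1 := valid_pred1 lam0 v; have v2 := valid_pred2 lam0 v.
have r0 := mellin_rec v lam0 xi1.
have r1 := mellin_rec (valid_succ v) lam1 xi1.
have r2 := mellin_rec v1 lam1 xi1.
have r3 := mellin_rec v2 lam1 xi1.
have s1 := IH k.+1.-1 (leqnn _) _ _ v1 lam1 xi1.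
have s2 := IH k.+1.-2 (leq_pred _) _ _ v2 lam1 xi1.
move: r0 r1 r2 r3 s1 s2; rewrite /=.
rewrite (_ : rho - 1 - 1 = rho - 2); last by ring.
rewrite (_ : rho - 1 - 2 = rho - 3); last by ring.
rewrite (_ : rho - 2 - 1 = rho - 3); last by ring.
rewrite (_ : rho - 2 - 2 = rho - 4); last by ring.
move=> r0 r1 r2 r3 s1 s2.
apply: (mulfI (lt0r_neq0 rho0)); rewrite r0 !mulrDr r1.
rewrite (_ : rho * (2 * xi * _) = 2 * xi * ((rho - 1) * mellin k (rho - 1) (lam + 1) xi)
  + 2 * xi * mellin k (rho - 1) (lam + 1) xi); last by ring.
rewrite (_ : rho * mellin k.-1 _ _ _ = (rho - 2) * mellin k.-1 (rho - 2) (lam + 1) xi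
  + 2 * mellin k.-1 (rho - 2) (lam + 1) xi); last by ring.
rewrite r2 r3 {1}s1 {1}s2 s1 s2; ring.
Qed.

(** Without subtracted terms one differentiates under the integral: the
    derivative in xi is monotone in xi, hence dominated by its value to the left;
    mellin_rec carries the formula over to larger k. *)
Lemma der_mellin k rho lam xi : valid k rho lam -> 0 < lam -> -1 < xi ->
  is_derive xi 1 (mellin k rho lam) (- 2 * lam * mellin k.-1 (rho - 1) (lam + 1) xi).
Proof.
suff: forall k, (forall i, (i <= k)%N -> forall rho lam xi, valid i rho lam -> 0 < lam -> -1 < xi ->
  is_derive xi 1 (mellin i rho lam) (- 2 * lam * mellin i.-1 (rho - 1) (lam + 1) xi)).
  by move=> /(_ k k (leqnn k)); apply.
move=> {k rho lam xi}; elim=> [|k IH] i.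
  rewrite leqn0 => /eqP -> rho lam xi v lam0 xi1 /=.
  have lam1 : 0 < lam + 1 by rewrite ltr_pwDr// ltW.
  pose u := (xi - 1) / 2.
  have u1 : -1 < u by rewrite /u; lra.
  have uxi : u < xi by rewrite /u; lra.
  have fE x s : s `^ (- rho - 1) * remainder lam x 0 s = s `^ (- rho - 1) * genfun lam x s.
    by rewrite /remainder big_ord0 subr0.
  have df x s : u < x -> 0 < s -> is_derive x 1 (fun x => s `^ (- rho - 1) * remainder lam x 0 s)
      (- 2 * lam * (s `^ (- (rho - 1) - 1) * remainder (lam + 1) x 0 s)).
    move=> ux s0; under eq_fun do rewrite fE.
    rewrite /remainder big_ord0 subr0.
    have q0 : 0 < quad x s by apply: quad_gt0; [exact: lt_trans ux|exact: ltW].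
    rewrite /genfun /quad; der; first exact: q0.
    rewrite (_ : - (rho - 1) - 1 = - rho - 1 + 1); last by ring.
    rewrite (powRS _ s0) (_ : - lam - 1 = - (lam + 1)); last by ring.
    ring.
  pose G s := 2 * lam * (s `^ (- (rho - 1) - 1) * remainder (lam + 1) u 0 s).
  have G0 s : 0 <= G s.
    by rewrite /G !mulr_ge0 ?(ltW lam0) ?powR_ge0// /remainder big_ord0 subr0 powR_ge0.
  have Iuv x : `]u, (xi + 1)[%classic x -> u < x by rewrite /= in_itv/= => /andP[].
  have xiI : `]u, (xi + 1)[%classic xi by rewrite /= in_itv/= uxi ltrDl ltr01.
  have intf x : `]u, (xi + 1)[%classic x ->
      mu.-integrable half (EFin \o (fun s => s `^ (- rho - 1) * remainder lam x 0 s)).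
    by move=> /Iuv ux; apply/tame_integrable/tame_remainder => //; exact: lt_trans ux.
  have dfx x s : `]u, (xi + 1)[%classic x -> half s ->
      derivable (fun x => s `^ (- rho - 1) * remainder lam x 0 s) x 1.
    by move=> /Iuv ux; rewrite /= in_itv/= andbT => s0; have [] := df x s ux s0.
  have intG : mu.-integrable half (EFin \o G).
    apply/tame_integrable/tameZ/tame_remainder => //; exact: (valid_pred1 lam0 v).
  have dE x s : `]u, (xi + 1)[%classic x -> half s ->
      partial1of2 (fun x s => s `^ (- rho - 1) * remainder lam x 0 s) x s =
      - 2 * lam * (s `^ (- (rho - 1) - 1) * remainder (lam + 1) x 0 s).
    by move=> /Iuv ux; rewrite /= in_itv/= andbT => s0; exact/der_derive1/df.
  have GG x s : `]u, (xi + 1)[%classic x -> half s ->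
      `|partial1of2 (fun x s => s `^ (- rho - 1) * remainder lam x 0 s) x s| <= G s.
    move=> Ix hs; rewrite dE//; move: Ix hs => /Iuv ux; rewrite /= in_itv/= andbT => s0.
    have l2 : `|-2 * lam| = 2 * lam by rewrite ler0_norm; lra.
    rewrite normrM l2 /G ler_wpM2l ?mulr_ge0 ?(ltW lam0)//.
    rewrite normrM (ger0_norm (powR_ge0 _ _)) ler_wpM2l ?powR_ge0//.
    rewrite /remainder !big_ord0 !subr0 ger0_norm ?powR_ge0//.
    apply: powR_opp_le; [exact: ltW|by apply: quad_gt0 => //; exact: ltW|].
    rewrite /quad lerD2r lerD2l ler_wpM2l ?mulr_ge0 ?(ltW s0)//; exact: ltW.
  have mh : measurable (half : set (measurableTypeR R)) by exact: measurable_itv.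
  have D1 := derivable_under_integral mh xiI intf dfx G0 intG GG.
  have D2 := differentiation_under_integral mh xiI intf dfx G0 intG GG.
  apply: DeriveDef; first exact: D1.
  rewrite -derive1E [LHS]D2 /mellin -RintegralZl//; last first.
    by apply/tame_integrable/tame_remainder => //; exact: (valid_pred1 lam0 v).
  by apply: eq_Rintegral => s; rewrite inE => hs; rewrite dE.
rewrite leq_eqVlt => /predU1P[->{i}|]; last by rewrite ltnS; exact: IH.
move=> rho lam xi v lam0 xi1.
have lam1 : 0 < lam + 1 by rewrite ltr_pwDr// ltW.
have rho0 : 0 < rho.
  by case/andP: v => + _; apply: le_lt_trans; rewrite /growth ler0n.
have v1 := valid_pred1 lam0 v; have v2 := valid_pred2 lam0 v.
have d1 := IH k.+1.-1 (leqnn _) _ _ _ v1 lam1 xi1.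
have d2 := IH k.+1.-2 (leq_pred _) _ _ _ v2 lam1 xi1.
have r := mellin_rec v1 lam1 xi1.
apply: (@near_eq_is_derive _ _ _ (fun x : R => - 2 * lam / rho *
    (x * mellin k (rho - 1) (lam + 1) x + mellin k.-1 (rho - 2) (lam + 1) x))).
  near=> x; have x1 : -1 < x by near: x; exact: lt_nbhsr.
  apply: (mulfI (lt0r_neq0 rho0)); rewrite (mellin_rec v lam0 x1)/=.
  by field; exact: lt0r_neq0.
apply: (is_derive_eq (der_mul (der_cst _ _) (der_add (der_mul (der_id _) d1) d2))).
move: r; rewrite /= (_ : rho - 1 - 2 = rho - 2 - 1); last by ring.
set A := mellin k _ _ _; set B := mellin k.-1 _ _ _; set C := mellin k.-2 _ _ _ => r.
transitivity (- 2 * lam / rho * (A + - 2 * (lam + 1) * (xi * B + C))); first by ring.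
by rewrite -r; field; exact: lt0r_neq0.
Unshelve. all: by end_near. Qed.

(** With der_mellin for the derivatives this is the Gegenbauer equation: the
    recursions mellin_rec and mellin_split reduce it to two transforms, whose
    coefficients cancel. *)
Lemma mellin_ode k rho lam xi : valid k rho lam -> 0 < lam -> -1 < xi ->
  (1 - xi ^+ 2) * (- 2 * lam * (- 2 * (lam + 1) * mellin k.-2 (rho - 2) (lam + 1 + 1) xi))
  - (2 * lam + 1) * xi * (- 2 * lam * mellin k.-1 (rho - 1) (lam + 1) xi)
  + rho * (rho + 2 * lam) * mellin k rho lam xi = 0.
Proof.
move=> v lam0 xi1.
have lam1 : 0 < lam + 1 by rewrite ltr_pwDr// ltW.
have v1 := valid_pred1 lam0 v; have v2 := valid_pred2 lam0 v.
have r0 := mellin_rec v lam0 xi1.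
have r1 := mellin_rec v1 lam1 xi1.
have r2 := mellin_rec v2 lam1 xi1.
have s2 := mellin_split v2 lam1 xi1.
move: r1 r2 s2; rewrite (_ : rho - 1 - 1 = rho - 2); last by ring.
rewrite (_ : rho - 1 - 2 = rho - 3); last by ring.
rewrite (_ : rho - 2 - 1 = rho - 3); last by ring.
move=> r1 r2 s2.
rewrite (mulrC rho) -(mulrA (rho + 2 * lam)) r0.
move: r1 r2 s2; set B1 := mellin k.-1 _ _ _; set B2 := mellin k.-2 _ (lam + 1) _.
set C2 := mellin k.-2 _ _ _; set C3 := mellin _ _ _ _; set C4 := mellin _ (_ - _ - _) _ _.
move=> r1 r2 s2.
have h1 : (1 - rho) * B1 = 2 * (lam + 1) * (xi * C2 + C3) by lra.
have h2 : (rho + 2 * lam) * B2 = 2 * (lam + 1) * (C2 + xi * C3).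
  rewrite (_ : _ * B2 = (rho - 2) * B2 + 2 * (lam + 1) * B2); last by ring.
  by rewrite r2 s2; ring.
transitivity (2 * lam * (2 * (lam + 1) * (1 - xi ^+ 2) * C2 + xi * ((1 - rho) * B1)
  - (rho + 2 * lam) * B2)); first by ring.
by rewrite h1 h2; ring.
Qed.

End mellin.

(* From here on the integral is reached only through mellinE. *)
#[global] Opaque mellin.

(** * The hypergeometric equation *)

Section hypergeometric.
Context {R : realType}.
Implicit Types (a b c x z : R) (u : nat -> R).

(** The recursion of the coefficients of a power series solution of the Gauss
    equation; it is preserved by formal differentiation, with a, b and c raised
    by one. *)
Definition gauss_rec a b c u := forall k,
  k.+1%:R * (c + k%:R) * u k.+1 = (a + k%:R) * (b + k%:R) * u k.

Lemma gauss_rec_diffs a b c u : gauss_rec a b c u ->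
  gauss_rec (a + 1) (b + 1) (c + 1) (pseries_diffs u).
Proof.
move=> h k; rewrite /pseries_diffs; have := h k.+1; rewrite -!natr1 => e.
rewrite (_ : (a + 1 + k%:R) * _ * _ = (k%:R + 1) * ((a + (k%:R + 1)) * (b + (k%:R + 1)) * u k.+1)); last by ring.
by rewrite -e; ring.
Qed.

(** Ratio test: the ratio of consecutive terms is at most
    (k + m)^2 |x| / k^2, and r is a number between |x| and 1. *)
Lemma gauss_rec_cvg a b c u x : 0 < c -> gauss_rec a b c u -> `|x| < 1 ->
  cvgn (pseries u x).
Proof.
move=> c0 h x1.
pose r := (`|x| + 1) / 2.
have r1 : r < 1 by rewrite /r; lra.
have xr : `|x| < r by rewrite /r; lra.
have r0 : 0 < r by apply: le_lt_trans xr.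
pose m := Num.max `|a| `|b|.
have m0 : 0 <= m by rewrite le_max normr_ge0.
pose K := (Num.truncn ((2 * m + m ^+ 2) / (r - `|x|))).+1.
have KK : (2 * m + m ^+ 2) <= K%:R * (r - `|x|).
  rewrite -ler_pdivrMr ?subr_gt0//; apply: ltW; exact: truncnS_gt.
have step k : (K <= k)%N -> `|u k.+1| * `|x| <= r * `|u k|.
  move=> Kk; have k1 : 1 <= k%:R :> R by rewrite ler1n (leq_trans _ Kk).
  have Kk' : K%:R <= k%:R :> R by rewrite ler_nat.
  have xk : (k%:R + m) ^+ 2 * `|x| <= r * k%:R ^+ 2.
    have h1 : 2 * m + m ^+ 2 <= k%:R * (r - `|x|).
      by apply: (le_trans KK); rewrite ler_wpM2r// subr_ge0 ltW.
    have h2 : k%:R * (2 * m + m ^+ 2) <= k%:R * (k%:R * (r - `|x|)) by rewrite ler_wpM2l.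
    have h3 : 0 <= (k%:R - 1) * m ^+ 2 by rewrite mulr_ge0 ?sqr_ge0// subr_ge0.
    have h4 : (2 * k%:R * m + m ^+ 2) * `|x| <= 2 * k%:R * m + m ^+ 2.
      by rewrite ler_piMr ?(ltW x1)// addr_ge0 ?sqr_ge0// !mulr_ge0.
    nra.
  have p0 : 0 < k.+1%:R * (c + k%:R) by rewrite mulr_gt0// ltr_wpDr.
  rewrite -(ler_pM2l p0) mulrA -[X in X * `|u _| * _](gtr0_norm p0) -normrM h !normrM.
  have ak : `|a + k%:R| <= k%:R + m.
    rewrite addrC (le_trans (ler_normD _ _))// ger0_norm// lerD2l.
    by rewrite /m le_max lexx.
  have bk : `|b + k%:R| <= k%:R + m.
    rewrite addrC (le_trans (ler_normD _ _))// ger0_norm// lerD2l.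
    by rewrite /m le_max lexx orbT.
  apply: (@le_trans _ _ ((k%:R + m) ^+ 2 * `|x| * `|u k|)).
    rewrite expr2 mulrAC ler_wpM2r// ler_wpM2r//.
    by apply: ler_pM.
  apply: (@le_trans _ _ (r * k%:R ^+ 2 * `|u k|)); first by rewrite ler_wpM2r.
  rewrite (_ : r * _ * _ = k%:R ^+ 2 * (r * `|u k|)); last by ring.
  rewrite ler_wpM2r ?mulr_ge0 ?(ltW r0)// expr2.
  by apply: ler_pM => //; [rewrite ler_nat|rewrite lerDr ltW].
pose M := \sum_(i < K.+1) `|u i * x ^+ i| / r ^+ i.
have uM k : `|u k * x ^+ k| <= M * r ^+ k.
  have [kK|Kk] := leqP k K.
    rewrite -ler_pdivrMr ?exprn_gt0// /M (bigD1 (Ordinal (kK : k < K.+1)%N))//= lerDl.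
    by apply: sumr_ge0 => i _; rewrite mulr_ge0// invr_ge0 exprn_ge0// ltW.
  elim: k Kk => // k IH; rewrite ltnS leq_eqVlt => /predU1P[<-|Kk].
    have KM : `|u K * x ^+ K| <= M * r ^+ K.
      rewrite -ler_pdivrMr ?exprn_gt0// /M (bigD1 ord_max)//= lerDl.
      by apply: sumr_ge0 => i _; rewrite mulr_ge0// invr_ge0 exprn_ge0// ltW.
    rewrite exprS mulrA normrM normrM exprS mulrCA.
    apply: (@le_trans _ _ (r * `|u K| * `|x ^+ K|)).
      by rewrite ler_wpM2r//; exact: step.
    by rewrite -mulrA -normrM ler_wpM2l// ltW.
  rewrite exprS mulrA normrM normrM exprS mulrCA.
  apply: (@le_trans _ _ (r * `|u k| * `|x ^+ k|)).
    by rewrite ler_wpM2r//; apply: step; exact: ltnW.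
  by rewrite -mulrA -normrM ler_wpM2l ?(ltW r0)//; exact: IH.
apply: normed_cvg; apply: (@series_le_cvg _ _ (fun k => M * r ^+ k)).
- by move=> k; exact: normr_ge0.
- by move=> k; apply: le_trans (uM k); exact: normr_ge0.
- exact: uM.
- by apply: is_cvg_geometric_series; rewrite ger0_norm// ltW.
Qed.

Lemma der_gauss_series a b c u x : 0 < c -> gauss_rec a b c u -> `|x| < 1 ->
  is_derive x 1 (fun x => limn (pseries u x)) (limn (pseries (pseries_diffs u) x)).
Proof.
move=> c0 h x1; pose K := (`|x| + 1) / 2.
have x0 := normr_ge0 x.
have xK : `|x| < `|K| by rewrite (@ger0_norm _ K) /K; lra.
have K1 : `|K| < 1 by rewrite (@ger0_norm _ K) /K; lra.
have h1 := gauss_rec_diffs h; have h2 := gauss_rec_diffs h1.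
have c1 : 0 < c + 1 by rewrite addr_gt0.
have c2 : 0 < c + 1 + 1 by rewrite addr_gt0.
by apply: (pseries_snd_diffs _ _ _ xK); [exact: gauss_rec_cvg h K1|exact: gauss_rec_cvg h1 K1|exact: gauss_rec_cvg h2 K1].
Qed.

(** The coefficients of the left hand side vanish by the recursion, so already
    the corresponding combination of partial sums is zero. *)
Lemma gauss_series_ode a b c u x : 0 < c -> gauss_rec a b c u -> `|x| < 1 ->
  x * (1 - x) * limn (pseries (pseries_diffs (pseries_diffs u)) x)
  + (c - (a + b + 1) * x) * limn (pseries (pseries_diffs u) x)
  - a * b * limn (pseries u x) = 0.
Proof.
move=> c0 h x1; have h1 := gauss_rec_diffs h; have h2 := gauss_rec_diffs h1.
have c1 : 0 < c + 1 by rewrite addr_gt0.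
have c2 : 0 < c + 1 + 1 by rewrite addr_gt0.
have C0 := gauss_rec_cvg c0 h x1; have C1 := gauss_rec_cvg c1 h1 x1.
have C2 := gauss_rec_cvg c2 h2 x1.
pose sr (p : nat -> R) := series (fun i => p i * x ^+ i).
have xdiff (p : nat -> R) : cvgn (pseries (pseries_diffs p) x) ->
    sr (fun i => i%:R * p i) n @[n --> \oo] --> x * limn (pseries (pseries_diffs p) x).
  move=> /pseries_diffs_equiv H.
  have -> : sr (fun i => i%:R * p i) = (fun n => x * series (fun i => i%:R * p i * x ^+ i.-1) n).
    apply/funext => n; rewrite /sr /series/= mulr_sumr; apply: eq_bigr => i _.
    by case: i => [|i]; [rewrite !mul0r mulr0|rewrite exprS/=; ring].
  by apply: cvgM => //; exact: cvg_cst.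
have S0 : sr u n @[n --> \oo] --> limn (pseries u x) by exact: C0.
have S1 : sr (pseries_diffs u) n @[n --> \oo] --> limn (pseries (pseries_diffs u) x) by exact: C1.
have T1 := xdiff u C1.
have T2 := xdiff _ C2.
(* The coefficients of x F' - F, whose derivative is x F''. *)
pose w i : R := (i%:R - 1) * u i.
have dw : pseries_diffs w = (fun i => i%:R * pseries_diffs u i).
  by apply/funext => i; rewrite /pseries_diffs /w -natr1; ring.
have Cw : cvgn (pseries (pseries_diffs w) x) by rewrite dw; apply/cvg_ex; exists (x * limn (pseries (pseries_diffs (pseries_diffs u)) x)); exact: T2.
have T3 := xdiff w Cw.
rewrite dw (_ : limn _ = x * limn (pseries (pseries_diffs (pseries_diffs u)) x)) in T3; last first.
  by apply/cvg_lim => //; exact: T2.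
set F0 := limn (pseries u x) in S0 *; set F1 := limn (pseries (pseries_diffs u) x) in S1 T1 *.
set F2 := limn (pseries (pseries_diffs _) x) in T2 T3 *.
have L : (fun n => sr (fun i => i%:R * pseries_diffs u i) n - sr (fun i => i%:R * w i) n
   + c * sr (pseries_diffs u) n - (a + b + 1) * sr (fun i => i%:R * u i) n
   - a * b * sr u n) n @[n --> \oo] --> x * F2 - x * (x * F2) + c * F1 - (a + b + 1) * (x * F1)
   - a * b * F0.
  apply: cvgB; last by apply: cvgM => //; exact: cvg_cst.
  apply: cvgB; last by apply: cvgM => //; exact: cvg_cst.
  apply: cvgD; last by apply: cvgM => //; exact: cvg_cst.
  exact: cvgB.
have Z : (fun n => sr (fun i => i%:R * pseries_diffs u i) n - sr (fun i => i%:R * w i) n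
   + c * sr (pseries_diffs u) n - (a + b + 1) * sr (fun i => i%:R * u i) n
   - a * b * sr u n) = (fun=> 0).
  apply/funext => n; rewrite /sr /series/= !mulr_sumr -!sumrN -!big_split/=.
  apply: big1 => i _; rewrite /w /pseries_diffs; have := h i; rewrite -natr1 => e.
  transitivity (((i%:R + 1) * (c + i%:R) * u i.+1 - (a + i%:R) * (b + i%:R) * u i) * x ^+ i).
    by ring.
  by rewrite e subrr mul0r.
rewrite Z in L.
have e := cvg_unique (@Rhausdorff R) (cvg_cst 0) L.
by rewrite [RHS]e; ring.
Qed.

Definition hyp_coef a b c k : R :=
  pochhammer a k * pochhammer b k / (pochhammer c k * k`!%:R).

Lemma hyp_coef_rec a b c : 0 < c -> gauss_rec a b c (hyp_coef a b c).
Proof.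
move=> c0 k; rewrite /hyp_coef /pochhammer !big_nat_recr//= factS natrM.
have p0 : \prod_(0 <= i < k) (c + i%:R) != 0.
  by rewrite prodf_seq_neq0; apply/allP => i _; rewrite implyTb gt_eqF// ltr_wpDr.
have f0 : k`!%:R != 0 :> R by rewrite pnatr_eq0 -lt0n fact_gt0.
have ck : c + k%:R != 0 by rewrite gt_eqF// ltr_wpDr.
have k0 : k.+1%:R != 0 :> R by rewrite pnatr_eq0.
rewrite -natr1 in k0 *.
by field; rewrite f0 p0 k0 ck.
Qed.

Lemma hyp2F1_at0 a b c : hyp2F1 a b c 0 = 1.
Proof.
apply/cvg_lim => //; apply: cvg_near_cst; near=> n.
have n0 : (0 < n)%N by near: n; exact: nbhs_infty_gt.
rewrite /series/= -(prednK n0) big_nat_recl//= big1 ?addr0; last first.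
  by move=> i _; rewrite exprS mul0r mulr0.
by rewrite /pochhammer !big_nil expr0 fact0 !mulr1 divr1.
Unshelve. all: by end_near. Qed.

Lemma hyp2F1C a b c z : hyp2F1 a b c z = hyp2F1 b a c z.
Proof. by rewrite /hyp2F1; under eq_fun do rewrite (mulrC (pochhammer a _)). Qed.

(** The power of 1 - z changes the exponents at 1, and thereby turns the Gauss
    equation into the Gegenbauer equation in the variable z = (1 - xi) / 2. *)
Lemma legendre_factor_ode (lam rho z : R) : 0 < lam -> 0 <= z < 1 ->
  let c := lam + 2^-1 in
  let a := lam + 2^-1 + rho in
  let b := 2^-1 - lam - rho in
  let u := hyp_coef a b c in
  let F0 z := limn (pseries u z) in
  let F1 z := limn (pseries (pseries_diffs u) z) in
  let F2 := limn (pseries (pseries_diffs (pseries_diffs u)) z) in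
  let p := 2^-1 - lam in
  let v z := (1 - z) `^ p * F0 z in
  let v1 z := (1 - z) `^ p * F1 z - p * ((1 - z) `^ (p - 1) * F0 z) in
  let v2 := (1 - z) `^ p * F2 - 2 * p * (1 - z) `^ (p - 1) * F1 z
            + p * (p - 1) * (1 - z) `^ (p - 1 - 1) * F0 z in
  [/\ is_derive z 1 v (v1 z), is_derive z 1 v1 v2 &
    z * (1 - z) * v2 + c * (1 - 2 * z) * v1 z + rho * (rho + 2 * lam) * v z = 0].
Proof.
move=> lam0 /andP[z0 z1] c a b u F0 F1 F2 p v v1 v2.
have c0 : 0 < c by rewrite /c addr_gt0.
have c1 : 0 < c + 1 by rewrite addr_gt0.
have nz : `|z| < 1 by rewrite ger0_norm.
have h := @hyp_coef_rec a b c c0; have h1 := gauss_rec_diffs h.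
have d0 : is_derive z 1 F0 (F1 z) by exact: der_gauss_series h nz.
have d1 : is_derive z 1 F1 F2 by exact: der_gauss_series h1 nz.
have w0 : 0 < 1 - z by rewrite subr_gt0.
have dw q : is_derive z 1 (fun z => (1 - z) `^ q) (- q * (1 - z) `^ (q - 1)).
  by der; [exact: w0|ring].
split.
- by apply: (is_derive_eq (der_mul (dw p) d0)); rewrite /v1; ring.
- apply: (is_derive_eq (der_add (der_mul (dw p) d1)
    (der_opp (der_mul (der_cst p z) (der_mul (dw (p - 1)) d0))))).
  by rewrite /v2; ring.
have := gauss_series_ode c0 h nz.
rewrite -/F2 -/(F1 z) -/(F0 z) => G.
rewrite /v2 /v1 /v.
set W := (1 - z) `^ (p - 1 - 1).
have W1 : (1 - z) `^ (p - 1) = (1 - z) * W by rewrite -powRS// subrK.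
have W0 : (1 - z) `^ p = (1 - z) * ((1 - z) * W) by rewrite -W1 -powRS// subrK.
rewrite W0 W1.
transitivity ((1 - z) ^+ 2 * W * (z * (1 - z) * F2 + (c - (a + b + 1) * z) * F1 z - a * b * F0 z)); last by rewrite G mulr0.
by rewrite /a /b /c /p; field.
Qed.

Lemma legendre_factor (lam rho : R) : 0 < lam -> exists w w1 w2 : R -> R,
  [/\ forall z, 0 <= z < 1 -> is_derive z 1 w (w1 z) /\ is_derive z 1 w1 (w2 z),
    forall z, 0 <= z < 1 -> z * (1 - z) * w2 z + (lam + 2^-1) * (1 - 2 * z) * w1 z
      + rho * (rho + 2 * lam) * w z = 0,
    w 0 = 1 &
    forall z, w z = (1 - z) `^ (2^-1 - lam) *
      hyp2F1 (lam + 2^-1 + rho) (2^-1 - lam - rho) (lam + 2^-1) z].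
Proof.
move=> lam0.
pose u := hyp_coef (lam + 2^-1 + rho) (2^-1 - lam - rho) (lam + 2^-1).
pose F0 z := limn (pseries u z); pose F1 z := limn (pseries (pseries_diffs u) z).
pose F2 z := limn (pseries (pseries_diffs (pseries_diffs u)) z).
pose p := 2^-1 - lam.
exists (fun z => (1 - z) `^ p * F0 z),
  (fun z => (1 - z) `^ p * F1 z - p * ((1 - z) `^ (p - 1) * F0 z)),
  (fun z => (1 - z) `^ p * F2 z - 2 * p * (1 - z) `^ (p - 1) * F1 z
            + p * (p - 1) * (1 - z) `^ (p - 1 - 1) * F0 z).
split.
- by move=> z z01; have [] := @legendre_factor_ode lam rho z lam0 z01.
- by move=> z z01; have [] := @legendre_factor_ode lam rho z lam0 z01.
- by rewrite subr0 powR1 mul1r; exact: hyp2F1_at0.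
- by [].
Qed.

End hypergeometric.

(** * Uniqueness at the regular singular point *)

Section uniqueness.
Context {R : realType}.
Implicit Types (f df : R -> R) (a b z t : R).

Lemma derive_le0_nincr f df a b : a <= b ->
  (forall t, a <= t <= b -> is_derive t 1 f (df t)) ->
  (forall t, a <= t <= b -> df t <= 0) -> f b <= f a.
Proof.
move=> ab dF df0.
have [||c] := @MVT_segment _ f df a b ab.
- by move=> t; rewrite in_itv/= => /andP[/ltW ta /ltW tb]; apply: dF; rewrite ta.
- apply: derivable_within_continuous => t; rewrite in_itv/= => tab.
  by have [] := dF t tab.
rewrite in_itv/= => cab e; rewrite -subr_le0 e.
by rewrite mulr_le0_ge0 ?subr_ge0//; exact: df0.
Qed.

(** The solution of the Gegenbauer equation vanishing at the regular singular
    point 0 is zero: the energy z (1 - z) d'^2 + kappa d^2 decreases up to 1/2,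
    and after multiplication by (z (1 - z))^N also beyond. *)
Lemma gegenbauer_unique (N : nat) (kappa : R) (d d1 d2 : R -> R) :
  (0 < N)%N -> 0 < kappa ->
  (forall z, 0 <= z < 1 -> is_derive z 1 d (d1 z)) ->
  (forall z, 0 <= z < 1 -> is_derive z 1 d1 (d2 z)) ->
  (forall z, 0 <= z < 1 -> z * (1 - z) * d2 z
     + (N%:R + 1) / 2 * (1 - 2 * z) * d1 z + kappa * d z = 0) ->
  d 0 = 0 -> forall z, 0 <= z < 1 -> d z = 0.
Proof.
move=> N0 k0 D D1 ode d0.
pose E z := z * (1 - z) * d1 z ^+ 2 + kappa * d z ^+ 2.
have E0 : E 0 = 0 by rewrite /E d0 !mul0r expr0n mulr0 addr0.
have dE z : 0 <= z < 1 -> is_derive z 1 E (- N%:R * (1 - 2 * z) * d1 z ^+ 2).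
  move=> z01; have a := D z z01; have b := D1 z z01; rewrite /E; der.
  have := ode z z01; rewrite /= expr1 => e.
  transitivity ((1 - 2 * z) * d1 z ^+ 2 + 2 * d1 z * (z * (1 - z) * d2 z + kappa * d z)); first by ring.
  rewrite (_ : _ + kappa * d z = - ((N%:R + 1) / 2 * (1 - 2 * z) * d1 z)); last by lra.
  by field.
have Ed z : 0 <= z < 1 -> E z <= 0 -> d z = 0.
  move=> /andP[z0 z1] Ez; apply/eqP; rewrite -sqrf_eq0.
  have h1 : 0 <= z * (1 - z) * d1 z ^+ 2 by rewrite mulr_ge0 ?sqr_ge0// mulr_ge0// subr_ge0 ltW.
  rewrite eq_le sqr_ge0 andbT -(pmulr_rle0 _ k0).
  by move: Ez; rewrite /E; lra.
have N1 : 0 <= N%:R :> R by [].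
have Ele z : 0 <= z <= 2^-1 -> E z <= 0.
  move=> /andP[z0 z2]; rewrite -[leRHS]E0.
  apply: (@derive_le0_nincr E (fun z => - N%:R * (1 - 2 * z) * d1 z ^+ 2) 0 z z0) => t /andP[t0 tz].
    by apply: dE; lra.
  rewrite /= !mulNr oppr_le0 mulr_ge0 ?sqr_ge0// mulr_ge0//; lra.
move=> z /andP[z0 z1]; have [z2|z2] := leP z 2^-1.
  by apply: Ed; rewrite ?z0 ?z1//; apply: Ele; rewrite z0.
apply: Ed; first by rewrite z0.
pose G z := (z * (1 - z)) ^+ N * E z.
have dG t : 2^-1 <= t <= z -> is_derive t 1 G
    (N%:R * (t * (1 - t)) ^+ N.-1 * (1 - 2 * t) * (kappa * d t ^+ 2)).
  move=> t2; have e := dE t; rewrite /G; der; first by apply: e; lra.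
  rewrite -{1}(prednK N0) exprS /E; ring.
have Gz : G z <= G 2^-1.
  apply: (derive_le0_nincr (ltW z2) dG) => t /andP[t2 tz].
  rewrite -mulrA mulr_ge0_le0//.
    by rewrite mulr_ge0// exprn_ge0// mulr_ge0; lra.
  by rewrite mulr_le0_ge0; [|lra|rewrite mulr_ge0 ?sqr_ge0// ltW].
have Gh : G 2^-1 <= 0.
  rewrite /G mulr_ge0_le0//; first by rewrite exprn_ge0//; lra.
  by apply: Ele; lra.
have := le_trans Gz Gh; rewrite /G pmulr_rle0// exprn_gt0// mulr_gt0; lra.
Qed.

End uniqueness.

(** * Mellin transforms as Legendre functions *)

Section mellin_legendre.
Context {R : realType}.
Implicit Types (rho z : R).

(** Both sides solve the Gegenbauer equation in z and agree at z = 0. *)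
Lemma mellin_legendre k rho (N : nat) z : (0 < N)%N -> 0 < rho ->
  valid k rho (N%:R / 2) -> 0 <= z < 1 ->
  mellin k rho (N%:R / 2) (1 - 2 * z) = mellin k rho (N%:R / 2) 1 *
    ((1 - z) `^ (2^-1 - N%:R / 2) *
     hyp2F1 (N%:R / 2 + 2^-1 + rho) (2^-1 - N%:R / 2 - rho) (N%:R / 2 + 2^-1) z).
Proof.
move=> N0 rho0 v z01; set lam : R := N%:R / 2 in v *.
have lam0 : 0 < lam by rewrite /lam divr_gt0// ltr0n.
have lam1 : 0 < lam + 1 by rewrite ltr_pwDr// ltW.
have v1 := valid_pred1 lam0 v; have v2 := valid_pred1 lam1 v1.
set A := mellin k rho lam 1.
have [w [w1 [w2 [dw ow w0 wE]]]] := @legendre_factor R lam rho lam0.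
rewrite -wE.
have [y [y1 [y2 [dy oy y0 yE]]]] : exists y y1 y2 : R -> R,
  [/\ forall z, 0 <= z < 1 -> is_derive z 1 y (y1 z) /\ is_derive z 1 y1 (y2 z),
    forall z, 0 <= z < 1 -> z * (1 - z) * y2 z + (lam + 2^-1) * (1 - 2 * z) * y1 z
      + rho * (rho + 2 * lam) * y z = 0,
    y 0 = A &
    forall z, y z = mellin k rho lam (1 - 2 * z)].
  have lin (t : R) : is_derive t 1 (fun t : R => 1 - 2 * t) (- 2) by der; ring.
  exists (fun z => mellin k rho lam (1 - 2 * z)),
    (fun z => - 2 * (- 2 * lam * mellin k.-1 (rho - 1) (lam + 1) (1 - 2 * z))),
    (fun z => 4 * (- 2 * lam * (- 2 * (lam + 1) *
       mellin k.-2 (rho - 2) (lam + 1 + 1) (1 - 2 * z)))).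
  split.
  - move=> t t01; have t1 : -1 < 1 - 2 * t by lra.
    split.
      by apply: (is_derive_eq (@der_comp R _ (fun t => 1 - 2 * t) _ _ _ (der_mellin v lam0 t1) (lin t))); ring.
    have dm := @der_comp R _ (fun t => 1 - 2 * t) _ _ _ (der_mellin v1 lam1 t1) (lin t).
    apply: (is_derive_eq (der_mul (der_cst (- 2 : R) t) (der_mul (der_cst (- 2 * lam) t) dm))).
    by rewrite (_ : rho - 1 - 1 = rho - 2); ring.
  - move=> t t01; have t1 : -1 < 1 - 2 * t by lra.
    by rewrite -[RHS](mellin_ode v lam0 t1); field.
  - by rewrite mulr0 subr0.
  - by [].
rewrite -yE; apply/eqP; rewrite -subr_eq0; apply/eqP.
apply: (@gegenbauer_unique R N (rho * (rho + 2 * lam)) (fun z => y z - A * w z)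
  (fun z => y1 z - A * w1 z) (fun z => y2 z - A * w2 z)).
- exact: N0.
- by rewrite mulr_gt0// addr_gt0// mulr_gt0.
- move=> t t01; have [a _] := dy t t01; have [b _] := dw t t01.
  by apply: (is_derive_eq (der_add a (der_opp (der_mul (der_cst A t) b)))); ring.
- move=> t t01; have [_ a] := dy t t01; have [_ b] := dw t t01.
  by apply: (is_derive_eq (der_add a (der_opp (der_mul (der_cst A t) b)))); ring.
- move=> t t01; rewrite (_ : (N%:R + 1) / 2 = lam + 2^-1); last by rewrite /lam; field.
  have a := oy t t01; have b := ow t t01.
  transitivity ((t * (1 - t) * y2 t + (lam + 2^-1) * (1 - 2 * t) * y1 t
      + rho * (rho + 2 * lam) * y t)
    - A * (t * (1 - t) * w2 t + (lam + 2^-1) * (1 - 2 * t) * w1 t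
      + rho * (rho + 2 * lam) * w t)); first by ring.
  by rewrite a b mulr0 subr0.
- by rewrite y0 w0 mulr1 subrr.
- exact: z01.
Qed.

End mellin_legendre.

(** * The reflection formula *)

Section reflection.
Context {R : realType}.
Implicit Types (lam xi s t rho th : R) (j k : nat).
Notation mu := (@lebesgue_measure R).
Local Notation half := (`]0, +oo[%classic : set R).

Lemma cos_gtN1 th : 0 <= th < pi -> -1 < cos th.
Proof.
move=> /andP[t0 tp]; rewrite -cospi ltr_cos ?in_itv/= ?t0 ?(ltW tp) ?lexx ?pi_ge0//.
Qed.

Lemma derive0_cst (f : R -> R) (a b : R) : a <= b ->
  (forall t, a <= t <= b -> is_derive t 1 f 0) -> f b = f a.
Proof.
move=> ab df.
have [||c _] := @MVT_segment _ f (fun=> 0) a b ab.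
- by move=> t; rewrite in_itv/= => /andP[/ltW ta /ltW tb]; apply: df; rewrite ta.
- apply: derivable_within_continuous => t; rewrite in_itv/= => tab.
  by have [] := df t tab.
by rewrite mul0r => /eqP; rewrite subr_eq0 => /eqP.
Qed.

(** Two constants of motion solve the equation of the oscillator. *)
Lemma oscillator (w T : R) (P P1 : R -> R) :
  (forall t, 0 <= t < T -> is_derive t 1 P (P1 t)) ->
  (forall t, 0 <= t < T -> is_derive t 1 P1 (- w ^+ 2 * P t)) -> P 0 = 0 ->
  forall th, 0 <= th < T -> w * P th = P1 0 * sin (w * th).
Proof.
move=> dP dP1 P0 th /andP[t0 tT].
have dw t : is_derive t 1 (fun t => sin (w * t)) (w * cos (w * t)) by der; ring.
have dw' t : is_derive t 1 (fun t => cos (w * t)) (- w * sin (w * t)) by der; ring.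
have iv t : 0 <= t <= th -> 0 <= t < T.
  by move=> /andP[-> tt]; rewrite (le_lt_trans tt).
have := @derive0_cst (fun t => P1 t * cos (w * t) + w * (P t * sin (w * t))) 0 th t0.
rewrite P0 mulr0 cos0 mul0r mulr0 addr0 mulr1 => A.
have := @derive0_cst (fun t => P1 t * sin (w * t) - w * (P t * cos (w * t))) 0 th t0.
rewrite P0 mulr0 sin0 mul0r mulr0 mulr0 subr0 => B.
have {}A : P1 th * cos (w * th) + w * (P th * sin (w * th)) = P1 0.
  apply: A => t /iv tI; apply: (is_derive_eq (der_add (der_mul (dP1 t tI) (dw' t))
    (der_mul (der_cst w t) (der_mul (dP t tI) (dw t))))).
  by ring.
have {}B : P1 th * sin (w * th) - w * (P th * cos (w * th)) = 0.
  apply: B => t /iv tI; apply: (is_derive_eq (der_add (der_mul (dP1 t tI) (dw t))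
    (der_opp (der_mul (der_cst w t) (der_mul (dP t tI) (dw' t)))))).
  by ring.
rewrite -A.
transitivity (w * P th * (cos (w * th) ^+ 2 + sin (w * th) ^+ 2)).
  by rewrite cos2Dsin2 mulr1.
transitivity (P1 th * cos (w * th) * sin (w * th) + w * (P th * sin (w * th)) * sin (w * th)
  - (P1 th * sin (w * th) - w * (P th * cos (w * th))) * cos (w * th)).
  ring.
by rewrite B; ring.
Qed.

Lemma free_motion (T : R) (P P1 : R -> R) :
  (forall t, 0 <= t < T -> is_derive t 1 P (P1 t)) ->
  (forall t, 0 <= t < T -> is_derive t 1 P1 0) -> P 0 = 0 ->
  forall th, 0 <= th < T -> P th = P1 0 * th.
Proof.
move=> dP dP1 P0 th /andP[t0 tT].
have iv (u t : R) : u <= th -> 0 <= t <= u -> 0 <= t < T.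
  by move=> ut /andP[-> tt]; rewrite (le_lt_trans tt)// (le_lt_trans ut).
have PE t : 0 <= t <= th -> P1 t = P1 0.
  by move=> /andP[t0' tt]; apply: derive0_cst => // x xI; exact: dP1 (iv _ _ tt xI).
have := @derive0_cst (fun t => P t - P1 0 * t) 0 th t0.
rewrite P0 mulr0 subrr => H.
apply/eqP; rewrite -subr_eq0; apply/eqP; apply: H => t tI.
apply: (is_derive_eq (der_add (dP t (iv _ _ (lexx _) tI)) (der_opp (der_mul (der_cst (P1 0) t) (der_id t))))).
by rewrite PE// mulr1 mulr0 addr0 subrr.
Qed.

(** For lam = 1 the Gegenbauer equation is, after multiplication by the sine,
    the equation of the oscillator. *)
Lemma mellin1_oscillator rho : -2 < rho < 0 -> exists Phi1 : R -> R,
  [/\ Phi1 0 = mellin 0 rho 1 1,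
    forall th, 0 <= th < pi -> is_derive th 1 (fun th => sin th * mellin 0 rho 1 (cos th)) (Phi1 th) &
    forall th, 0 <= th < pi -> is_derive th 1 Phi1
      (- (rho + 1) ^+ 2 * (sin th * mellin 0 rho 1 (cos th)))].
Proof.
move=> rhoI.
have v : valid 0 rho 1 by rewrite /valid /growth/= mulr1; exact: rhoI.
exists (fun th => cos th * mellin 0 rho 1 (cos th)
   - sin th ^+ 2 * (- 2 * 1 * mellin 0 (rho - 1) (1 + 1) (cos th))); split.
- by rewrite sin0 cos0 expr0n/= mul0r subr0 mul1r.
- move=> th t; have c1 := cos_gtN1 t.
  have dy := der_comp (der_mellin v ltr01 c1) (is_derive_cos th).
  apply: (is_derive_eq (der_mul (is_derive_sin th) dy)) => /=.
  by move: (mellin _ _ _ _) (mellin _ _ _ _) => A B; ring.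
move=> th t; have c1 := cos_gtN1 t.
have l2 : 0 < 1 + 1 :> R by [].
have dy := der_comp (der_mellin v ltr01 c1) (is_derive_cos th).
have dy1 := der_comp (der_mellin (valid_pred1 ltr01 v) l2 c1) (is_derive_cos th).
have od := mellin_ode v ltr01 c1.
apply: (is_derive_eq (der_add (der_mul (is_derive_cos th) dy)
  (der_opp (der_mul (der_exp 2 (is_derive_sin th)) (der_mul (der_cst (- 2 * 1) th) dy1))))).
move: od; rewrite /= -!sin2cos2.
rewrite (_ : rho - 1 - 1 = rho - 2); last by ring.
move: (mellin _ rho _ _) (mellin _ (rho - 1) _ _) (mellin _ _ _ _) => C B A od.
transitivity (sin th * (sin th ^+ 2 * (-2 * 1 * (-2 * (1 + 1) * A)) -
     (2 * 1 + 1) * cos th * (-2 * 1 * B) - C)); last first.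
  rewrite (_ : sin th ^+ 2 * (-2 * 1 * (-2 * (1 + 1) * A)) -
     (2 * 1 + 1) * cos th * (-2 * 1 * B) = - (rho * (rho + 2 * 1) * C)); last by lra.
  ring.
by rewrite expr1; ring.
Qed.

Lemma mellin1_sine rho th : -2 < rho < 0 -> 0 <= th < pi ->
  (rho + 1) * (sin th * mellin 0 rho 1 (cos th)) = mellin 0 rho 1 1 * sin ((rho + 1) * th).
Proof.
move=> /mellin1_oscillator[P1 [<- dP dP1]]; apply: (oscillator dP dP1).
by rewrite sin0 mul0r.
Qed.

(** At rho = -1 the frequency of the oscillator vanishes and the motion is free;
    its speed is the integral of (1 + s)^(-2), which is 1. *)
Lemma mellin1_angle th : 0 <= th < pi -> sin th * mellin 0 (-1) 1 (cos th) = th.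
Proof.
move=> t; have [|P1 [P10 dP dP1]] := @mellin1_oscillator (- 1); first lra.
have dP1' u : 0 <= u < pi -> is_derive u 1 P1 0.
  by move=> uI; apply: (is_derive_eq (dP1 u uI)); rewrite addNr expr0n oppr0 mul0r.
have := free_motion dP dP1'; rewrite sin0 mul0r => /(_ erefl th t) ->.
rewrite P10 (_ : mellin 0 (-1) 1 1 = 1) ?mul1r//.
have /(congr1 fine) := @integral_majorant R 1 ltr01; rewrite -/(Rintegral _ _ _) /= => m1; apply: etrans m1.
rewrite mellinE; apply: eq_Rintegral => s; rewrite inE/= in_itv/= andbT => s0.
rewrite /remainder big_ord0 subr0 opprK subrr !powRr0 !mul1r /genfun powRr1 ?(ltW s0)//.
rewrite powR_inv1 ?(ltW (quad_gt0 _ (ltW s0)))//.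
by rewrite /quad; congr (_^-1); ring.
Qed.

Lemma angle_lt_pi n : 0 <= (pi - n.+1%:R^-1 : R) < pi.
Proof.
rewrite ltrBlDr ltrDl invr_gt0 ltr0n andbT subr_ge0.
apply: (@le_trans _ _ 1); first by rewrite invf_le1 ?ler1n// ltr0n.
by apply: le_trans (pi_ge2 R); lra.
Qed.

Lemma cvg_angle_pi : (pi - n.+1%:R^-1 : R) @[n --> \oo] --> (pi : R).
Proof.
rewrite -[X in _ --> X]subr0; apply: cvgB; first exact: cvg_cst.
exact: cvg_harmonic.
Qed.

Section poisson_limit.
Variable a : R.
Hypothesis a1 : `|a| < 1.
Let f th s : R := sin th * ((s `^ a - 1) * genfun 1 (cos th) s).

(** The factor s^a - 1 vanishes at s = 1, where sin th * genfun 1 concentrates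
    as th tends to pi: there sin th * |s - 1| is at most quad, and elsewhere
    (1 - s)^2 bounds quad from below, uniformly in th. *)
Lemma poisson_bound : exists e C : R, 0 < e /\
  forall th, 0 <= th < pi -> power_bounded e C (f th).
Proof.
pose e := 1 - `|a|; have e0 : 0 < e by rewrite subr_gt0.
pose C : R := 8.
exists e, (4 * C / e); split => // th thI.
have c1 := cos_gtN1 thI.
have s0 : 0 <= sin th by apply: sin_ge0_pi; case/andP: thI => -> /ltW ->.
have [aG aL] : -1 <= a /\ a <= 1 by move: a1; rewrite ltr_norml => /andP[/ltW -> /ltW ->].
have aN := ler_norm a; have aN' : - a <= `|a| by rewrite -normrN ler_norm.
have fE s : 0 < s -> `|f th s| = sin th * `|s `^ a - 1| / quad (cos th) s.
  move=> sp; rewrite /f !normrM (ger0_norm s0) -mulrA; congr (_ * (_ * _)).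
  by rewrite /genfun powR_inv1 ?(ltW (quad_gt0 c1 (ltW sp)))// ger0_norm// invr_ge0 ltW// quad_gt0// ltW.
(* away from s = 1 the denominator is at least (1 - s)^2 *)
have qge s : 0 < s -> (1 - s) ^+ 2 <= quad (cos th) s.
  by move=> sp; rewrite /quad; have := cos_geN1 th; nra.
have small s : 0 < s <= 1 -> s `^ a <= s `^ (e - 1) /\ 1 <= s `^ (e - 1).
  move=> sI; split; first by apply: ger_powR => //; rewrite /e; lra.
  by rewrite -[leLHS](powRr0 s); apply: ger_powR => //; rewrite /e; have := normr_ge0 a; lra.
have large s : 1 <= s -> s `^ a <= s ^+ 2 * s `^ (- e - 1) /\ 1 <= s ^+ 2 * s `^ (- e - 1).
  move=> sI; have sp : 0 < s by exact: lt_le_trans sI.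
  rewrite -powR_mulrn ?(ltW sp)// -powRD ?(gt_eqF sp) ?implybT//.
  split; first by apply: ler_powR => //; rewrite /e; lra.
  by rewrite -[leLHS](powRr0 s); apply: ler_powR => //; rewrite /e; have := normr_ge0 a; lra.
have mid s : 2^-1 <= s -> sin th * `|s - 1| <= quad (cos th) s.
  move=> s2; have sE := sin2cos2 th; have cN := cos_geN1 th; have cM := cos_le1 th.
  have h1 : sin th * `|s - 1| <= (s - 1) ^+ 2 + sin th ^+ 2 / 4.
    have := sqr_ge0 (`|s - 1| - sin th / 2); rewrite sqrrB real_normK ?num_real//.
    rewrite expr_div_n; lra.
  apply: (le_trans h1); rewrite sE /quad.
  have : 0 <= (2 * s - 1) * (1 + cos th) by rewrite mulr_ge0; lra.
  have : 0 <= (1 + cos th) * (1 + cos th) by rewrite mulr_ge0; lra.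
  lra.
have mid2 s : 2^-1 <= s -> `|s `^ a - 1| <= 2 * `|s - 1| ->
    sin th * `|s `^ a - 1| / quad (cos th) s <= 2.
  move=> s2 h; have sp : 0 < s by apply: lt_le_trans s2.
  rewrite ler_pdivrMr ?quad_gt0 ?(ltW sp)//.
  by have := ler_wpM2l s0 h; have := mid s s2; lra.
have tri s : `|s `^ a - 1| <= s `^ a + 1.
  by apply: (le_trans (ler_normB _ _)); rewrite normr1 ger0_norm ?powR_ge0.
have far s (d b : R) : 0 < s -> 0 < d -> d <= (1 - s) ^+ 2 -> s `^ a + 1 <= b ->
    sin th * `|s `^ a - 1| / quad (cos th) s <= b / d.
  move=> sp d0 dq sb; have qp := quad_gt0 c1 (ltW sp).
  apply: ler_pM.
  - by rewrite mulr_ge0.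
  - by rewrite invr_ge0 ltW.
  - rewrite -[b]mul1r.
    exact: (ler_pM s0 (normr_ge0 _) (sin_le1 th) (le_trans (tri s) sb)).
  - by rewrite lef_pV2 ?posrE//; apply: le_trans dq (qge s sp).
apply: power_boundedP => // s.
- move=> /[dup] sI /andP[sp s1]; rewrite fE//; have [h1 h2] := small s sI.
  have [s2|s2] := leP 2^-1 s.
    apply: (@le_trans _ _ 2); last by rewrite /C; lra.
    apply: mid2 => //.
    have l1 : s <= s `^ a by rewrite -[leLHS](powRr1 (ltW sp)); exact: ger_powR.
    have l2 : s `^ a <= s^-1 by rewrite -(powR_inv1 (ltW sp)); exact: ger_powR.
    have l3 : s^-1 <= 3 - 2 * s by rewrite -(ler_pM2l sp) divff ?(gt_eqF sp)//; nra.
    rewrite (distrC s 1) (ger0_norm (_ : 0 <= 1 - s)) ?subr_ge0// ler_norml; lra.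
  have := @far s 4^-1 (2 * s `^ (e - 1)) sp; rewrite invrK /C.
  have d4 : 4^-1 <= (1 - s) ^+ 2 by nra.
  have sb : s `^ a + 1 <= 2 * s `^ (e - 1) by lra.
  have d0 : (0 : R) < 4^-1 by [].
  by move=> /(_ d0 d4 sb); lra.
- move=> sI; have sp : 0 < s by exact: lt_le_trans sI.
  rewrite fE//; have [h1 h2] := large s sI.
  have [s2|s2] := leP s 2.
    apply: (@le_trans _ _ 2).
      apply: mid2; first by apply: le_trans sI; lra.
      have l1 : s `^ a <= s by rewrite -[leRHS](powRr1 (ltW sp)); exact: ler_powR.
      have l2 : s^-1 <= s `^ a by rewrite -(powR_inv1 (ltW sp)); exact: ler_powR.
      have l3 : 2 - s <= s^-1 by rewrite -(ler_pM2l sp) divff ?(gt_eqF sp)//; nra.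
      rewrite (ger0_norm (_ : 0 <= s - 1)) ?subr_ge0// ler_norml; lra.
    have q0 := powR_ge0 s (- e - 1); rewrite /C.
    have : s ^+ 2 * s `^ (- e - 1) <= 4 * s `^ (- e - 1) by rewrite ler_wpM2r//; nra.
    lra.
  have := @far s (s ^+ 2 / 4) (2 * (s ^+ 2 * s `^ (- e - 1))) sp.
  have d0 : 0 < s ^+ 2 / 4 by rewrite divr_gt0// exprn_gt0.
  have d4 : s ^+ 2 / 4 <= (1 - s) ^+ 2 by nra.
  have sb : s `^ a + 1 <= 2 * (s ^+ 2 * s `^ (- e - 1)) by lra.
  move=> /(_ d0 d4 sb); rewrite (_ : _ / (s ^+ 2 / 4) = C * s `^ (- e - 1))//.
  by rewrite /C; field; exact: lt0r_neq0.
Qed.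

Lemma poisson_cvg : \int[mu]_(s in half) f (pi - n.+1%:R^-1) s @[n --> \oo] --> (0 : R).
Proof.
have [e [C [e0 bnd]]] := poisson_bound.
pose th n : R := pi - n.+1%:R^-1.
have thI n : 0 <= th n < pi := angle_lt_pi n.
have thc : th n @[n --> \oo] --> pi := cvg_angle_pi.
have cf n : {in `]0, +oo[, continuous (f (th n))}.
  move=> s; rewrite in_itv/= andbT => sp.
  have q0 := quad_gt0 (cos_gtN1 (thI n)) (ltW sp).
  have d1 := der_genfun 1 q0.
  have d2 : is_derive s 1 (fun s => s `^ a) (a * s `^ (a - 1) * 1) by apply: der_powR.
  exact: (der_continuous (der_mul (der_cst (sin (th n)) s)
    (der_mul (der_add d2 (der_opp (der_cst 1 s))) d1))).
have mh : measurable (half : set R) by exact: measurable_itv.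
have := @dominated_half_line R (fun n s => f (th n) s) (fun=> 0) (fun s => C * majorant e s).
case.
- by move=> n; exact: continuous_gt0_measurable.
- move=> s sp; rewrite /f; have [->|s1] := eqVneq s 1.
    by under eq_fun do rewrite powR1 subrr mul0r mulr0; exact: cvg_cst.
  rewrite -[X in _ --> X](mul0r ((s `^ a - 1) * genfun 1 (- 1) s)).
  apply: cvgM.
    rewrite -sinpi; apply: (cvg_comp _ _ thc); exact: continuous_sin.
  apply: cvgM; first exact: cvg_cst.
  have cc : cos (th n) @[n --> \oo] --> (-1 : R).
    rewrite -cospi; apply: (cvg_comp _ _ thc); exact: continuous_cos.
  have qN : 0 < quad (- 1) s.
    rewrite /quad (_ : _ + _ = (1 - s) ^+ 2); last by ring.
    by rewrite lt_def sqr_ge0 sqrf_eq0 subr_eq0 eq_sym s1.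
  have dx : is_derive (- 1 : R) 1 (fun x : R => genfun 1 x s) (- 1 * quad (- 1) s `^ (- 1 - 1) * (2 * s)).
    by rewrite /genfun /quad; der; [exact: qN|ring].
  exact: (cvg_comp _ (fun x : R => genfun 1 x s) cc (der_continuous dx)).
- exact: integrable_scaled_majorant.
- by move=> n s sp; exact: bnd.
by move=> _; rewrite /Rintegral integral0.
Qed.

End poisson_limit.

(** As th tends to pi the kernel sin th * genfun 1 concentrates at s = 1, where
    all the powers of s agree. Hence sin th * mellin 0 rho 1 (cos th) has the same
    limit for every rho, namely pi by mellin1_angle, while mellin1_sine gives that
    limit in terms of the value at th = 0. *)
Lemma mellin1_at1 rho : -2 < rho < 0 -> sin (pi * rho) * mellin 0 rho 1 1 = - pi * (rho + 1).
Proof.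
move=> rhoI; pose th n : R := pi - n.+1%:R^-1.
have thI n : 0 <= th n < pi := angle_lt_pi n.
have vr : valid 0 rho 1 by rewrite /valid /growth/= mulr1.
have v1 : valid 0 (-1) (1 : R) by rewrite /valid /growth/=; lra.
have a1 : `|- rho - 1| < 1 by rewrite ltr_norml; lra.
have pc := poisson_cvg a1.
have E n : (rho + 1) * (\int[mu]_(s in half) (sin (th n) * ((s `^ (- rho - 1) - 1)
    * genfun 1 (cos (th n)) s)) + th n) = mellin 0 rho 1 1 * sin ((rho + 1) * th n).
  have cN := cos_gtN1 (thI n).
  rewrite -(mellin1_sine rhoI (thI n)); congr (_ * _).
  have tr := tame_remainder vr ltr01 cN; have t1 := tame_remainder v1 ltr01 cN.
  have ang := mellin1_angle (thI n).
  suff : \int[mu]_(s in half) (sin (th n) * ((s `^ (- rho - 1) - 1) * genfun 1 (cos (th n)) s))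
     = sin (th n) * mellin 0 rho 1 (cos (th n)) + (- sin (th n)) * mellin 0 (-1) 1 (cos (th n)).
    move=> ->; have := ang; move: (mellin _ _ _ _) (mellin _ _ _ _) => A B AB; lra.
  rewrite !mellinE -(Rintegral_tameZ _ tr) -(Rintegral_tameZ _ t1).
  rewrite -(Rintegral_tameD (tameZ _ tr) (tameZ _ t1)).
  apply: eq_Rintegral => s _; rewrite /remainder big_ord0 subr0 opprK subrr powRr0; ring.
have thc : th n @[n --> \oo] --> pi := cvg_angle_pi.
have L : (rho + 1) * (\int[mu]_(s in half) (sin (th n) * ((s `^ (- rho - 1) - 1)
    * genfun 1 (cos (th n)) s)) + th n) @[n --> \oo] --> (rho + 1) * (0 + pi).
  apply: cvgM; first exact: cvg_cst.
  by apply: cvgD; [exact: pc|exact: thc].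
have M : mellin 0 rho 1 1 * sin ((rho + 1) * th n) @[n --> \oo] -->
    mellin 0 rho 1 1 * sin ((rho + 1) * pi).
  apply: cvgM; first exact: cvg_cst.
  apply: (cvg_comp (fun n => (rho + 1) * th n) sin); last exact: continuous_sin.
  by apply: cvgM; [exact: cvg_cst|exact: thc].
rewrite (funext E) in L.
have := cvg_unique (@Rhausdorff R) L M.
have -> : sin ((rho + 1) * pi) = - sin (pi * rho).
  by rewrite mulrDl mul1r sinDpi (mulrC rho).
rewrite add0r; move: (sin _) (mellin _ _ _ _) => A B e.
apply: oppr_inj; transitivity (B * - A); first by ring.
by rewrite -e; ring.
Qed.

End reflection.

(** * The value on the positive axis *)

Section beta.
Context {R : realType}.
Implicit Types (lam xi s t rho : R) (j k M : nat).
Notation mu := (@lebesgue_measure R).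
Local Notation half := (`]0, +oo[%classic : set R).

Lemma genfun1 lam s : 0 <= s -> genfun lam 1 s = (1 + s) `^ (- 2 * lam).
Proof.
move=> s0; have -> : - 2 * lam = 2%:R * - lam by ring.
rewrite powRrM powR_mulrn ?addr_ge0// /genfun /quad; congr (_ `^ _); ring.
Qed.

(** Integration by parts in the Beta integral of s^(-rho-1) (1 + s)^(-2 lam). *)
Lemma mellin_half_step rho lam : valid 0 rho lam -> 0 < lam ->
  2 * lam * mellin 0 rho (lam + 2^-1) 1 = (rho + 2 * lam) * mellin 0 rho lam 1.
Proof.
move=> v lam0.
have lam1 : 0 < lam + 2^-1 by rewrite addr_gt0.
have v1 : valid 0 rho (lam + 2^-1).
  by move: v; rewrite /valid /growth => /andP[a b]; rewrite b andbT; lra.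
have N1 : -1 < (1 : R) by lra.
have t0 := tame_remainder v lam0 N1; have t1 := tame_remainder v1 lam1 N1.
have t0' := tameZ (- (rho + 2 * lam)) t0; have t1' := tameZ (2 * lam) t1.
have := integral_tame_derivative t0 (tameD t0' t1').
rewrite (Rintegral_tameD t0' t1') (Rintegral_tameZ _ t0) (Rintegral_tameZ _ t1).
rewrite -!mellinE => H; apply/eqP; rewrite -subr_eq0 addrC -mulNr; apply/eqP.
apply: H => s s0.
have s1 : 0 < 1 + s by rewrite addr_gt0.
have dr := der_remainder lam 0 (quad_gt0 N1 (ltW s0)).
have dp : is_derive s 1 (fun s => s `^ (- rho - 1)) ((- rho - 1) * s `^ (- rho - 1 - 1) * 1).
  by apply: der_powR.
apply: (is_derive_eq (der_mul (der_id s) (der_mul dp dr))).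
rewrite /remainder !big_ord0 !subr0 !genfun1 ?(ltW s0)//.
rewrite (_ : s `^ (- rho - 1) = s * s `^ (- rho - 1 - 1)); last first.
  by rewrite -powRS// subrK.
have e1 : - 2 * (lam + 2^-1) = - 2 * lam - 2 + 1 by field.
have e2 : - 2 * (lam + 1) = - 2 * lam - 2 by ring.
have e3 : (1 + s) `^ (- 2 * lam) = (1 + s) * ((1 + s) * (1 + s) `^ (- 2 * lam - 2)).
  by rewrite -!powRS//; congr (_ `^ _); ring.
rewrite e1 e2 e3 (powRS _ s1).
by move: (_ `^ _) (_ `^ _) => A B; ring.
Qed.

Lemma mellin_at1_plain rho M : -2 < rho < 0 -> (2 <= M)%N ->
  sin (pi * rho) * mellin 0 rho (M%:R / 2) 1 =
  - pi * (\prod_(1 <= i < M) (rho + i%:R)) / (M.-1)`!%:R.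
Proof.
move=> rhoI; elim: M => // M IH; rewrite ltnS leq_eqVlt => /predU1P[<-|M2].
  rewrite big_nat1 divff// mellin1_at1//= (_ : 1`! = 1%N)// divr1; ring.
have M0 : 0 < M%:R :> R by rewrite ltr0n (leq_trans _ M2).
have v : valid 0 rho (M%:R / 2).
  have : 2 <= M%:R :> R by rewrite ler_nat.
  by rewrite /valid /growth => m2; apply/andP; split; [lra|case/andP: rhoI].
have := mellin_half_step v (divr_gt0 M0 (ltr0Sn R 1)).
rewrite (_ : M%:R / 2 + 2^-1 = M.+1%:R / 2); last by rewrite -natr1; field.
rewrite (_ : 2 * (M%:R / 2) = M%:R); last by field.
move=> e; apply: (mulfI (lt0r_neq0 M0)).
transitivity (sin (pi * rho) * (M%:R * mellin 0 rho (M.+1%:R / 2) 1)); first by ring.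
rewrite e; transitivity ((rho + M%:R) * (sin (pi * rho) * mellin 0 rho (M%:R / 2) 1)); first by ring.
rewrite (IH M2) big_nat_recr; last exact: ltnW.
case: M M0 M2 {IH v e} => [//|M] M0 M2; rewrite [in RHS]factS natrM /=.
have f0 : M`!%:R != 0 :> R by rewrite pnatr_eq0 -lt0n fact_gt0.
by field; rewrite f0 addrC natr1 lt0r_neq0.
Qed.

(** The value at xi = 1 is a Beta integral, continued analytically in rho past
    the integers by mellin_rec. *)
Lemma mellin_at1 k rho M : valid k rho (M%:R / 2) -> (0 < M)%N ->
  (k = 0%N -> (2 <= M)%N /\ -2 < rho) ->
  sin (pi * rho) * mellin k rho (M%:R / 2) 1 =
  - pi * (\prod_(1 <= i < M) (rho + i%:R)) / (M.-1)`!%:R.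
Proof.
suff: forall k, (forall j, (j <= k)%N -> forall rho M, valid j rho (M%:R / 2) -> (0 < M)%N ->
  (j = 0%N -> (2 <= M)%N /\ -2 < rho) ->
  sin (pi * rho) * mellin j rho (M%:R / 2) 1 =
  - pi * (\prod_(1 <= i < M) (rho + i%:R)) / (M.-1)`!%:R).
  by move=> /(_ k k (leqnn k)); apply.
move=> {k rho M}; elim=> [|k IH] j.
  rewrite leqn0 => /eqP -> rho M v M0 /(_ erefl)[M2 r2].
  by apply: mellin_at1_plain => //; rewrite r2; case/andP: v.
rewrite leq_eqVlt => /predU1P[->{j}|]; last by rewrite ltnS; exact: IH.
move=> rho M v M0 _.
have M0' : 0 < M%:R :> R by rewrite ltr0n.
have l0 : 0 < M%:R / 2 :> R by rewrite divr_gt0.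
have rho0 : 0 < rho.
  by case/andP: v => + _; apply: le_lt_trans; rewrite /growth ler0n.
have N1 : -1 < (1 : R) by lra.
have lE : M%:R / 2 + 1 = M.+2%:R / 2 :> R by rewrite -[M.+2%:R]natr1 -natr1; field.
have v1 := valid_pred1 l0 v; have v2 := valid_pred2 l0 v.
have r := mellin_rec v l0 N1.
rewrite lE in v1 v2 r.
have k1 : k = 0%N -> (2 <= M.+2)%N /\ -2 < rho - 1 by move=> _; split => //; lra.
have k2 : k.-1 = 0%N -> (2 <= M.+2)%N /\ -2 < rho - 2 by move=> _; split => //; lra.
have h1 := IH k (leqnn _) _ _ v1 isT k1.
have h2 := IH k.-1 (leq_pred _) _ _ v2 isT k2.
rewrite /= in r; move: h1 h2.
have -> : sin (pi * (rho - 1)) = - sin (pi * rho).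
  have -> : pi * rho = pi * (rho - 1) + pi by ring.
  by rewrite sinDpi opprK.
have -> : sin (pi * (rho - 2)) = sin (pi * rho).
  have -> : pi * rho = pi * (rho - 2) + pi + pi by ring.
  by rewrite !sinDpi opprK.
have -> : \prod_(1 <= i < M.+2) (rho - 1 + i%:R) = rho * (\prod_(1 <= i < M) (rho + i%:R)) * (rho + M%:R).
  rewrite big_add1 /= big_nat_recl// subrK -mulrA; congr (_ * _).
  transitivity (\prod_(0 <= i < M) (rho + i.+1%:R)).
    by apply: eq_bigr => i _; rewrite -[i.+2%:R]natr1; ring.
  by rewrite -[in LHS](prednK M0) big_nat_recr//= prednK// [in RHS]big_add1.
have -> : \prod_(1 <= i < M.+2) (rho - 2 + i%:R) = (rho - 1) * rho * (\prod_(1 <= i < M) (rho + i%:R)).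
  rewrite big_add1 /= big_nat_recl// -mulrA; congr (_ * _); first by ring.
  rewrite -[in LHS](prednK M0) big_nat_recl//; congr (_ * _); first by ring.
  rewrite [in RHS]big_add1; apply: eq_bigr => i _.
  by rewrite -[i.+3%:R]natr1 -[i.+2%:R]natr1; ring.
move: r; set y := mellin _ _ _ _; set y1 := mellin _ _ _ _; set y2 := mellin _ _ _ _.
set S := sin _; set P := \prod_(_ <= _ < _) _ => r h1 h2.
have f0 : (M.-1)`!%:R != 0 :> R by rewrite pnatr_eq0 -lt0n fact_gt0.
have fE : (M.+1)`!%:R = (M%:R + 1) * (M%:R * (M.-1)`!%:R) :> R.
  by rewrite factS natrM -natr1 -[in M`!](prednK M0) factS natrM prednK.
rewrite /= fE in h1 h2.
have M1 : M%:R + 1 != 0 :> R by rewrite natr1 pnatr_eq0.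
apply: (mulfI (lt0r_neq0 rho0)).
transitivity (S * (rho * y)); first by ring.
rewrite r.
transitivity (M%:R * ((- S * y1) - S * y2)); first by field.
rewrite h1 h2; field.
by rewrite f0 M1 lt0r_neq0.
Qed.

End beta.

(** * Potentials of masses on a half line *)

Section potential.
Context {R : realType}.
Implicit Types (r s t : R).
Notation leb := (@lebesgue_measure R).
Local Notation half := (`]0, +oo[%classic : set R).
Local Notation TR := (measurableTypeR R).

Variable nu : {sigma_finite_measure set TR -> \bar R}.
Variables (m : R -> R) (N : nat) (rho C : R).
Hypothesis N0 : (0 < N)%N.
Hypothesis num : forall x : R, 0 < x -> nu (`]0, x]%classic : set TR) = (m x)%:E.
Hypothesis m_nd : nondecreasing m.
Hypothesis mC : forall x : R, 0 < x -> m x <= C * x `^ (rho + N%:R).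

Lemma m_ge0 x : 0 < x -> 0 <= m x.
Proof. by move=> x0; rewrite -lee_fin -num. Qed.

(** The normalization of m by its growth makes the bound independent of r, as
    dominated convergence requires. *)
Lemma scaled_mass_bound r s : 0 < r -> 0 < s ->
  0 <= (r / s) `^ (- rho - N%:R) * m (r / s) <= C.
Proof.
move=> r0 s0; have rs : 0 < r / s by rewrite divr_gt0.
rewrite mulr_ge0 ?powR_ge0 ?m_ge0//=.
apply: le_trans (ler_wpM2l (powR_ge0 _ _) (mC rs)) _.
rewrite mulrCA -powRD ?(gt_eqF rs) ?implybT//.
by rewrite (_ : _ + _ = 0) ?powRr0 ?mulr1//; ring.
Qed.

Lemma scaled_mass_eq r s (v : R) : 0 < r -> 0 < s ->
  r ^- N * (s ^+ N.-1 * v) * m (r / s) =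
  r `^ rho * (s `^ (- rho - 1) * v * ((r / s) `^ (- rho - N%:R) * m (r / s))).
Proof.
move=> r0 s0.
have -> : (r / s) `^ (- rho - N%:R) = r `^ (- rho) / r ^+ N * (s `^ rho * s ^+ N).
  rewrite powRM ?invr_ge0 ?(ltW r0) ?(ltW s0)// powRD ?(gt_eqF r0) ?implybT//.
  rewrite powR_invn ?(ltW r0)//; congr (_ * _).
  rewrite -[s^-1]powR_inv1 ?(ltW s0)// -powRrM -powR_mulrn ?(ltW s0)//.
  by rewrite -powRD ?(gt_eqF s0) ?implybT//; congr (_ `^ _); ring.
have e1 : r `^ rho * r `^ (- rho) = 1 by rewrite powRN divff// gt_eqF// powR_gt0.
have e2 : s `^ (- rho - 1) * s `^ rho * s = 1.
  rewrite -powRD ?(gt_eqF s0) ?implybT// (_ : _ + rho = - 1); last by ring.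
  by rewrite powR_inv1 ?(ltW s0)// mulVf// gt_eqF.
have e3 : s ^+ N = s * s ^+ N.-1 by rewrite -exprS prednK.
rewrite e3.
transitivity ((r `^ rho * r `^ (- rho)) * (s `^ (- rho - 1) * s `^ rho * s)
  * (r ^- N * (s ^+ N.-1 * v) * m (r / s))); first by rewrite e1 e2 !mul1r.
ring.
Qed.

Variables (h w : R -> R).
Hypothesis tw : tame (fun s => s `^ (- rho - 1) * w s).
Hypothesis hw : forall (s c : R), 0 < s ->
  (\int[leb]_(x in (`]0%R, s]%classic : set R)) (c * (x ^+ N.-1 * w x))%:E
   = (c * (s ^+ N * h s))%:E)%E.
Hypothesis cw : {in `]0, +oo[, continuous w}.

Let mratio r : 0 < r -> measurable_fun half (fun s => m (r / s)).
Proof.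
move=> r0; have mh : measurable (half : set TR) by exact: measurable_itv.
apply: (@measurable_comp _ _ _ TR TR TR setT m half (fun s => r / s)) => //.
  exact: nondecreasing_measurable.
exact: measurable_ratio.
Qed.

Let mw : measurable_fun half w.
Proof. exact: continuous_gt0_measurable. Qed.

(** Fubini turns the integral against the masses into one against their
    distribution function, an integration by parts that allows jumps. *)
Lemma potential_fubini r : 0 < r ->
  leb.-integrable half (EFin \o (fun s => r ^- N * (s ^+ N.-1 * w s) * m (r / s))) /\
  (\int[nu]_(t in (half : set TR)) (t ^- N * h (r / t))%:E =
   \int[leb]_(s in half) (r ^- N * (s ^+ N.-1 * w s) * m (r / s))%:E)%E.
Proof.
move=> r0.
have mh : measurable (half : set TR) by exact: measurable_itv.
pose g : TR -> R := (fun s => r ^- N * (s ^+ N.-1 * w s)) \_ half.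
pose A : set (TR * TR) := [set p | 0 < p.1 /\ p.2 * p.1 <= r].
pose F (p : TR * TR) : \bar R := (g p.2 * \1_A p)%:E.
have mA : measurable A.
  have -> : A = (fst @^-1` (half : set TR)) `&` ((fun p : TR * TR => p.2 * p.1) @^-1` (`]-oo, r]%classic : set R)).
    by apply/seteqP; split => -[t s] /=; rewrite !in_itv/= andbT.
  apply: measurableI.
    by rewrite -[X in measurable X]setTI; apply: (measurable_fst _ _ mh).
  rewrite -[X in measurable X]setTI.
  have mm : measurable_fun [set: TR * TR] (fun p : TR * TR => (p.2 * p.1 : R)).
    by apply: measurable_funM; [exact: measurable_snd|exact: measurable_fst].
  by apply: mm => //; exact: measurable_itv.
have mg : measurable_fun [set: TR] g.
  apply/(measurable_restrictT _ mh).
  apply: measurable_funM; first exact: measurable_cst.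
  apply: measurable_funM; last exact: mw.
  by apply: (measurable_funS measurableT (@subsetT _ _)); exact: exprn_measurable.
have mF : measurable_fun [set: TR * TR] F.
  apply/measurable_EFinP; apply: measurable_funM.
    by apply: measurableT_comp => //; exact: measurable_snd.
  exact: measurable_indic.
have iK : leb.-integrable half (EFin \o (fun s => r ^- N * (s ^+ N.-1 * w s) * m (r / s))).
  apply: (@le_integrable _ TR R leb half _ _ (EFin \o (fun s => (r `^ rho * C) * (s `^ (- rho - 1) * w s)))) => //.
  - apply/measurable_EFinP; apply: measurable_funM; last exact: mratio.
    have mg' : measurable_fun half g by apply: measurable_funS mg.
    apply: (eq_measurable_fun g) mg' => s; rewrite inE => hs.
    by rewrite /g patchE mem_set.
  - move=> s; rewrite /= in_itv/= andbT => s0; rewrite lee_fin scaled_mass_eq//.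
    have /andP[b0 bC] := scaled_mass_bound r0 s0.
    move: (_ * w s) ((r / s) `^ _ * _) b0 bC => v b b0 bC.
    rewrite normrM (normrM v b) (ger0_norm b0) (ger0_norm (powR_ge0 r rho)).
    rewrite [leRHS]normrM normrM (ger0_norm (powR_ge0 r rho)) -mulrA.
    rewrite ler_wpM2l ?powR_ge0// [leRHS]mulrC ler_wpM2l//.
    exact: le_trans bC (ler_norm _).
  - exact/tame_integrable/tameZ.
have secA (s : TR) (c : R) : 0 < s ->
    (\int[nu]_t (c * \1_A (t, s))%:E = (c * m (r / s))%:E)%E.
  move=> s0; pose B : set TR := `]0, (r / s)]%classic.
  have -> : (\int[nu]_t (c * \1_A (t, s))%:E = \int[nu]_t ((cst c%:E) \_ B) t)%E.
    apply: eq_integral => t _; rewrite patchE indicE.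
    have -> : ((t, s) \in A) = (t \in B).
      rewrite /A /B; apply/idP/idP; rewrite !inE/= in_itv/= ler_pdivlMr// mulrC.
        by move=> [-> ->].
      by move=> /andP[].
    by case: ifP => _; rewrite ?mulr1 ?mulr0.
  rewrite -integral_mkcond integral_cst; last exact: measurable_itv.
  have nB : nu B = (m (r / s))%:E := num (divr_gt0 r0 s0).
  by rewrite EFinM; exact: (congr1 (fun x => c%:E * x)%E nB).
have g0 (s : TR) : ~ half s -> g s = 0.
  by move=> hs; rewrite /g patchE memNset.
have gE (s : TR) : half s -> g s = r ^- N * (s ^+ N.-1 * w s).
  by move=> hs; rewrite /g patchE mem_set.
have [_ iF] := @integrable21ltyP _ _ TR TR R nu leb F mF.
have Flt : (\int[leb]_s \int[nu]_t `|F (t, s)| < +oo)%E.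
  have -> : (\int[leb]_s \int[nu]_t `|F (t, s)| =
     \int[leb]_(s in half) `|(r ^- N * (s ^+ N.-1 * w s) * m (r / s))%:E|)%E.
    rewrite [RHS]integral_mkcond; apply: eq_integral => s _; rewrite patchE.
    case: ifPn => [/set_mem hs|/negP hs].
      have s0 : 0 < s by move: hs; rewrite /= in_itv/= andbT.
      have -> : (fun t => `|F (t, s)|)%E = (fun t => (`|g s| * \1_A (t, s))%:E).
        by apply/funext => t; rewrite /F/= normrM; congr (_ * _)%:E; rewrite ger0_norm.
      rewrite secA// gE//= [in RHS]normrM; congr (_ * _)%:E.
      by rewrite ger0_norm// m_ge0// divr_gt0.
    have hs' : ~ half s by move=> /mem_set.
    under eq_integral do rewrite /F g0// mul0r abse0.
    by rewrite integral0.
  by have /integrableP[] := iK.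
have := Fubini (iF Flt).
have -> : (\int[leb]_s \int[nu]_t F (t, s) =
     \int[leb]_(s in half) (r ^- N * (s ^+ N.-1 * w s) * m (r / s))%:E)%E.
  rewrite [RHS]integral_mkcond; apply: eq_integral => s _; rewrite patchE.
  case: ifPn => [/set_mem hs|/negP hs].
    have s0 : 0 < s by move: hs; rewrite /= in_itv/= andbT.
    by rewrite -(gE _ hs); exact: (secA s (g s) s0).
  have hs' : ~ half s by move=> /mem_set.
  under eq_integral do rewrite /F g0// mul0r.
  by rewrite integral0.
move=> <-; split => //.
rewrite [LHS]integral_mkcond; apply: eq_integral => t _; rewrite patchE.
case: ifPn => [/set_mem ht|/negP ht].
  have t0 : 0 < t by move: ht; rewrite /= in_itv/= andbT.
  pose B : set TR := `]0, (r / t)]%classic.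
  have -> : (\int[leb]_s F (t, s) = \int[leb]_(s in B) (r ^- N * (s ^+ N.-1 * w s))%:E)%E.
    rewrite [RHS]integral_mkcond; apply: eq_integral => s _; rewrite patchE /F indicE.
    have -> : (s \in B) = ((t, s) \in A) && (s \in (half : set TR)).
      rewrite /A /B; apply/idP/idP.
        rewrite inE/= in_itv/= => /andP[s0 st]; apply/andP; split; apply/mem_set.
          by split => //; rewrite -ler_pdivlMr.
        by rewrite /= in_itv/= s0.
      move=> /andP[/set_mem[/= _ st] /set_mem]; rewrite /= in_itv/= andbT => s0.
      by apply/mem_set; rewrite /= in_itv/= s0 ler_pdivlMr.
    have [/set_mem hs|hs] := boolP (s \in (half : set TR)).
      by rewrite andbT gE//; case: (_ \in A); rewrite ?mulr1 ?mulr0.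
    by rewrite andbF g0 ?mul0r//; move=> /mem_set; apply/negP.
  have rt0 : 0 < r / t by rewrite divr_gt0.
  rewrite (hw (r ^- N) rt0) expr_div_n; congr (_%:E).
  by field; rewrite !expf_neq0// gt_eqF.
rewrite (_ : (fun s => F (t, s)) = cst 0%E) ?integral0//.
apply/funext => s; rewrite /F indicE memNset ?mulr0// => -[/= t0 _].
by apply: ht; apply/mem_set; rewrite /= in_itv/= t0.
Qed.

(** The growth of the masses passes to the potential: the rescaled distribution
    function is bounded and tends to Delta, so dominated convergence applies. *)
Lemma potential_limit (Delta : R) :
  x `^ (- rho - N%:R) * m x @[x --> +oo] --> Delta ->
  ((r `^ (- rho))%:E * \int[nu]_(t in (half : set TR)) (t ^- N * h (r / t))%:E)%E
    @[r --> +oo] --> (Delta * \int[leb]_(s in half) (s `^ (- rho - 1) * w s))%:E.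
Proof.
move=> mD.
pose K r := \int[leb]_(s in half) (s `^ (- rho - 1) * w s * ((r / s) `^ (- rho - N%:R) * m (r / s))).
have KE r : 0 < r -> ((r `^ (- rho))%:E *
    \int[nu]_(t in (half : set TR)) (t ^- N * h (r / t))%:E = (K r)%:E)%E.
  move=> r0; have [iK ->] := potential_fubini r0.
  rewrite (integrable_half_fin_num iK) -EFinM -RintegralZl//; congr (_%:E).
  apply: eq_Rintegral => s; rewrite inE/= in_itv/= andbT => s0.
  by rewrite scaled_mass_eq// mulrA powRN mulVf ?mul1r// gt_eqF// powR_gt0.
suff KD : K r @[r --> +oo] --> Delta * \int[leb]_(s in half) (s `^ (- rho - 1) * w s).
  apply: cvg_trans; last first.
    by apply: (cvg_comp K EFin KD); apply: cvg_EFin; [exact: nearW|exact: cvg_id].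
  apply: near_eq_cvg; near=> r; rewrite /= KE//; near: r; exact: nbhs_pinfty_gt.
apply/cvg_pinftyP => u uy.
pose v n := Num.max (u n) 1.
have v0 n : 0 < v n by rewrite lt_max ltr01 orbT.
have vu : \forall n \near \oo, u n = v n.
  have /cvgryPge/(_ 1) := uy; apply: filterS => n un.
  by rewrite /v max_l.
have vy : v n @[n --> \oo] --> +oo.
  by apply: cvg_trans uy; apply: near_eq_cvg.
apply: (@cvg_trans _ (K (v n) @[n --> \oo])).
  by apply: near_eq_cvg; apply: filterS vu => n ->.
have [] := @dominated_half_line R
  (fun n s => s `^ (- rho - 1) * w s * ((v n / s) `^ (- rho - N%:R) * m (v n / s)))
  (fun s => Delta * (s `^ (- rho - 1) * w s))
  (fun s => C * `|s `^ (- rho - 1) * w s|).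
- move=> n; have [iK _] := potential_fubini (v0 n).
  have /measurable_EFinP mK := measurable_int _ iK.
  have mp : measurable_fun half (fun s => v n `^ (- rho) * (v n ^- N * (s ^+ N.-1 * w s) * m (v n / s))).
    by apply: measurable_funM => //; exact: measurable_cst.
  apply: (eq_measurable_fun _ _ mp) => s; rewrite inE/= in_itv/= andbT => s0.
  by rewrite scaled_mass_eq// mulrA powRN mulVf ?mul1r// gt_eqF// powR_gt0.
- move=> s s0; rewrite [X in _ --> X]mulrC; apply: cvgM; first exact: cvg_cst.
  apply: (cvg_comp (fun n => v n / s) (fun x => x `^ (- rho - N%:R) * m x)); last exact: mD.
  apply/cvgryPge => A; have /cvgryPge/(_ (A * s)) := vy.
  by apply: filterS => n; rewrite ler_pdivlMr.
- exact/tame_integrable/tameZ/tame_norm.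
- move=> n s s0; have /andP[b0 bC] := scaled_mass_bound (v0 n) s0.
  by rewrite normrM mulrC (ger0_norm b0) ler_wpM2r.
by rewrite RintegralZl//; exact: tame_integrable.
Unshelve. all: by end_near. Qed.

End potential.

(** * Potentials of the remainders and of a comparison kernel *)

Section kernels.
Context {R : realType}.
Implicit Types (lam xi r s t rho : R) (k : nat).
Notation leb := (@lebesgue_measure R).
Local Notation half := (`]0, +oo[%classic : set R).
Local Notation TR := (measurableTypeR R).

Section limit.
Variable nu : {sigma_finite_measure set TR -> \bar R}.
Variables (m : R -> R) (N : nat) (rho C Delta : R).
Hypothesis N0 : (0 < N)%N.
Hypothesis num : forall x : R, 0 < x -> nu (`]0, x]%classic : set TR) = (m x)%:E.
Hypothesis m_nd : nondecreasing m.
Hypothesis mC : forall x : R, 0 < x -> m x <= C * x `^ (rho + N%:R).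
Hypothesis mD : x `^ (- rho - N%:R) * m x @[x --> +oo] --> Delta.

(** The function w = N h + s h' satisfies (s^N h)' = s^(N-1) w, as
    potential_fubini requires; a last integration by parts expresses the Mellin
    integral of w by that of h. *)
Lemma kernel_limit (h h1 h2 : R -> R) :
  (forall s, 0 <= s -> is_derive s 1 h (h1 s)) ->
  (forall s, 0 <= s -> is_derive s 1 h1 (h2 s)) ->
  tame (fun s => s `^ (- rho - 1) * h s) ->
  tame (fun s => s `^ (- rho - 1) * (s * h1 s)) ->
  ((r `^ (- rho))%:E * \int[nu]_(t in (half : set TR)) (t ^- N * h (r / t))%:E)%E
    @[r --> +oo] -->
  ((rho + N%:R) * Delta * \int[leb]_(s in half) (s `^ (- rho - 1) * h s))%:E.
Proof.
move=> dh dh1 th th1.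
pose w s := N%:R * h s + s * h1 s.
have thN := tameZ N%:R th.
have tw : tame (fun s => s `^ (- rho - 1) * w s).
  by apply: eq_tame (tameD thN th1) => s _; rewrite /w; ring.
have dw s : 0 <= s -> is_derive s 1 w (N%:R * h1 s + (s * h2 s + h1 s * 1)).
  move=> s0; have e := der_add (der_mul (der_cst N%:R s) (dh s s0)) (der_mul (der_id s) (dh1 s s0)).
  by apply: (is_derive_eq e); ring.
have cw : {in `]0, +oo[, continuous w}.
  by move=> s; rewrite in_itv/= andbT => /ltW s0; exact: (der_continuous (dw s s0)).
have hw (s c : R) : 0 < s -> (\int[leb]_(x in (`]0%R, s]%classic : set R)) (c * (x ^+ N.-1 * w x))%:E
   = (c * (s ^+ N * h s))%:E)%E.
  move=> s0.
  have df (x : R) : 0 <= x -> is_derive x 1 (fun x : R => c * (x ^+ N.-1 * w x))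
     (c * (x ^+ N.-1 * (N%:R * h1 x + (x * h2 x + h1 x * 1)) + w x * (N.-1%:R * x ^+ N.-1.-1 * 1))).
    move=> x0; apply: (is_derive_eq (der_mul (der_cst c x) (der_mul (der_exp N.-1 (der_id x)) (dw x x0)))).
    by ring.
  have dF (x : R) : 0 <= x -> is_derive x 1 (fun x : R => c * (x ^+ N * h x)) (c * (x ^+ N.-1 * w x)).
    move=> x0; apply: (is_derive_eq (der_mul (der_cst c x) (der_mul (der_exp N (der_id x)) (dh x x0)))).
    by rewrite /w -{1}(prednK N0) exprS; ring.
  have FTC : (\int[leb]_(x in `[0%R, s]) (c * (x ^+ N.-1 * w x))%:E = (c * (s ^+ N * h s))%:E - (c * (0 ^+ N * h 0))%:E)%E.
    apply: (@continuous_FTC2 R _ (fun x => c * (x ^+ N * h x)) 0 s s0).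
    - apply: derivable_within_continuous => x; rewrite in_itv/= => /andP[x0 _].
      by have [] := df x x0.
    - split.
      + by move=> x; rewrite in_itv/= => /andP[/ltW x0 _]; have [] := dF x x0.
      + exact/cvg_at_right_filter/(der_continuous (dF 0 (lexx 0))).
      + exact/cvg_at_left_filter/(der_continuous (dF s (ltW s0))).
    - by move=> x; rewrite in_itv/= => /andP[/ltW x0 _]; exact: (der_derive1 (dF x x0)).
  have F0 : c * (0 ^+ N * h 0) = 0 by rewrite expr0n gtn_eqF// mul0r mulr0.
  rewrite F0 sube0 in FTC; rewrite -FTC.
  apply: integral_itv_obnd_cbnd; apply/measurable_EFinP.
  apply: (@measurable_funS _ _ TR R half) => //.
    by move=> x; rewrite /= !in_itv/= andbT => /andP[].
  apply: continuous_gt0_measurable => x; rewrite in_itv/= andbT => /ltW x0.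
  exact: (der_continuous (df x x0)).
have H := potential_limit N0 num m_nd mC tw hw cw mD.
have -> : (rho + N%:R) * Delta * \int[leb]_(s in half) (s `^ (- rho - 1) * h s) =
    Delta * \int[leb]_(s in half) (s `^ (- rho - 1) * w s); last exact: H.
have tmr := tameZ (- rho) th.
have parts : \int[leb]_(s in half) (- rho * (s `^ (- rho - 1) * h s) + s `^ (- rho - 1) * (s * h1 s)) = 0.
  apply: (integral_tame_derivative th (tameD tmr th1)) => s s0.
  have dp : is_derive s 1 (fun s => s `^ (- rho - 1)) ((- rho - 1) * s `^ (- rho - 1 - 1) * 1).
    by apply: der_powR.
  apply: (is_derive_eq (der_mul (der_id s) (der_mul dp (dh s (ltW s0))))).
  rewrite (_ : s `^ (- rho - 1) = s * s `^ (- rho - 1 - 1)); last first.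
    by rewrite -powRS// subrK.
  by ring.
move: parts; rewrite (Rintegral_tameD tmr th1) (Rintegral_tameZ _ th) => parts.
have -> : \int[leb]_(s in half) (s `^ (- rho - 1) * w s) =
   N%:R * \int[leb]_(s in half) (s `^ (- rho - 1) * h s) + \int[leb]_(s in half) (s `^ (- rho - 1) * (s * h1 s)).
  rewrite -(Rintegral_tameZ _ th) -(Rintegral_tameD thN th1).
  by apply: eq_Rintegral => s _; rewrite /w; ring.
move: parts; move: (Rintegral _ _ _) (Rintegral _ _ _) => B A e.
by rewrite (_ : B = rho * A); [ring|lra].
Qed.

End limit.

Lemma tame_der_remainder k rho lam xi : valid k rho lam -> 0 < lam -> -1 < xi ->
  tame (fun s => s `^ (- rho - 1) * (s * (- 2 * lam * (xi * remainder (lam + 1) xi k.-1 s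
                 + s * remainder (lam + 1) xi k.-2 s)))).
Proof.
move=> v lam0 xi1.
have lam1 : 0 < lam + 1 by rewrite ltr_pwDr// ltW.
have t1 := tame_remainder (valid_pred1 lam0 v) lam1 xi1.
have t2 := tame_remainder (valid_pred2 lam0 v) lam1 xi1.
apply: eq_tame (tameZ (- 2 * lam) (tameD (tameZ xi t1) t2)) => s s0.
rewrite (_ : - (rho - 1) - 1 = - rho - 1 + 1); last by ring.
rewrite (_ : - (rho - 2) - 1 = - rho - 1 + 1 + 1); last by ring.
by rewrite !(powRS _ s0); ring.
Qed.

(** A positive kernel comparable to the remainders at both ends, which absorbs
    the errors made when rays are compared. *)
Definition bump k s : R := s ^+ k / (1 + s).

Lemma bump_ge0 k s : 0 <= s -> 0 <= bump k s.
Proof. by move=> s0; rewrite divr_ge0 ?exprn_ge0// addr_ge0. Qed.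

Definition bump1 k s : R := k%:R * s ^+ k.-1 / (1 + s) - s ^+ k / (1 + s) ^+ 2.

Lemma der_bump k s : 0 <= s -> is_derive s 1 (bump k) (bump1 k s).
Proof.
move=> s0; have s1 : 1 + s != 0 by rewrite gt_eqF// ltr_wpDr.
rewrite /bump /bump1; der; first exact: s1.
by ring.
Qed.

Lemma der_bump1 k s : 0 <= s -> exists b, is_derive s 1 (bump1 k) b.
Proof.
move=> s0; have s1 : 1 + s != 0 by rewrite gt_eqF// ltr_wpDr.
eexists; rewrite /bump1; der; [exact: s1|exact: expf_neq0|reflexivity].
Qed.

Lemma tame_bump k rho : (0 < k)%N -> k%:R - 1 < rho < k%:R ->
  tame (fun s => s `^ (- rho - 1) * bump k s).
Proof.
move=> k0 /andP[r1 r2]; split.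
  move=> s; rewrite in_itv/= andbT => s0.
  have dp : is_derive s 1 (fun s => s `^ (- rho - 1)) ((- rho - 1) * s `^ (- rho - 1 - 1) * 1).
    by apply: der_powR.
  exact: (der_continuous (der_mul dp (der_bump k (ltW s0)))).
exists (Num.min (k%:R - rho) (rho - (k%:R - 1))), 1; split => //.
- by rewrite lt_min !subr_gt0 r1 r2.
- move=> s /andP[s0 s1]; rewrite (ger0_norm (mulr_ge0 (powR_ge0 _ _) (bump_ge0 k (ltW s0)))) mul1r.
  apply: (@le_trans _ _ (s `^ (- rho - 1) * s ^+ k)).
    rewrite ler_wpM2l ?powR_ge0// /bump ler_pdivrMr ?addr_gt0//.
    by rewrite ler_peMr ?exprn_ge0 ?(ltW s0)// lerDl ltW.
  rewrite -powR_mulrn ?(ltW s0)// -powRD ?(gt_eqF s0) ?implybT//.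
  apply: ger_powR; first by rewrite s0.
  by rewrite lerBlDr minEle; case: ifP; lra.
- move=> s s1; have s0 : 0 < s by exact: lt_le_trans s1.
  rewrite (ger0_norm (mulr_ge0 (powR_ge0 _ _) (bump_ge0 k (ltW s0)))) mul1r.
  apply: (@le_trans _ _ (s `^ (- rho - 1) * s ^+ k.-1)).
    rewrite ler_wpM2l ?powR_ge0// /bump ler_pdivrMr ?addr_gt0// -{1}(prednK k0) exprSr.
    by rewrite ler_wpM2l ?exprn_ge0 ?(ltW s0)// lerDr.
  have kE : k%:R = k.-1%:R + 1 :> R by rewrite natr1 prednK.
  rewrite -powR_mulrn ?(ltW s0)// -powRD ?(gt_eqF s0) ?implybT//.
  by apply: ler_powR => //; rewrite minEle; case: ifP; lra.
Qed.

Lemma tame_bump1 k rho : (0 < k)%N -> k%:R - 1 < rho < k%:R ->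
  tame (fun s => s `^ (- rho - 1) * (s * bump1 k s)).
Proof.
move=> k0 rI; have [cb [e [C [e0 C0 b0 b1]]]] := tame_bump k0 rI.
have bE s : 0 < s -> s * bump1 k s = bump k s * (k%:R - s / (1 + s)).
  move=> s0; rewrite /bump /bump1; have -> : s ^+ k = s * s ^+ k.-1 by rewrite -exprS prednK.
  by field; rewrite gt_eqF// addr_gt0.
have bk s : 0 < s -> `|s `^ (- rho - 1) * (s * bump1 k s)| <= k%:R * `|s `^ (- rho - 1) * bump k s|.
  move=> s0; rewrite bE// mulrA normrM mulrC ler_wpM2r//.
  have f0 : 0 <= s / (1 + s) by rewrite divr_ge0 ?addr_ge0 ?(ltW s0).
  have f1 : s / (1 + s) <= 1 by rewrite ler_pdivrMr ?addr_gt0// mul1r lerDr.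
  have k1 : 1 <= k%:R :> R by rewrite ler1n.
  rewrite ger0_norm; lra.
split.
  move=> s; rewrite in_itv/= andbT => s0.
  have dp : is_derive s 1 (fun s => s `^ (- rho - 1)) ((- rho - 1) * s `^ (- rho - 1 - 1) * 1).
    by apply: der_powR.
  have [b db] := der_bump1 k (ltW s0).
  exact: (der_continuous (der_mul dp (der_mul (der_id s) db))).
exists e, (k%:R * C); split => //; first exact: mulr_ge0.
- move=> s /[dup] sI /andP[s0 _]; apply: (le_trans (bk s s0)).
  by rewrite -mulrA ler_wpM2l//; exact: b0.
- move=> s s1; apply: (le_trans (bk s (lt_le_trans ltr01 s1))).
  by rewrite -mulrA ler_wpM2l//; exact: b1.
Qed.

End kernels.

(** * Remainders on rays close to the masses *)

Section at_pi.
Context {R : realType}.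
Implicit Types (lam xi r s t rho : R) (k : nat).
Notation leb := (@lebesgue_measure R).
Local Notation half := (`]0, +oo[%classic : set R).
Local Notation TR := (measurableTypeR R).

Lemma coef_bounded j lam : exists2 C, 0 <= C &
  forall xi, `|xi| <= 1 -> `|coef lam xi j| <= C.
Proof.
suff: forall i, (i <= j)%N -> forall lam, exists2 C, 0 <= C &
    forall xi, `|xi| <= 1 -> `|coef lam xi i| <= C by apply.
elim: j {lam} => [|j IH] i.
  by rewrite leqn0 => /eqP -> lam; exists 1 => // xi _; rewrite coef0 normr1.
rewrite leq_eqVlt => /predU1P[->{i}|]; last by rewrite ltnS; exact: IH.
move=> lam; have [C1 C10 H1] := IH j (leqnn j) (lam + 1).
have [C2 C20 H2] := IH j.-1 (leq_pred j) (lam + 1).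
exists (`|2 * lam| * (C1 + C2)); first by rewrite mulr_ge0// addr_ge0.
move=> xi xi1; apply: (@le_trans _ _ `|j.+1%:R * coef lam xi j.+1|).
  by rewrite (normrM j.+1%:R) ler_peMl// normr_nat ler1n.
rewrite coef_rec normrM mulNr normrN ler_wpM2l//.
apply: le_trans (ler_normD _ _) _; apply: lerD.
  by rewrite (normrM xi) (le_trans _ (H1 xi xi1))// ler_piMl.
by case: j H2 {IH H1} => [|j] H2; rewrite ?normr0//; exact: H2.
Qed.

Lemma bump_near k s : 0 <= s <= 1 -> s ^+ k <= 2 * bump k s.
Proof.
move=> /andP[s0 s1]; have k0 : 0 <= s ^+ k by rewrite exprn_ge0.
rewrite /bump mulrA ler_pdivlMr ?ltr_wpDr// mulrC ler_wpM2r//; lra.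
Qed.

Lemma bump_far k j s : (j < k)%N -> 2^-1 <= s -> s ^+ j <= 2 ^+ k * 3 * bump k s.
Proof.
move=> jk s2; have s0 : 0 <= s by lra.
apply: (@le_trans _ _ (2 ^+ k * s ^+ k.-1)).
  have -> : s ^+ j = (2 ^+ j)^-1 * (2 * s) ^+ j.
    by rewrite exprMn mulKf// expf_neq0.
  apply: (@le_trans _ _ ((2 * s) ^+ j)).
    by rewrite ler_piMl ?exprn_ge0 ?mulr_ge0// invf_le1 ?exprn_gt0// exprn_ege1// ler1n.
  apply: (@le_trans _ _ ((2 * s) ^+ k.-1)).
    apply: ler_weXn2l; first lra.
    by case: k jk.
  rewrite exprMn ler_wpM2r ?exprn_ge0//.
  by apply: ler_weXn2l; [lra|exact: leq_pred].
rewrite -mulrA ler_wpM2l ?exprn_ge0// /bump.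
have -> : s ^+ k = s * s ^+ k.-1 by case: k jk => // k _; rewrite exprS.
rewrite mulrA ler_pdivlMr ?ltr_wpDr// mulrC mulrA ler_wpM2r ?exprn_ge0//; lra.
Qed.

(** Past 1/2 the powers below k are dominated by the (k-1)-st, and the
    coefficients are bounded on the rays by coef_bounded. *)
Lemma coef_sum_far k lam : exists2 B, 0 <= B & forall xi s, `|xi| <= 1 -> 2^-1 <= s ->
  `|\sum_(j < k) coef lam xi j * s ^+ j| <= B * bump k s.
Proof.
have [C C0 HC] : exists2 C, 0 <= C & forall xi, `|xi| <= 1 ->
    forall j, (j < k)%N -> `|coef lam xi j| <= C.
  elim: k => [|k [C C0 HC]]; first by exists 0.
  have [D D0 HD] := coef_bounded k lam.
  exists (C + D) => [|xi xi1 j]; first exact: addr_ge0.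
  rewrite ltnS leq_eqVlt => /predU1P[->|jk].
    by rewrite (le_trans (HD _ xi1))// lerDr.
  by rewrite (le_trans (HC _ xi1 _ jk))// lerDl.
exists (k%:R * (C * (2 ^+ k * 3))) => [|xi s xi1 s2].
  by rewrite !mulr_ge0// exprn_ge0.
have s0 : 0 <= s by lra.
apply: le_trans (ler_norm_sum _ _ _) _.
apply: (@le_trans _ _ (\sum_(j < k) C * (2 ^+ k * 3) * bump k s)).
  apply: ler_sum => j _; rewrite (normrM (coef _ _ _)) -mulrA ler_pM//; first exact: HC.
  by rewrite ger0_norm ?exprn_ge0// bump_far.
by rewrite sumr_const card_ord -[leLHS]mulr_natl mulrA.
Qed.

(** Up to 1/2 the generating functions of all rays are smooth uniformly, since
    quad >= (1 - s)^2 >= 1/4. *)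
Lemma remainder_near k lam : 0 < lam -> exists2 B, 0 <= B & forall xi s, `|xi| <= 1 ->
  0 <= s <= 2^-1 -> `|remainder lam xi k s| <= B * bump k s.
Proof.
move=> lam0.
have HA xi : [set xi : R | `|xi| <= 1] xi -> `|xi| <= 1 /\
    forall s, 0 <= s <= 2^-1 -> 4^-1 <= quad xi s.
  move=> /= xi1; split=> // s /andP[s0 s2]; move: xi1; rewrite ler_norml => /andP[xi1 _].
  have : s * (-1) <= s * xi by rewrite ler_wpM2l.
  have : 0 <= (2^-1 - s) * (2^-1 + (1 - s)) by rewrite mulr_ge0//; lra.
  rewrite /quad; nra.
have h1 : 2^-1 <= 1 :> R by lra.
have h4 : 0 < 4^-1 :> R by lra.
have [C C0 HC] := remainder_near0 h1 h4 HA k lam0.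
exists (C * 2) => [|xi s xi1 /[dup] s2 /andP[s0 s3]]; first exact: mulr_ge0.
rewrite (le_trans (HC xi s xi1 s2))// -mulrA ler_wpM2l// bump_near// s0/=; lra.
Qed.

(** The kernels decrease as the ray turns towards the masses, up to a multiple
    of the bump that does not depend on the ray. *)
Lemma remainder_compare k lam : 0 < lam -> exists2 B, 0 <= B & forall xi eta s,
  `|xi| <= 1 -> `|eta| <= 1 -> 0 <= s -> xi <= eta -> 0 < quad xi s ->
  - remainder lam xi k s <= - remainder lam eta k s + B * bump k s.
Proof.
move=> lam0; have [B1 B10 H1] := coef_sum_far k lam.
have [B2 B20 H2] := remainder_near k lam0.
exists (2 * B1 + 2 * B2); first by rewrite addr_ge0 ?mulr_ge0.
move=> xi eta s xi1 eta1 s0 xe qs; have b0 := bump_ge0 k s0.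
have -> : (2 * B1 + 2 * B2) * bump k s = 2 * (B1 * bump k s) + 2 * (B2 * bump k s) by ring.
have [s2|s2] := leP s 2^-1.
  have ss : 0 <= s <= 2^-1 by rewrite s0 s2.
  have := H2 xi s xi1 ss; have := H2 eta s eta1 ss.
  move: (remainder lam eta k s) (remainder lam xi k s) => x y.
  rewrite !ler_norml => /andP[_ hx] /andP[hy _].
  have : 0 <= B1 * bump k s by rewrite mulr_ge0.
  move: (B1 * _) (B2 * _) hx hy => b1 b2; lra.
have s2' := ltW s2.
have := H1 xi s xi1 s2'; have := H1 eta s eta1 s2'.
have g : genfun lam eta s <= genfun lam xi s.
  apply: powR_opp_le => //; first exact: ltW.
  by rewrite /quad lerD2r lerD2l ler_wpM2l// mulr_ge0.
rewrite /remainder; move: (\sum_(j < k) coef lam eta j * s ^+ j) (\sum_(j < k) coef lam xi j * s ^+ j) => x y.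
rewrite !ler_norml => /andP[hx _] /andP[_ hy].
have : 0 <= B2 * bump k s by rewrite mulr_ge0.
move: (B1 * _) (B2 * _) hx hy => b1 b2; lra.
Qed.

(** The lower bound by genfun past 1 is the source of the divergence at the
    masses; the sign elsewhere allows restricting the integral to [1, 2]. *)
Lemma remainder_lower k lam : 0 < lam -> exists2 B, 0 <= B & forall xi s,
  `|xi| <= 1 -> 0 <= s ->
  0 <= remainder lam xi k s + B * bump k s /\
  (1 <= s -> genfun lam xi s <= remainder lam xi k s + B * bump k s).
Proof.
move=> lam0; have [B1 B10 H1] := coef_sum_far k lam.
have [B2 B20 H2] := remainder_near k lam0.
exists (B1 + B2); first by rewrite addr_ge0.
move=> xi s xi1 s0; have b0 := bump_ge0 k s0.
have b1 : 0 <= B1 * bump k s by rewrite mulr_ge0.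
have b2 : 0 <= B2 * bump k s by rewrite mulr_ge0.
have far : 2^-1 <= s -> genfun lam xi s <= remainder lam xi k s + (B1 + B2) * bump k s.
  move=> s2; have := H1 xi s xi1 s2; rewrite /remainder mulrDl.
  move: (\sum_(j < k) _) (B1 * _) (B2 * _) b1 b2 => x y z; rewrite ler_norml => ? ? /andP[]; lra.
split; last by move=> s1; apply: far; lra.
have [s2|s2] := leP s 2^-1; last by apply: le_trans (far (ltW s2)); exact: powR_ge0.
have := H2 xi s xi1; rewrite s0 s2 => /(_ isT); rewrite ler_norml mulrDl => /andP[] h _.
by move: (remainder _ _ _ _) h b1 => x; lra.
Qed.

End at_pi.

(** * Logarithmic divergence at the masses *)

Section divergence.
Context {R : realType}.
Implicit Types (lam xi r s t rho : R) (k : nat).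
Notation leb := (@lebesgue_measure R).
Local Notation half := (`]0, +oo[%classic : set R).
Local Notation TR := (measurableTypeR R).

(** Positive and negative parts compare separately, so both integrals may be
    infinite. *)
Lemma le_integral_measurable d (T : measurableType d) (mu : {measure set T -> \bar R})
    (D : set T) (f g : T -> \bar R) : measurable D ->
  measurable_fun D f -> measurable_fun D g -> (forall x, D x -> (f x <= g x)%E) ->
  (\int[mu]_(x in D) f x <= \int[mu]_(x in D) g x)%E.
Proof.
move=> mD mf mg fg; rewrite integralE [leRHS]integralE.
have fg' : {in D, forall x, (f x <= g x)%E} by move=> x; rewrite inE; exact: fg.
apply: leeB; apply: ge0_le_integral => //.
- exact: measurable_funepos.
- exact: measurable_funepos.
- by move=> x Dx; apply: (funepos_le fg'); rewrite inE.
- exact: measurable_funeneg.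
- exact: measurable_funeneg.
- by move=> x Dx; apply: (funeneg_le fg'); rewrite inE.
Qed.

Lemma log_integrand_continuous kappa c : 0 < kappa ->
  {within (`[1, 2]%classic : set R), continuous (fun s => c / (s - 1 + kappa))}.
Proof.
move=> k0; apply: derivable_within_continuous => s; rewrite in_itv/= => /andP[s1 _].
have p : s - 1 + kappa != 0 by rewrite gt_eqF//; lra.
have [l [//]] : exists l, is_derive s 1 (fun s => c / (s - 1 + kappa)) l.
by eexists; der; [exact: p|reflexivity].
Qed.

Lemma integral_log kappa c : 0 < kappa ->
  (\int[leb]_(s in (`[1%R, 2%R]%classic : set R)) (c / (s - 1 + kappa))%:E
   = (c * ln (1 + kappa) - c * ln kappa)%:E)%E.
Proof.
move=> k0.
have pos (s : R) : 1 <= s -> 0 < s - 1 + kappa by rewrite -subr_ge0 => s1; lra.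
have dF (s : R) : 1 <= s -> is_derive s 1 (fun s => c * ln (s - 1 + kappa)) (c / (s - 1 + kappa)).
  move=> s1; have d1 : is_derive s 1 (fun s : R => s - 1 + kappa) 1.
    by apply: (is_derive_eq (der_add (der_add (der_id s) (der_cst (-1) s)) (der_cst kappa s))); ring.
  apply: (is_derive_eq (der_mul (der_cst c s)
    (@der_comp R _ (fun s => s - 1 + kappa) _ _ _ (is_derive1_ln (pos s s1)) d1))); ring.
rewrite (@continuous_FTC2 R _ (fun s => c * ln (s - 1 + kappa)) 1 2).
- by congr (_%:E - _%:E)%E; congr (_ * ln _); ring.
- by rewrite ltrDl.
- exact: log_integrand_continuous.
- split.
  + by move=> x; rewrite in_itv/= => /andP[/ltW x1 _]; have [] := dF x x1.
  + exact/cvg_at_right_filter/(der_continuous (dF 1 (lexx 1))).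
  + have l12 : 1 <= 2 :> R by rewrite ler1n.
    exact/cvg_at_left_filter/(der_continuous (dF 2 l12)).
- by move=> x; rewrite in_itv/= => /andP[/ltW x1 _]; exact: (der_derive1 (dF x x1)).
Qed.

(** Between 1 and 2 the quadratic form is at most (s - 1 + kappa)^2, with
    kappa vanishing as the ray approaches the masses: this makes the
    generating function as large as 1 / (s - 1 + kappa), up to a constant. *)
Lemma genfun_lower lam xi s : 2^-1 <= lam -> -1 < xi <= 0 -> 1 <= s <= 2 ->
  3 `^ (1 - 2 * lam) / (s - 1 + 2 * Num.sqrt (1 + xi)) <= genfun lam xi s.
Proof.
move=> lam2 /andP[xi1 xi0] /andP[s1 s2].
have e0 : 0 < Num.sqrt (1 + xi) by rewrite sqrtr_gt0; lra.
have e2 : Num.sqrt (1 + xi) ^+ 2 = 1 + xi by rewrite sqr_sqrtr//; lra.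
move: (Num.sqrt _) e0 e2 => e e0 e2.
have a0 : 0 < s - 1 + 2 * e by lra.
have a3 : s - 1 + 2 * e <= 3 by nra.
have qa : quad xi s <= (s - 1 + 2 * e) ^+ 2.
  have : 0 <= (s - 1) * e by rewrite mulr_ge0//; lra.
  rewrite /quad; nra.
apply: (@le_trans _ _ (((s - 1 + 2 * e) ^+ 2) `^ (- lam))); last first.
  apply: powR_opp_le => //; first lra.
  by apply: quad_gt0 => //; lra.
move: (s - 1 + 2 * e) a0 a3 {qa} => a a0 a3.
rewrite -powR_mulrn ?(ltW a0)// -powRrM.
have -> : 2%:R * - lam = - (2 * lam - 1) - 1 by ring.
rewrite (@powRD _ a (- (2 * lam - 1)) (-1)) ?(gt_eqF a0) ?implybT// (powR_inv1 (ltW a0)).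
rewrite ler_wpM2r ?invr_ge0 ?(ltW a0)//.
rewrite (_ : 1 - 2 * lam = - (2 * lam - 1)); last by ring.
by apply: powR_opp_le => //; lra.
Qed.

(** On [1, 2] the integrand is at least c / (s - 1 + kappa), up to the bump. *)
Lemma mellin_lower k rho lam : valid k.+1 rho lam -> 2^-1 <= lam ->
  exists c B, 0 < c /\ forall xi, -1 < xi <= 0 ->
    - c * ln (2 * Num.sqrt (1 + xi)) - B <= mellin k.+1 rho lam xi.
Proof.
move=> v lam2; have lam0 : 0 < lam by lra.
have [B B0 HB] := remainder_lower k.+1 lam0.
have tb : tame (fun s => s `^ (- rho - 1) * bump k.+1 s).
  by apply: tame_bump => //; move: v; rewrite /valid/= -natr1; lra.
pose c := 2 `^ (- `|- rho - 1|) * 3 `^ (1 - 2 * lam).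
have c0 : 0 < c by rewrite mulr_gt0// powR_gt0.
exists c, (B * \int[leb]_(s in half) (s `^ (- rho - 1) * bump k.+1 s)); split => // xi xiI.
have [xi1 xi0] := andP xiI.
have xin : `|xi| <= 1 by rewrite ler_norml; lra.
have e0 : 0 < Num.sqrt (1 + xi) by rewrite sqrtr_gt0; lra.
have kap0 : 0 < 2 * Num.sqrt (1 + xi) by rewrite mulr_gt0.
have tr := tame_remainder v lam0 xi1.
have tB := tameZ B tb.
rewrite lerBlDr mellinE -(Rintegral_tameZ _ tb) -(Rintegral_tameD tr tB).
rewrite -lee_fin -integrable_half_fin_num; last exact/tame_integrable/tameD.
have fE s : s `^ (- rho - 1) * remainder lam xi k.+1 s + B * (s `^ (- rho - 1) * bump k.+1 s)
   = s `^ (- rho - 1) * (remainder lam xi k.+1 s + B * bump k.+1 s) by ring.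
have mf := measurable_int _ (tame_integrable (tameD tr tB)).
apply: (@le_trans _ _ (\int[leb]_(s in (`[1%R, 2%R]%classic : set R))
  (c / (s - 1 + 2 * Num.sqrt (1 + xi)))%:E)%E).
  rewrite integral_log// lee_fin mulNr [leRHS]addrC lerDl mulr_ge0 ?(ltW c0)//.
  by apply: ln_ge0; rewrite lerDl ltW.
have sub : (`[1%R, 2%R]%classic : set R) `<=` half.
  by move=> s; rewrite /= !in_itv/= andbT => /andP[s1 _]; exact: lt_le_trans s1.
have m12 : measurable (`[1%R, 2%R]%classic : set TR) by exact: measurable_itv.
apply: (@le_trans _ _ (\int[leb]_(s in (`[1%R, 2%R]%classic : set R))
  (s `^ (- rho - 1) * remainder lam xi k.+1 s + B * (s `^ (- rho - 1) * bump k.+1 s))%:E)%E).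
  apply: ge0_le_integral => //.
  - by move=> s; rewrite /= in_itv/= => /andP[s1 s2]; rewrite lee_fin divr_ge0 ?(ltW c0)//; lra.
  - apply/measurable_EFinP; apply: subspace_continuous_measurable_fun => //.
    exact: log_integrand_continuous.
  - by apply: measurable_funS mf => //; exact: measurable_itv.
  - move=> s; rewrite /= in_itv/= => sI; have [s1 s2] := andP sI.
    have s0 : 0 <= s by lra.
    rewrite lee_fin fE /c -mulrA; apply: ler_pM; rewrite ?powR_ge0//.
    + by rewrite divr_ge0 ?powR_ge0//; lra.
    + apply: (@le_trans _ _ (s `^ (- `|- rho - 1|))).
        by apply: powR_opp_le => //; lra.
      by apply: ler_powR => //; rewrite lerNl -normrN ler_norm.
    + by apply: le_trans (genfun_lower lam2 xiI sI) _; have [_] := HB xi s xin s0; apply.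
have mh : measurable (half : set TR) by exact: measurable_itv.
apply: (@ge0_subset_integral _ TR R leb _ _ m12 mh _ mf _ sub).
move=> s; rewrite /= in_itv/= andbT => /ltW s0; rewrite lee_fin fE mulr_ge0 ?powR_ge0//.
by have [] := HB xi s xin s0.
Qed.

Lemma mellin_diverges k rho lam : valid k.+1 rho lam -> 2^-1 <= lam ->
  mellin k.+1 rho lam xi @[xi --> (-1)^'+] --> +oo.
Proof.
move=> v lam2; have [c [B [c0 H]]] := mellin_lower v lam2.
apply/cvgryPge => A.
have d0 : 0 < (expR (- ((A + B) / c)) / 2) ^+ 2 by rewrite exprn_gt0// divr_gt0// expR_gt0.
near=> xi.
have xi1 : -1 < xi by near: xi; exact: nbhs_right_gt.
have xi0 : xi <= 0 by near: xi; apply: nbhs_right_le; rewrite oppr_lt0.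
have xid : xi <= -1 + (expR (- ((A + B) / c)) / 2) ^+ 2.
  by near: xi; apply: nbhs_right_le; rewrite ltrDl.
apply: le_trans (H xi _); last by rewrite xi1.
have e0 : 0 < Num.sqrt (1 + xi) by rewrite sqrtr_gt0; lra.
rewrite mulNr lerBrDr lerNr -ler_pdivlMl// -[leRHS]expRK ler_ln ?posrE ?expR_gt0 ?mulr_gt0//.
rewrite mulrN [_^-1 * _]mulrC -ler_pdivlMl// [leRHS]mulrC.
rewrite -[leRHS]ger0_norm ?divr_ge0 ?expR_ge0// -sqrtr_sqr ler_wsqrtr//; lra.
Unshelve. all: by end_near. Qed.

End divergence.

(** * The ray that carries the masses *)

Section on_the_masses.
Context {R : realType}.
Implicit Types (lam xi r s t rho : R) (k : nat).
Notation leb := (@lebesgue_measure R).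
Local Notation half := (`]0, +oo[%classic : set R).
Local Notation TR := (measurableTypeR R).

Definition bump_mellin k rho : R := \int[leb]_(s in half) (s `^ (- rho - 1) * bump k s).

Lemma valid_bump k rho lam : valid k.+1 rho lam -> k.+1%:R - 1 < rho < k.+1%:R.
Proof. by rewrite /valid/= -natr1; lra. Qed.

Lemma tame_ray k rho lam xi B : valid k.+1 rho lam -> 0 < lam -> -1 < xi ->
  tame (fun s => s `^ (- rho - 1) * (- remainder lam xi k.+1 s + B * bump k.+1 s)) /\
  \int[leb]_(s in half) (s `^ (- rho - 1) * (- remainder lam xi k.+1 s + B * bump k.+1 s)) =
    - mellin k.+1 rho lam xi + B * bump_mellin k.+1 rho.
Proof.
move=> v lam0 xi1.
have tr := tameZ (-1) (tame_remainder v lam0 xi1).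
have tb0 := tame_bump (ltn0Sn k) (valid_bump v).
have tb := tameZ B tb0.
have e s : -1 * (s `^ (- rho - 1) * remainder lam xi k.+1 s) + B * (s `^ (- rho - 1) * bump k.+1 s)
  = s `^ (- rho - 1) * (- remainder lam xi k.+1 s + B * bump k.+1 s) by ring.
split; first by apply: eq_tame (tameD tr tb) => s _; exact: e.
under eq_Rintegral do rewrite -e.
rewrite (Rintegral_tameD tr tb) (Rintegral_tameZ _ tb0).
by rewrite (Rintegral_tameZ _ (tame_remainder v lam0 xi1)) mulN1r.
Qed.

(** The kernel on the ray of the masses is -oo where a point meets a mass. *)
Definition remainder_pi lam k s : \bar R :=
  if s == 1 then -oo%E else (- remainder lam (-1) k s)%:E.

Lemma quad_N1 s : quad (-1) s = (1 - s) ^+ 2.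
Proof. by rewrite /quad; ring. Qed.

Lemma measurable_remainder lam xi k : measurable_fun [set: TR] (remainder lam xi k).
Proof.
apply: measurable_funB.
  apply: (measurableT_comp (measurable_powR (- lam))).
  apply: measurable_funD; last exact: exprn_measurable.
  apply: measurable_funD; first exact: measurable_cst.
  by do 2 apply: measurable_funM => //; exact: measurable_id.
apply: measurable_sum => j; apply: measurable_funM => //; exact: exprn_measurable.
Qed.

Lemma measurable_remainder_pi lam k : measurable_fun [set: TR] (remainder_pi lam k).
Proof.
apply: measurable_fun_ifT.
- by apply: measurable_fun_eqr.
- exact: measurable_cst.
- by apply/measurable_EFinP; apply: measurableT_comp => //; exact: measurable_remainder.
Qed.

Lemma remainder_pi_le lam k : 0 < lam -> exists2 B, 0 <= B & forall xi s,
  `|xi| <= 1 -> 0 <= s ->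
  (remainder_pi lam k s <= (- remainder lam xi k s + B * bump k s)%:E)%E.
Proof.
move=> lam0; have [B B0 H] := remainder_compare k lam0; exists B => // xi s xi1 s0.
rewrite /remainder_pi; case: eqP => [_|/eqP s1]; first exact: leNye.
have n1 : `|-1| <= 1 :> R by rewrite normrN1.
rewrite lee_fin; apply: H => //; first by move: xi1; rewrite ler_norml => /andP[].
by rewrite quad_N1 exprn_even_gt0//= subr_eq0 eq_sym.
Qed.

Lemma mellin_large k rho lam A : valid k.+1 rho lam -> 2^-1 <= lam ->
  exists xi, -1 < xi < 1 /\ A <= mellin k.+1 rho lam xi.
Proof.
move=> v lam2; have /cvgryPge/(_ A) H := mellin_diverges v lam2.
have : \forall xi \near (-1 : R)^'+, -1 < xi < 1 /\ A <= mellin k.+1 rho lam xi.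
  near=> xi; split; last by near: xi; exact: H.
  apply/andP; split; near: xi; first exact: nbhs_right_gt.
  by apply: nbhs_right_lt; lra.
by move/filter_ex.
Unshelve. all: by end_near. Qed.

(** The integrand is dominated by those of the rays nearby, whose integrals tend
    to -oo. *)
Lemma integral_pi k rho lam : valid k.+1 rho lam -> 2^-1 <= lam ->
  (\int[leb]_(s in half) ((s `^ (- rho - 1))%:E * remainder_pi lam k.+1 s) = -oo)%E.
Proof.
move=> v lam2; have lam0 : 0 < lam by lra.
have [B B0 H] := remainder_pi_le k.+1 lam0.
apply: eq_ninfty => A.
have [xi [/andP[xi1 xi2] HA]] := mellin_large (B * bump_mellin k.+1 rho - A) v lam2.
have [tf If] := tame_ray B v lam0 xi1.
apply: (@le_trans _ _ (\int[leb]_(s in half) (s `^ (- rho - 1) * (- remainder lam xi k.+1 s + B * bump k.+1 s))%:E)%E).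
  apply: (@le_integral_measurable R _ TR leb); first exact: measurable_itv.
  - apply: emeasurable_funM.
      apply/measurable_EFinP; apply: measurable_funS (measurable_powR (- rho - 1)) => //.
    by apply: measurable_funS (measurable_remainder_pi lam k.+1).
  - exact: measurable_int (tame_integrable tf).
  - move=> s; rewrite /= in_itv/= andbT => s0; rewrite EFinM.
    apply: lee_wpmul2l; first by rewrite lee_fin powR_ge0.
    by apply: H; [rewrite ler_norml; lra|exact: ltW].
rewrite (integrable_half_fin_num (tame_integrable tf)) If lee_fin.
by move: (mellin _ _ _ _) HA => M HA; lra.
Qed.

Section limit.
Variable nu : {sigma_finite_measure set TR -> \bar R}.
Variables (m : R -> R) (N : nat) (rho C Delta : R).
Hypothesis N0 : (0 < N)%N.
Hypothesis num : forall x : R, 0 < x -> nu (`]0, x]%classic : set TR) = (m x)%:E.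
Hypothesis m_nd : nondecreasing m.
Hypothesis mC : forall x : R, 0 < x -> m x <= C * x `^ (rho + N%:R).
Hypothesis mD : x `^ (- rho - N%:R) * m x @[x --> +oo] --> Delta.

Lemma ray_limit k lam xi B : valid k.+1 rho lam -> 0 < lam -> -1 < xi ->
  ((r `^ (- rho))%:E * \int[nu]_(t in (half : set TR))
     (t ^- N * (- remainder lam xi k.+1 (r / t) + B * bump k.+1 (r / t)))%:E)%E
    @[r --> +oo] -->
  ((rho + N%:R) * Delta * (- mellin k.+1 rho lam xi + B * bump_mellin k.+1 rho))%:E.
Proof.
move=> v lam0 xi1; have [tf <-] := tame_ray B v lam0 xi1.
pose r1 s := - 2 * lam * (xi * remainder (lam + 1) xi k s + s * remainder (lam + 1) xi k.-1 s).
have d1 s : 0 <= s -> is_derive s 1 (fun s => - remainder lam xi k.+1 s + B * bump k.+1 s)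
    (- r1 s + B * bump1 k.+1 s).
  move=> s0.
  apply: (is_derive_eq (der_add (der_opp (der_remainder lam k.+1 (quad_gt0 xi1 s0)))
    (der_mul (der_cst B s) (der_bump k.+1 s0)))); rewrite /r1 /=.
  by ring.
have d2 s : 0 <= s -> exists l, is_derive s 1 (fun s => - r1 s + B * bump1 k.+1 s) l.
  move=> s0; have [b db] := der_bump1 k.+1 s0.
  have q := quad_gt0 xi1 s0.
  eexists; apply: (der_add (der_opp (der_mul (der_cst (- 2 * lam) s) (der_add
    (der_mul (der_cst xi s) (der_remainder (lam + 1) k q))
    (der_mul (der_id s) (der_remainder (lam + 1) k.-1 q))))) (der_mul (der_cst B s) db)).
pose h2 s := derive1 (fun s => - r1 s + B * bump1 k.+1 s) s.
have d3 s : 0 <= s -> is_derive s 1 (fun s => - r1 s + B * bump1 k.+1 s) (h2 s).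
  by move=> s0; have [l dl] := d2 s s0; rewrite /h2 (der_derive1 dl).
have t1 := tameZ (-1) (tame_der_remainder v lam0 xi1).
have t2 := tameZ B (tame_bump1 (ltn0Sn k) (valid_bump v)).
have t3 : tame (fun s => s `^ (- rho - 1) * (s * (- r1 s + B * bump1 k.+1 s))).
  by apply: eq_tame (tameD t1 t2) => s _; rewrite /r1 /=; ring.
exact: (@kernel_limit R nu m N rho C Delta N0 num m_nd mC mD _ _ h2 d1 d3 tf t3).
Qed.

(** The potential is dominated by those of the rays nearby, whose limits tend to
    -oo. *)
Lemma pi_limit k lam : valid k.+1 rho lam -> 2^-1 <= lam -> 0 < rho -> 0 < Delta ->
  ((r `^ (- rho))%:E * \int[nu]_(t in (half : set TR))
     ((t ^- N)%:E * remainder_pi lam k.+1 (r / t)))%E @[r --> +oo] --> -oo%E.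
Proof.
move=> v lam2 rho0 D0; have lam0 : 0 < lam by lra.
have [B B0 H] := remainder_pi_le k.+1 lam0.
have c0 : 0 < (rho + N%:R) * Delta by rewrite mulr_gt0// addr_gt0// ltr0n.
apply/cvgeNyPle => A.
have [xi [/andP[xi1 xi2] HA]] := mellin_large
  (B * bump_mellin k.+1 rho - (A - 1) / ((rho + N%:R) * Delta)) v lam2.
have L := @ray_limit k lam xi B v lam0 xi1.
have LA : (rho + N%:R) * Delta * (- mellin k.+1 rho lam xi + B * bump_mellin k.+1 rho) < A.
  apply: (@le_lt_trans _ _ (A - 1)); last by rewrite ltrBlDr ltrDl.
  rewrite -ler_pdivlMl// mulrC.
  by move: (mellin _ _ _ _) HA => M HA; lra.
have [tf _] := tame_ray B v lam0 xi1.
near=> r.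
have r0 : 0 < r by near: r; exact: nbhs_pinfty_gt.
apply: (@le_trans _ _ ((r `^ (- rho))%:E * \int[nu]_(t in (half : set TR))
     (t ^- N * (- remainder lam xi k.+1 (r / t) + B * bump k.+1 (r / t)))%:E)%E).
  apply: lee_wpmul2l; first by rewrite lee_fin powR_ge0.
  apply: (@le_integral_measurable R _ TR nu); first exact: measurable_itv.
  - apply: emeasurable_funM; first by apply/measurable_EFinP; exact: measurable_pow_inv.
    apply: (@measurable_comp _ _ _ TR TR _ setT (remainder_pi lam k.+1) half (fun t => r / t)) => //.
      exact: measurable_remainder_pi.
    exact: measurable_ratio.
  - apply/measurable_EFinP; apply: measurable_funM; first exact: measurable_pow_inv.
    apply: (@measurable_comp _ _ _ TR TR TR half (fun s => - remainder lam xi k.+1 s + B * bump k.+1 s) half (fun t => r / t)).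
    + exact: measurable_itv.
    + by move=> _ [t + <-]; rewrite /= !in_itv/= !andbT => t0; rewrite divr_gt0.
    + apply: continuous_gt0_measurable => s; rewrite in_itv/= andbT => /ltW s0.
      exact: (der_continuous (der_add (der_opp (der_remainder lam k.+1 (quad_gt0 xi1 s0)))
        (der_mul (der_cst B s) (der_bump k.+1 s0)))).
    + exact: measurable_ratio.
  - move=> t; rewrite /= in_itv/= andbT => t0; rewrite EFinM.
    apply: lee_wpmul2l; first by rewrite lee_fin invr_ge0 exprn_ge0 ?(ltW t0).
    by apply: H; [rewrite ler_norml; lra|rewrite divr_ge0 ?(ltW t0) ?(ltW r0)].
apply: ltW; near: r.
exact: (L _ (open_ereal_lt' (x := EFin _) (y := A%:E) LA)).
Unshelve. all: by end_near. Qed.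

End limit.
End on_the_masses.

(** * The indicator and the Legendre functions *)

Section indicator.
Context {R : realType}.
Implicit Types (lam xi r s t rho theta : R) (k : nat).
Notation leb := (@lebesgue_measure R).
Local Notation half := (`]0, +oo[%classic : set R).
Local Notation TR := (measurableTypeR R).

Lemma kernel_sumE n q theta s :
  \sum_(0 <= j < q.+1) (- s) ^+ j * gegenbauer ((n%:R - 2) / 2) j (cos theta) =
  \sum_(j < q.+1) coef ((n%:R - 2) / 2) (cos theta) j * s ^+ j.
Proof.
rewrite big_mkord; apply: eq_bigr => j _.
by rewrite /coef (exprNn s) mulrAC.
Qed.

Lemma kernelE n q theta s : 0 < quad (cos theta) s ->
  hadamard_kernel n s theta q =
  (- remainder ((n%:R - 2) / 2) (cos theta) q.+1 s)%:E.
Proof.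
move=> q0; rewrite /hadamard_kernel kernel_sumE -/(quad (cos theta) s).
rewrite inver gt_eqF ?powR_gt0// -EFinN -EFinD /remainder /genfun powRN.
by congr (_%:E); ring.
Qed.

Lemma kernel_piE n q s : (0 : R) < (n%:R - 2) / 2 ->
  hadamard_kernel n s pi q = remainder_pi ((n%:R - 2) / 2) q.+1 s.
Proof.
move=> n0; rewrite /remainder_pi; case: eqP => [->|/eqP s1].
  rewrite /hadamard_kernel cospi mulr1 mulrN1 expr1n.
  rewrite (_ : 1 - 2 + 1 = 0); last by ring.
  by rewrite powR0 ?gt_eqF// inver eqxx.
rewrite -cospi -kernelE// cospi quad_N1 exprn_even_gt0//= subr_eq0 eq_sym//.
Qed.

Lemma indicatorE n rho Delta q theta :
  valid q.+1 rho ((n%:R - 2) / 2) -> (0 : R) < (n%:R - 2) / 2 -> 0 <= theta < pi ->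
  indicator_integral n rho Delta q theta =
  ((rho + n%:R - 2) * Delta * - mellin q.+1 rho ((n%:R - 2) / 2) (cos theta))%:E.
Proof.
move=> v lam0 th; rewrite /indicator_integral [RHS]EFinM; congr (_ * _)%E.
have xi1 := cos_gtN1 th.
have [tf If] := tame_ray 0 v lam0 xi1.
move: If; rewrite mul0r addr0 => <-.
rewrite -(integrable_half_fin_num (tame_integrable tf)).
apply: eq_integral => s; rewrite inE/= in_itv/= andbT => /ltW s0.
by rewrite kernelE ?quad_gt0// -EFinM mul0r addr0.
Qed.

Lemma indicator_pi n rho Delta q :
  valid q.+1 rho ((n%:R - 2) / 2) -> (2^-1 : R) <= (n%:R - 2) / 2 -> 0 < rho -> 0 < Delta ->
  indicator_integral n rho Delta q pi = -oo%E.
Proof.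
move=> v lam2 rho0 D0; rewrite /indicator_integral.
have lam0 : (0 : R) < (n%:R - 2) / 2 by lra.
under eq_integral do rewrite kernel_piE//.
rewrite integral_pi// gt0_muleNy// lte_fin mulr_gt0//.
by move: lam0; lra.
Qed.

(** The factor Gamma ((n - 1) / 2) cancels in the Legendre formulas, once it is
    known to be finite and nonzero. *)
Lemma Gamma_gt0 n : (3 <= n)%N -> 0 < Gamma ((n%:R - 1) / 2 : R).
Proof.
move=> n3; have n3' : 3 <= n%:R :> R by rewrite (ler_nat R 3).
set z : R := (n%:R - 1) / 2; have z1 : 1 <= z by rewrite /z; lra.
have f0 t : 0 <= t `^ (z - 1) * expR (- t) by rewrite mulr_ge0 ?powR_ge0 ?expR_ge0.
have tf : tame (fun t => t `^ (z - 1) * expR (- t)).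
  split.
    move=> s; rewrite in_itv/= andbT => s0.
    have dp : is_derive s 1 (fun s => s `^ (z - 1)) ((z - 1) * s `^ (z - 1 - 1) * 1).
      by apply: der_powR.
    have de : is_derive s 1 (fun s : R => expR (- s)) (expR (- s) * (- 1)).
      exact: (@der_comp R _ (fun s => - s) _ _ _ (is_derive_expR (- s)) (der_opp (der_id s))).
    exact: (der_continuous (der_mul dp de)).
  exists 1, (n`!%:R); split => //.
  - move=> s /andP[s0 s1]; rewrite ger0_norm// subrr powRr0 mulr1.
    apply: (@le_trans _ _ 1); last by rewrite ler1n fact_gt0.
    rewrite mulr_ile1 ?powR_ge0 ?expR_ge0//.
      have := @ge0_ler_powR R (z - 1) _ s 1; rewrite powR1; apply; rewrite ?nnegrE ?(ltW s0)//; lra.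
    by rewrite -[leRHS]expR0 ler_expR oppr_le0 ltW.
  - move=> s s1; have s0 : 0 < s by lra.
    rewrite ger0_norm// expRN ler_pdivrMr ?expR_gt0//.
    apply: (@le_trans _ _ (n`!%:R * s `^ (-1 - 1) * (s ^+ n / n`!%:R))); last first.
      rewrite ler_wpM2l ?mulr_ge0 ?powR_ge0//.
      have := expR_ge1Dxn n.-1 (ltW s0); rewrite prednK ?(ltn_trans _ n3)//.
      by apply: le_trans; rewrite lerDr.
    rewrite (_ : _ * _ = s `^ (-1 - 1) * s ^+ n); last first.
      by field; rewrite pnatr_eq0 -lt0n fact_gt0.
    rewrite -powR_mulrn ?(ltW s0)// -powRD ?(gt_eqF s0) ?implybT//.
    by apply: ler_powR => //; rewrite /z; lra.
rewrite /Gamma -lte_fin -(integrable_half_fin_num (tame_integrable tf)).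
have mf := measurable_int _ (tame_integrable tf).
have m12 : measurable (`[1%R, 2%R]%classic : set TR) by exact: measurable_itv.
have mh : measurable (half : set TR) by exact: measurable_itv.
have sub : (`[1%R, 2%R]%classic : set R) `<=` half.
  by move=> s; rewrite /= !in_itv/= andbT => /andP[s1 _]; exact: lt_le_trans s1.
apply: (@lt_le_trans _ _ (\int[leb]_(t in (`[1%R, 2%R]%classic : set R)) (expR (- 2))%:E)%E).
  have m1 : leb (`[1%R, 2%R]%classic : set R) = (2 - 1)%:E.
    by rewrite lebesgue_measure_itv/= lte_fin ltrDl ltr01.
  rewrite (@integral_cst _ TR R leb _ m12) -[X in (_ * X)%E]/(leb (`[1%R, 2%R]%classic : set R)) m1.
  by rewrite -EFinM lte_fin mulr_gt0 ?expR_gt0//; lra.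
apply: (@le_trans _ _ (\int[leb]_(t in (`[1%R, 2%R]%classic : set R)) (t `^ (z - 1) * expR (- t))%:E)%E).
  apply: ge0_le_integral => //.
  - exact: measurable_funS mf.
  - move=> t; rewrite /= in_itv/= => /andP[t1 t2]; rewrite lee_fin.
    apply: (@le_trans _ _ (expR (- t))); first by rewrite ler_expR lerN2.
    rewrite ler_peMl ?expR_ge0// -[leLHS](powRr0 t) ler_powR//; lra.
apply: (@ge0_subset_integral _ TR R leb _ _ m12 mh _ mf _ sub).
by move=> t _; rewrite lee_fin.
Qed.

(** The powers of 1 - cos cancel between the Legendre function and the power
    of sin, which leaves a power of 1 + cos. *)
Lemma legendre_prefactor (a theta : R) : 0 < theta < pi ->
  2 `^ a / sin theta `^ a * ((1 + cos theta) / (1 - cos theta)) `^ (- a / 2) =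
  (1 - (1 - cos theta) / 2) `^ (- a).
Proof.
move=> th; have s0 : 0 < sin theta by apply: sin_gt0_pi.
have xi1 : -1 < cos theta by apply: cos_gtN1; move: th; lra.
have xi2 : cos theta < 1.
  by have := sin2cos2 theta; have := exprn_gt0 2 s0; nra.
have sE : sin theta = ((1 + cos theta) * (1 - cos theta)) `^ 2^-1.
  rewrite powR12_sqrt; last by rewrite mulr_ge0; lra.
  by rewrite (_ : _ * _ = sin theta ^+ 2) ?sqrtr_sqr ?gtr0_norm// sin2cos2; ring.
have invE (x b : R) : 0 < x -> x^-1 `^ b = (x `^ b)^-1.
  by move=> x0; rewrite -(powR_inv1 (ltW x0)) -powRrM mulN1r powRN.
rewrite sE -powRrM.
have -> : 1 - (1 - cos theta) / 2 = (1 + cos theta) * 2^-1 by field.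
have c1 : 0 < 1 + cos theta by lra.
have c2 : 0 < 1 - cos theta by lra.
move: (1 + cos theta) (1 - cos theta) c1 c2 => x y x0 y0.
rewrite !powRM ?invr_ge0 ?(ltW x0) ?(ltW y0)// !invE//.
rewrite (_ : - a / 2 = - (2^-1 * a)); last by field.
rewrite (_ : x `^ (- a) = x `^ (- (2^-1 * a)) * x `^ (- (2^-1 * a))); last first.
  by rewrite -powRD ?(gt_eqF x0) ?implybT//; congr (_ `^ _); field.
have p0 (z b : R) : 0 < z -> z `^ b != 0 by move=> z0; rewrite gt_eqF// powR_gt0.
rewrite !powRN.
by field; rewrite !p0.
Qed.

Lemma sin_pi_neq0 (q : nat) rho : q%:R < rho < q.+1%:R -> sin (pi * rho) != 0.
Proof.
move=> /andP[r1 r2].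
have -> : pi * rho = pi * (rho - q%:R) + pi *+ q by rewrite -mulr_natr; ring.
have -> (x : R) : sin (x + pi *+ q) = (-1) ^+ q * sin x.
  elim: q {r1 r2} => [|q IH]; first by rewrite mulr0n addr0 expr0 mul1r.
  by rewrite mulrSr addrA sinDpi IH exprS mulN1r mulNr.
rewrite mulf_neq0// ?signr_eq0// gt_eqF// sin_gt0_pi// mulr_gt0 ?pi_gt0 ?subr_gt0//=.
rewrite -[ltRHS]mulr1 ltr_pM2l ?pi_gt0// ltrBlDl -(natrD _ q 1) addn1 //.
Qed.

(** The two degrees exchange the first two parameters of the hypergeometric
    function. In the product of the rho + k the last factor is that of the
    indicator, and the others come from mellin_at1. *)
Lemma legendre_mellin n rho Delta q theta nu : (3 <= n)%N -> 0 < rho ->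
  valid q.+1 rho ((n%:R - 2) / 2) -> 0 < theta < pi ->
  nu = - rho - (n%:R - 1) / 2 \/ nu = rho + (n%:R - 3) / 2 ->
  indicator_legendre n rho Delta nu theta =
  (rho + n%:R - 2) * Delta * - mellin q.+1 rho ((n%:R - 2) / 2) (cos theta).
Proof.
move=> n3 rho0 v th nuE.
have -> : indicator_legendre n rho Delta nu theta =
    indicator_legendre n rho Delta (- rho - (n%:R - 1) / 2) theta.
  case: nuE => -> //; rewrite /indicator_legendre /legendreP hyp2F1C.
  rewrite (_ : - (rho + (n%:R - 3) / 2) = - rho - (n%:R - 1) / 2 + 1); last by field.
  by rewrite (_ : rho + (n%:R - 3) / 2 + 1 = - (- rho - (n%:R - 1) / 2)); last by field.
have nN : n = (n - 2).+2 by rewrite -addn2 subnK// ltnW.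
have rI : q%:R < rho < q.+1%:R := v.
have S0 := sin_pi_neq0 rI.
move: (n - 2)%N nN n3 v => N -> n3 v {nuE}.
have N0 : (0 < N)%N by [].
have NE : N.+2%:R = N%:R + 2 :> R by rewrite -addn2 natrD.
have lamE : (N.+2%:R - 2) / 2 = N%:R / 2 :> R by rewrite NE addrK.
rewrite lamE in v *.
pose z := (1 - cos theta) / 2.
have th' : 0 <= theta < pi by move: th => /andP[/ltW -> ->].
have xi1 := cos_gtN1 th'.
have z01 : 0 <= z < 1 by have := cos_le1 theta; rewrite /z; lra.
have cE : cos theta = 1 - 2 * z by rewrite /z; field.
have M := mellin_legendre N0 rho0 v z01.
rewrite -cE in M; rewrite M.
have at1 : sin (pi * rho) * mellin q.+1 rho (N%:R / 2) 1 =
  - pi * (\prod_(1 <= i < N) (rho + i%:R)) / (N.-1)`!%:R by apply: mellin_at1.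
have pre := legendre_prefactor ((N.+2%:R - 3) / 2) th.
have G0 := Gamma_gt0 n3.
rewrite /indicator_legendre /legendreP -/z.
rewrite (_ : (3 - N.+2%:R) / 2 / 2 = - ((N.+2%:R - 3) / 2) / 2); last by field.
rewrite (_ : 1 - (3 - N.+2%:R) / 2 = (N.+2%:R - 1) / 2); last by field.
rewrite (_ : (N.+2 - 3)%N = N.-1); last by rewrite subSS subSS subn1.
rewrite (_ : 2^-1 - N%:R / 2 = - ((N.+2%:R - 3) / 2)); last by rewrite NE; field.
rewrite -/z in pre; rewrite -pre.
rewrite (_ : - (- rho - (N.+2%:R - 1) / 2) = N%:R / 2 + 2^-1 + rho); last by rewrite NE; field.
rewrite (_ : - rho - (N.+2%:R - 1) / 2 + 1 = - ((N.+2%:R - 3) / 2) - rho); last by rewrite NE; field.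
rewrite (_ : (N.+2%:R - 1) / 2 = N%:R / 2 + 2^-1) in G0 *; last by rewrite NE; field.
rewrite [N.+2.-1]/= big_nat_recr//=.
have s0 : sin theta `^ ((N.+2%:R - 3) / 2) != 0 by rewrite gt_eqF// powR_gt0// sin_gt0_pi.
have f0 : (N.-1)`!%:R != 0 :> R by rewrite pnatr_eq0 -lt0n fact_gt0.
rewrite NE.
move: at1 s0 f0 S0 (gt_eqF G0).
rewrite NE.
move: (hyp2F1 _ _ _ _) (mellin _ _ _ _) (Gamma _) (sin theta `^ _) (2 `^ _) ((_ / _) `^ _) (\prod_(1 <= i < N) _) => Hh M1 G s P X Y.
move: (sin _) ((N.-1)`!%:R) => S F at1 s0 f0 S0 /negbT G0'.
have -> : M1 = - pi * Y / F / S by rewrite -at1 mulrC mulKf.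
by field; rewrite S0 f0 s0 G0'.
Qed.

End indicator.

(** * Limits in the angle *)

Section angles.
Context {R : realType}.
Implicit Types (lam xi r s t rho theta : R) (k : nat).

Lemma mellin_cos_cvg0 k rho lam : valid k rho lam -> 0 < lam ->
  mellin k rho lam (cos theta) @[theta --> 0^'+] --> mellin k rho lam (cos 0).
Proof.
move=> v lam0; apply: cvg_at_right_filter.
apply: (@continuous_comp _ _ _ (@cos R) (mellin k rho lam) 0); first exact: continuous_cos.
by apply: (der_continuous (der_mellin v lam0 _)); rewrite cos0; lra.
Qed.

Lemma mellin_cos_cvg_pi k rho lam : valid k.+1 rho lam -> 2^-1 <= lam ->
  mellin k.+1 rho lam (cos theta) @[theta --> pi^'-] --> +oo.
Proof.
move=> v lam2; apply: (cvg_comp (@cos R) (mellin k.+1 rho lam) _ (mellin_diverges v lam2)).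
move=> A [e /= e0 HA].
have : cos theta @[theta --> (pi : R)] --> cos (pi : R) by exact: continuous_cos.
rewrite cospi => /cvgr_dist_lt/(_ e e0) cd.
near=> theta; apply: HA => /=.
  by near: theta; apply: cvg_within; exact: cd.
apply: cos_gtN1; apply/andP; split; last by near: theta; exact: nbhs_left_lt.
by near: theta; apply: nbhs_left_ge; exact: pi_gt0.
Unshelve. all: by end_near. Qed.

End angles.

(** * The distribution function of the masses *)

Section masses.
Context {R : realType} {n : nat} (mu : {measure set (borelRn R n) -> \bar R}).
Hypothesis mu_fin : locally_finite mu.
Hypothesis mu_ball : mu (ecball 0 1) = 0%E.
Local Notation TR := (measurableTypeR R).
Local Notation nu := (lebesgue_stieltjes_measure (mass_fun mu_fin)).

Lemma mass_small (t : R) : t <= 1 -> mass mu t = 0.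
Proof.
move=> t1; apply/eqP; rewrite eq_le; apply/andP; split; last by rewrite /mass fine_ge0.
by rewrite (le_trans (mass_nondecreasing mu_fin t1))// /mass mu_ball.
Qed.

Lemma stieltjes_mass (x : R) : 0 < x -> nu (`]0, x]%classic : set TR) = (mass mu x)%:E.
Proof.
move=> x0; rewrite /lebesgue_stieltjes_measure /measure_extension measurable_mu_extE/=; last exact: is_ocitv.
rewrite wlength_itv_bnd ?(ltW x0)//=; congr (_%:E); rewrite /mass_fun (mass_small ler01); exact: subr0.
Qed.

Lemma mass_ge0 (x : R) : 0 <= mass mu x.
Proof. by rewrite /mass fine_ge0. Qed.

Variables rho Delta : R.
Hypothesis n_lim : t `^ (- rho) * counting_fun mu t @[t --> +oo] --> Delta.

Lemma mass_limit : x `^ (- rho - (n - 2)%:R) * mass mu x @[x --> +oo] --> Delta.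
Proof.
apply: cvg_trans n_lim; apply: near_eq_cvg; near=> x.
have x0 : 0 < x by near: x; exact: nbhs_pinfty_gt.
rewrite /counting_fun powRD ?(gt_eqF x0) ?implybT// -mulrA; congr (_ * (_ * _)).
by rewrite powR_invn ?(ltW x0).
Unshelve. all: by end_near. Qed.

Lemma density_ge0 : 0 <= Delta.
Proof.
rewrite leNgt; apply/negP => D0; have /cvgr_lt/(_ 0 D0) := mass_limit.
by move/filter_ex => [x]; rewrite ltNge mulr_ge0 ?powR_ge0 ?mass_ge0.
Qed.

Lemma mass_bound : 0 < rho -> exists C, forall x, 0 < x ->
  mass mu x <= C * x `^ (rho + (n - 2)%:R).
Proof.
move=> rho0; have /cvgr_le/(_ (Delta + 1)) := mass_limit.
rewrite ltrDl => /(_ ltr01)[T [_ HT]].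
pose T1 := Num.max T 1.
have D1 : 0 <= Delta + 1 by have := density_ge0; lra.
exists (Delta + 1 + mass mu (T1 + 1)) => x x0; have [x1|x1] := leP x 1.
  by rewrite mass_small// mulr_ge0 ?powR_ge0// addr_ge0 ?mass_ge0.
rewrite mulrDl; have [xT|xT] := leP x (T1 + 1).
  rewrite -[leLHS]add0r lerD ?mulr_ge0 ?powR_ge0//.
  apply: (le_trans (mass_nondecreasing mu_fin xT)).
  rewrite ler_peMr ?mass_ge0// -[leLHS](powRr0 x) ler_powR ?(ltW x1)//.
  by rewrite addr_ge0 ?(ltW rho0).
rewrite -[leLHS]addr0 lerD ?mulr_ge0 ?powR_ge0 ?mass_ge0//.
have /HT : T < x.
  apply: le_lt_trans _ xT; apply: (@le_trans _ _ T1); first by rewrite le_max lexx.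
  by rewrite lerDl.
rewrite -opprD powRN mulrC ler_pdivrMr ?powR_gt0//.
Qed.

End masses.

(** * Points of a ray *)

Section rays.
Context {R : realType} {n : nat}.
Implicit Types (e : 'rV[R]_n) (r theta : R).

Lemma enormZ r e : 0 <= r -> enorm (r *: e) = r * enorm e.
Proof.
move=> r0; rewrite /enorm /dotp.
under eq_bigr do rewrite !mxE mulrACA -expr2.
by rewrite -mulr_sumr sqrtrM ?sqr_ge0// sqrtr_sqr ger0_norm.
Qed.

Lemma spherical_ray e theta r : 0 < r -> spherical e 1 theta ->
  spherical (r *: e) r theta.
Proof.
move=> r0 [e_1 th ec]; split => //.
  by rewrite enormZ ?(ltW r0)// -e_1 mulr1.
rewrite /dotp; under eq_bigr do rewrite mxE -mulrA.
by rewrite -mulr_sumr -/(dotp e e1) ec mul1r.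
Qed.

Lemma spherical_e1 : (0 < n)%N -> spherical (e1 : 'rV[R]_n) 1 0.
Proof.
move=> n0.
have d1 : dotp (e1 : 'rV[R]_n) e1 = 1.
  rewrite /dotp (bigD1 (Ordinal n0))//= !mxE eqxx mulr1 big1 ?addr0// => i i0.
  by rewrite !mxE (_ : (i == 0 :> nat) = false) ?mul0r//; apply: negbTE.
split; [by rewrite /enorm d1 sqrtr1|by rewrite lexx pi_ge0|by rewrite d1 cos0 mulr1].
Qed.

End rays.

(** * The potential along rays *)

Section representation.
Context {R : realType} {n : nat} (u : 'rV[R]_n -> \bar R) (q : nat).
Variable mu : {measure set (borelRn R n) -> \bar R}.
Hypothesis hn : (3 <= n)%N.
Hypothesis mu_fin : locally_finite mu.
Hypothesis mu_ball : mu (ecball 0 1) = 0%E.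
Local Notation TR := (measurableTypeR R).
Local Notation half := (`]0, +oo[%classic : set R).
Local Notation nu := (lebesgue_stieltjes_measure (mass_fun mu_fin)).
Local Notation lam := ((n%:R - 2) / 2 : R).
Hypothesis u_repr : forall (x : 'rV[R]_n) (r theta : R), spherical x r theta ->
  u x = (\int[nu]_(t in `]0%R, +oo[)
           ((t ^- (n - 2))%:E * hadamard_kernel n (r / t) theta q))%E.

Lemma lam_ge : 2^-1 <= lam.
Proof. by have : 3 <= n%:R :> R by [rewrite (ler_nat R 3)]; lra. Qed.

Lemma u_ray (e : 'rV[R]_n) (theta r : R) : spherical e 1 theta -> theta < pi -> 0 < r ->
  u (r *: e) = (\int[nu]_(t in (half : set TR))
    (t ^- (n - 2) * - remainder lam (cos theta) q.+1 (r / t))%:E)%E.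
Proof.
move=> es tp r0; have [_ /andP[t0 _] _] := es.
rewrite (u_repr (spherical_ray r0 es)); apply: eq_integral => t.
rewrite inE/= in_itv/= andbT => t_gt0; rewrite kernelE// quad_gt0//.
  by apply: cos_gtN1; rewrite t0.
by rewrite divr_ge0 ?ltW.
Qed.

Lemma u_ray_pi (e : 'rV[R]_n) (r : R) : spherical e 1 pi -> 0 < r ->
  u (r *: e) = (\int[nu]_(t in (half : set TR))
    ((t ^- (n - 2))%:E * remainder_pi lam q.+1 (r / t)))%E.
Proof.
move=> es r0; rewrite (u_repr (spherical_ray r0 es)); apply: eq_integral => t _.
by rewrite kernel_piE//; have := lam_ge; lra.
Qed.

(** A constant distribution function gives measure 0 to the half open intervals,
    hence to all measurable sets. *)
Lemma massless_potential (x : 'rV[R]_n) (r theta : R) : (forall t, mass mu t = 0) ->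
  spherical x r theta -> u x = 0%E.
Proof.
move=> m0 /u_repr ->.
have nu0 := @lebesgue_stieltjes_measure_unique R (mass_fun mu_fin) mzero.
rewrite (@eq_measure_integral _ TR R _ mzero); first exact: integral_measure_zero.
move=> A mA _; apply: nu0 => // X /[dup] oX /ocitvP[->|[[a b] /= ab ->]].
  by rewrite measure0.
rewrite /lebesgue_stieltjes_measure /measure_extension measurable_mu_extE/=; last exact: is_ocitv.
by rewrite wlength_itv_bnd ?(ltW ab)//= /mass_fun !m0 subrr.
Qed.

(** For q = 0 the kernel at theta = 0 is 1 - (1 + s)^(2-n), which is nonnegative
    and at least 1/2 for s >= 1. *)
Lemma potential_lower (T r : R) : q = 0%N -> 0 < T <= r ->
  ((T ^- (n - 2) * 2^-1 * mass mu T)%:E <= u (r *: e1))%E.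
Proof.
move=> q0 /andP[T0 Tr]; have r0 := lt_le_trans T0 Tr.
rewrite (u_ray (spherical_e1 (ltnW (ltnW hn))) (pi_gt0 R) r0) cos0 q0.
have l2 := lam_ge.
have rE (s : R) : 0 <= s -> - remainder lam 1 1 s = 1 - (1 + s) `^ (- 2 * lam).
  by move=> s0; rewrite /remainder genfun1// big_ord1 coef0 expr0 mulr1 opprB.
have r_ge0 (s : R) : 0 <= s -> 0 <= - remainder lam 1 1 s.
  move=> s0; rewrite rE// subr_ge0 -[leRHS](powRr0 (1 + s)) ler_powR ?lerDl//; lra.
have r_ge (s : R) : 1 <= s -> 2^-1 <= - remainder lam 1 1 s.
  move=> s1; rewrite rE; last by lra.
  have : (1 + s) `^ (- 2 * lam) <= 2 `^ (-1).
    rewrite mulNr; apply: (@le_trans _ _ (2 `^ (- (2 * lam)))).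
      by apply: powR_opp_le; lra.
    by apply: ler_powR; lra.
  by rewrite powR_inv1//; lra.
have mh : measurable (half : set TR) by exact: measurable_itv.
have mT : measurable (`]0, T]%classic : set TR) by exact: measurable_itv.
have sub : (`]0, T]%classic : set R) `<=` half.
  by move=> s; rewrite /= !in_itv/= andbT => /andP[].
have mf : measurable_fun (half : set TR)
    (fun t => (t ^- (n - 2) * - remainder lam 1 1 (r / t))%:E).
  apply/measurable_EFinP; apply: measurable_funM; first exact: measurable_pow_inv.
  apply: measurableT_comp => //.
  apply: (@measurable_comp _ _ _ TR TR TR setT (remainder lam 1 1) half (fun t => r / t)) => //.
    exact: measurable_remainder.
  exact: measurable_ratio.
pose I1 : \bar R := (\int[nu]_(t in (`]0%R, T]%classic : set TR)) (T ^- (n - 2) * 2^-1)%:E)%E.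
pose I2 : \bar R := (\int[nu]_(t in (`]0%R, T]%classic : set TR))
   (t ^- (n - 2) * - remainder lam 1 1 (r / t))%:E)%E.
apply: (@le_trans _ _ I1).
  have mE := stieltjes_mass mu_fin mu_ball T0.
  rewrite /I1 (@integral_cst _ TR R nu _ mT) EFinM.
  by rewrite -[X in (_ <= _ * X)%E]/(nu (`]0, T]%classic : set TR)) mE.
apply: (@le_trans _ _ I2).
  apply: ge0_le_integral => //.
  - by move=> t _; rewrite lee_fin mulr_ge0// invr_ge0 exprn_ge0// ltW.
  - exact: measurable_funS mf.
  - move=> t; rewrite /= in_itv/= => /andP[t0 tT]; rewrite lee_fin.
    apply: ler_pM; rewrite ?invr_ge0 ?exprn_ge0 ?(ltW T0)//.
      by rewrite lef_pV2 ?posrE ?exprn_gt0// lerXn2r ?nnegrE ?(ltW t0) ?(ltW T0).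
    by apply: r_ge; rewrite ler_pdivlMr// mul1r (le_trans tT).
apply: (@ge0_subset_integral _ TR R nu _ _ mT mh _ mf _ sub).
move=> t; rewrite /= in_itv/= andbT => t0; rewrite lee_fin mulr_ge0//.
  by rewrite invr_ge0 exprn_ge0// ltW.
by rewrite r_ge0// divr_ge0// ltW.
Qed.

(** At a negative order the potential would tend to 0 along the positive axis,
    where it increases from 0. *)
Lemma negative_order_massless rho : q = 0%N -> rho < 0 -> has_finite_type u rho ->
  forall t, mass mu t = 0.
Proof.
move=> q0 rho0 [C uC] t.
have [t0|t0] := leP t 0; first by rewrite mass_small//; lra.
apply/eqP; rewrite eq_le mass_ge0 andbT leNgt; apply/negP => m0.
pose d := t ^- (n - 2) * 2^-1 * mass mu t.
have d0 : 0 < d by rewrite !mulr_gt0// invr_gt0 exprn_gt0.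
have /cvgryPge/(_ ((C + 1) / d)) big := @powR_cvgy R (- rho) ltac:(by rewrite oppr_gt0).
suff : \forall r \near (+oo : set_system R), False by move/filter_ex => [].
near=> r.
have tr : t <= r by near: r; apply: nbhs_pinfty_ge; rewrite num_real.
have r0 : 0 < r by exact: lt_le_trans tr.
have h1 : (d%:E <= u (r *: e1))%E by apply: potential_lower; rewrite // t0.
have h2 : (u (r *: e1) <= max_sphere u r)%E.
  apply: ereal_sup_ubound; exists (r *: e1) => //.
  by rewrite /esphere /= subr0; have [<-] := spherical_ray r0 (@spherical_e1 R n (ltnW (ltnW hn))).
have h3 : (`|max_sphere u r| <= (C * r `^ rho)%:E)%E by near: r; exact: uC.
have : (d%:E <= (C * r `^ rho)%:E)%E.
  by apply: le_trans h1 (le_trans h2 (le_trans (lee_abs _) h3)).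
have : (C + 1) / d <= r `^ (- rho) by near: r; exact: big.
rewrite lee_fin ler_pdivrMr// -[r `^ rho]invrK -powRN ler_pdivlMr ?powR_gt0//.
by rewrite mulrC; lra.
Unshelve. all: by end_near. Qed.

End representation.

(** * The indicator of the potential *)

Lemma indicator_zero (R : realType) n (rho : R) q theta :
  indicator_integral n rho 0 q theta = 0%E.
Proof. by rewrite /indicator_integral mulr0 mul0e. Qed.

Lemma indicator_legendre_zero (R : realType) n (rho nu theta : R) :
  indicator_legendre n rho 0 nu theta = 0.
Proof. by rewrite /indicator_legendre mulr0 !mul0r. Qed.

Lemma truncn_nonint (R : realType) (rho : R) : rho \isn't a Num.int -> 0 < rho ->
  (Num.truncn rho)%:R < rho < (Num.truncn rho).+1%:R.
Proof.
move=> ni /ltW/truncn_itv/andP[r1 ->]; rewrite andbT lt_neqAle r1 andbT.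
by apply: contraNneq ni => <-.
Qed.

Theorem proposition1 (R : realType) (n : nat) (hn : (3 <= n)%N)
  (u : 'rV[R]_n -> \bar R) (rho : R) (q : nat)
  (u_sub : subharmonic u)
  (u_order : has_order u rho)
  (rho_nint : rho \isn't a Num.int)
  (u_type : has_finite_type u rho)
  (hq : q = Num.truncn rho)
  (mu : {measure set (borelRn R n) -> \bar R})
  (mu_fin : locally_finite mu)
  (mu_riesz : riesz_measure u mu)
  (mu_axis : mu (~` neg_axis) = 0%E)
  (mu_ball : mu (ecball 0 1) = 0%E)
  (u_repr : forall (x : 'rV[R]_n) (r theta : R), spherical x r theta ->
     u x = (\int[lebesgue_stieltjes_measure (mass_fun mu_fin)]_(t in `]0%R, +oo[)
              ((t ^- (n - 2))%:E * hadamard_kernel n (r / t) theta q))%E)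
  (Delta : R)
  (n_lim : t `^ (- rho) * counting_fun mu t @[t --> +oo] --> Delta) :
  let H := indicator_integral n rho Delta q in
  let L := indicator_legendre n rho Delta in
  [/\ (* the limit along every ray off the negative axis *)
      forall (e : 'rV[R]_n) (theta : R), spherical e 1 theta -> theta < pi ->
        ((r `^ (- rho))%:E * u (r *: e))%E @[r --> +oo] --> H theta,
      (* the Legendre formulas for 0 < theta < pi *)
      forall theta : R, 0 < theta < pi ->
        H theta = (L (- rho - (n%:R - 1) / 2) theta)%:E /\
        H theta = (L (rho + (n%:R - 3) / 2) theta)%:E,
      (* the Legendre formulas at theta = 0, as limits *)
      (L (- rho - (n%:R - 1) / 2) theta)%:E @[theta --> 0^'+] --> H 0 /\
      (L (rho + (n%:R - 3) / 2) theta)%:E @[theta --> 0^'+] --> H 0,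
      (* the last formula at theta = pi, as a limit *)
      (L (rho + (n%:R - 3) / 2) theta)%:E @[theta --> pi^'-] --> H pi &
      (* the common value at theta = pi *)
      Delta != 0 ->
        H pi = -oo%E /\
        forall e : 'rV[R]_n, spherical e 1 pi ->
          ((r `^ (- rho))%:E * u (r *: e))%E @[r --> +oo] --> -oo%E].
Proof.
move=> H L.
have lam2 := @lam_ge R n hn.
have lam0 : (0 : R) < (n%:R - 2) / 2 by lra.
have n20 : (0 < n - 2)%N by rewrite subn_gt0.
(* At a negative order there are no masses: u, H, L and Delta all vanish. *)
have [rho0|rho0] := ltP 0 rho; last first.
  have rho0' : rho < 0.
    by rewrite lt_neqAle rho0 andbT; apply: contraNneq rho_nint => ->.
  have q0 : q = 0%N.
    by rewrite hq truncn_floor leNgt rho0'.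
  have m0 := negative_order_massless hn mu_ball u_repr q0 rho0' u_type.
  have D0 : Delta = 0.
    have lim0 : x `^ (- rho - (n - 2)%:R) * mass mu x @[x --> +oo] --> (0 : R).
      by under eq_fun do rewrite m0 mulr0; exact: cvg_cst.
    exact: (cvg_unique _ (mass_limit n_lim) lim0).
  rewrite /H /L D0; split.
  - move=> e theta es _; rewrite indicator_zero.
    have zero : (0%E : \bar R) @[_ --> (+oo : set_system R)] --> (0%E : \bar R) by exact: cvg_cst.
    apply: cvg_trans zero; apply: near_eq_cvg; near=> r.
    have r0 : 0 < r by near: r; exact: nbhs_pinfty_gt.
    by rewrite (massless_potential u_repr m0 (spherical_ray r0 es)) mule0.
  - by move=> theta _; rewrite indicator_zero !indicator_legendre_zero.
  - by split; rewrite indicator_zero; under eq_fun do rewrite indicator_legendre_zero; exact: cvg_cst.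
  - by rewrite indicator_zero; under eq_fun do rewrite indicator_legendre_zero; exact: cvg_cst.
  - by rewrite eqxx.
have v : valid q.+1 rho ((n%:R - 2) / 2) by rewrite /valid/= hq truncn_nonint.
have nE : n%:R - 2 = (n - 2)%:R :> R by rewrite natrB// ltnW.
have rnE : rho + n%:R - 2 = rho + (n - 2)%:R by rewrite -nE addrA.
have HE theta : 0 <= theta < pi -> H theta =
    ((rho + n%:R - 2) * Delta * - mellin q.+1 rho ((n%:R - 2) / 2) (cos theta))%:E.
  exact: indicatorE.
have LE nu theta : nu = - rho - (n%:R - 1) / 2 \/ nu = rho + (n%:R - 3) / 2 -> 0 < theta < pi ->
    L nu theta = (rho + n%:R - 2) * Delta * - mellin q.+1 rho ((n%:R - 2) / 2) (cos theta).
  by move=> nuE th; rewrite /L; exact: legendre_mellin.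
have Dge0 := density_ge0 n_lim.
have [C mC] := mass_bound mu_fin mu_ball n_lim rho0.
have mD := mass_limit n_lim.
have num := stieltjes_mass mu_fin mu_ball.
have m_nd := mass_nondecreasing mu_fin.
have L0 nu : nu = - rho - (n%:R - 1) / 2 \/ nu = rho + (n%:R - 3) / 2 ->
    (L nu theta)%:E @[theta --> 0^'+] --> H 0.
  move=> nuE; rewrite HE ?lexx ?pi_gt0//.
  suff c : L nu theta @[theta --> 0^'+] -->
      (rho + n%:R - 2) * Delta * - mellin q.+1 rho ((n%:R - 2) / 2) (cos 0).
    by apply: (cvg_comp _ EFin c); apply: cvg_EFin; [exact: nearW|exact: cvg_id].
  have c : (rho + n%:R - 2) * Delta * - mellin q.+1 rho ((n%:R - 2) / 2) (cos theta)
      @[theta --> 0^'+] --> (rho + n%:R - 2) * Delta * - mellin q.+1 rho ((n%:R - 2) / 2) (cos 0).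
    by apply: cvgMr; apply: cvgN; exact: mellin_cos_cvg0.
  apply: cvg_trans c; apply: near_eq_cvg; near=> theta.
  rewrite LE//; apply/andP; split; near: theta; first exact: nbhs_right_gt.
  by apply: nbhs_right_lt; exact: pi_gt0.
split.
- move=> e theta es tp; have [_ /andP[t0 _] _] := es.
  have th : 0 <= theta < pi by rewrite t0.
  rewrite HE// rnE.
  have := @ray_limit R (lebesgue_stieltjes_measure (mass_fun mu_fin)) (mass mu) (n - 2)
    rho C Delta n20 num m_nd mC mD q ((n%:R - 2) / 2) (cos theta) 0 v lam0 (cos_gtN1 th).
  have E0 (a b : R) : a + 0 * b = a by rewrite mul0r addr0.
  rewrite (E0 (- mellin q.+1 rho ((n%:R - 2) / 2) (cos theta)) (bump_mellin q.+1 rho)).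
  apply: cvg_trans; apply: near_eq_cvg; near=> r.
  have r0 : 0 < r by near: r; exact: nbhs_pinfty_gt.
  rewrite (u_ray u_repr es tp r0); congr (_ * _)%E.
  by apply: eq_integral => t _; rewrite E0.
- move=> theta th; have th' : 0 <= theta < pi by move: th => /andP[/ltW -> ->].
  by rewrite HE// !LE//; [right|left].
- by split; apply: L0; [left|right].
- have [D0|D0] := eqVneq Delta 0.
    rewrite /H /L D0 indicator_zero.
    by under eq_fun do rewrite indicator_legendre_zero; exact: cvg_cst.
  have Dgt0 : 0 < Delta by rewrite lt_neqAle eq_sym D0.
  rewrite /H indicator_pi//; apply/cvgerNyP.
  have c0 : 0 < (rho + n%:R - 2) * Delta by rewrite mulr_gt0// rnE addr_gt0// ltr0n.
  have c := gt0_cvgMry c0 (mellin_cos_cvg_pi v lam2).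
  have c' : - ((rho + n%:R - 2) * Delta * mellin q.+1 rho ((n%:R - 2) / 2) (cos theta))
      @[theta --> pi^'-] --> -oo by apply/cvgNrNy; exact: c.
  apply: cvg_trans c'; apply: near_eq_cvg; near=> theta.
  rewrite LE; [|by right|]; first by rewrite mulrN.
  apply/andP; split; near: theta; last exact: nbhs_left_lt.
  by apply: nbhs_left_gt; exact: pi_gt0.
- move=> D0; have Dgt0 : 0 < Delta by rewrite lt_neqAle eq_sym D0.
  split; first by rewrite /H indicator_pi.
  move=> e es.
  have := @pi_limit R (lebesgue_stieltjes_measure (mass_fun mu_fin)) (mass mu) (n - 2)
    rho C Delta n20 num m_nd mC mD q ((n%:R - 2) / 2) v lam2 rho0 Dgt0.
  apply: cvg_trans; apply: near_eq_cvg; near=> r.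
  have r0 : 0 < r by near: r; exact: nbhs_pinfty_gt.
  by rewrite (u_ray_pi hn u_repr es r0).
Unshelve. all: by end_near. Qed.
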